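(* Let $p,q\ge2$ be integers and let $G=\mathrm{DL}(p,q)$ be the Diestel--Leader graph with origin $(o,o')$, with the counting measure on its vertices, and $F(n)$ the number of vertices in the ball $B_n((o,o'))$. Then $F|_{\mathbb N}$ is log-regularly-varying with positive index, and the uniform probability measure on $B_n((o,o'))$ converges weakly in $\overline G$ as $n\to\infty$ to a probability measure $\nu_0$ on $\partial\,\mathrm{DL}(p,q)$. If $p\ge q$, then the index of $F|_{\mathbb N}$ is $\ln p$. In addition, $\nu_0$ has the following description: (i) If $p>q$, then $\nu_0$ is concentrated on $\partial T\subseteq\partial\,\mathrm{DL}(p,q)$ and is the harmonic measure on $\partial T$. In this case, for every $\xi$ there is $\xi'$ such that $\mathrm{IPVT}_\xi(\mathrm{DL}(p,q))=\pi^{-1}(\mathrm{IPVT}_{\xi'}(T))$ in distribution, where $\pi:\mathrm{DL}(p,q)\to T$ is the projection on the first coordinate. (ii) If $p=q$, then $\nu_0$ is the average of the harmonic measures on $\partial T$ and $\partial T'$. In addition, the edge-measured version $E$ of $\mathrm{DL}(p,q)$ (for $p\geq q$) satisfies the following: its volume function restricted to $\mathbb N$ is log-regularly-varying with the same index $\ln p$; the probability measures $\alpha^{(n)}$ converge weakly to a probability measure $\alpha$ on $(\partial\,\mathrm{DL}(p,q))^2$; and, for every $t\in[0,1)$, the measure $\nu_t$ on $\partial E$ determined by $\alpha$ is identical to the measure $\nu_0$ of the vertex-measured version, i.e. to the weak limit as $n\to\infty$ of the uniform probability measure on the vertices of $B_n((o,o'))$ (the harmonic measure on $\partial T$ if $p>q$,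 and the average of the harmonic measures on $\partial T$ and $\partial T'$ if $p=q$), regarded as a measure on $\partial E$ via $\partial G\subset\partial E$.
   Context: Diestel--Leader graph. $\mathcal T^{(p)}$ is the $(p+1)$-regular tree; $T=\mathcal T^{(p)}$, $T'=\mathcal T^{(q)}$ with fixed vertices $o,o'$ and fixed ends $\omega_0\in\partial T$, $\omega_0'\in\partial T'$. $u\wedge v$ is the common vertex of the geodesics $uv$, $u\omega_0$, $v\omega_0$, and $h(u)=d(u,u\wedge o)-d(o,u\wedge o)$; $h'$ on $T'$ is defined similarly. $\mathrm{DL}(p,q)$ has vertex set $\{(v,v')\in T\times T':h(v)+h'(v')=0\}$ and $(v,v')\sim(w,w')$ iff $v\sim w$ and $v'\sim w'$. Horoboundary. For a metric space $H$ with origin $o_H$, $\overline H$ is the closure of $\{d(\cdot,x)-d(o_H,x):x\in H\}$ in the space of 1-Lipschitz functions vanishing at $o_H$ (uniform convergence on compacts), $H$ is identified with its image and $\partial H=\overline H\setminus H$; $d_\theta$ is the function of $\theta\in\partial H$. For a tree, $\partial T$ is the space of ends, and $d_\omega(y)=\lim_{x\to\omega}(d(y,x)-d(o,x))$. $\partial T$ is viewed as a subset of $\partial\,\mathrm{DL}(p,q)$ via $\omega\mapsto[(y,y')\mapsto d_\omega(y)]$, and $\partial T'$ via $\omega'\mapsto[(y,y')\mapsto d_{\omega'}(y')]$. The harmonic measure on $\partial T$ (resp. $\partial T'$) is the law of the limit end of simple random walk started at $o$ (resp. $o'$). Log-regular variation. $f:\mathbb N\to\mathbb R^+$ is log-regularly-varying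 with index $b$ if $\lim_nf(n+1)/f(n)=e^b$ exists and is positive. $\mathrm{IPVT}_\xi(H)$ for a vertex-measured graph $H$ (counting measure) with origin $o_H$ such that the number of vertices in the ball $B_n(o_H)$ is log-regularly-varying in $n\in\mathbb N$ with positive index $b$ and the uniform probability measure on $B_n(o_H)$ converges weakly in $\overline H$ as $n\to\infty$ to a probability measure $\nu_0$ on $\partial H$: let $p_H=e^b$ and let $(\Theta_i,\Delta_i)_i$ be the Poisson point process on $\partial H\times\mathbb Z$ with intensity $\nu_0\otimes\beta^{(\xi)}$, $\beta^{(\xi)}(i)=(p_H-1)p_H^{\,i-1+\xi}$. Then $\mathrm{IPVT}_\xi(H)$ is the random unordered collection of the cells $C_i=\{y\in H:d_{\Theta_i}(y)+\Delta_i\le d_{\Theta_j}(y)+\Delta_j\ \forall j\}$. ($\mathcal T^{(p)}$ satisfies these properties with index $\ln p$ and $\nu_0$ the harmonic measure.) $\pi^{-1}$ of a collection is the collection of the inverse images of its members. Edge-measured version. $E$ is obtained from $G=\mathrm{DL}(p,q)$ by replacing each edge by a unit interval with Lebesgue measure, with the path metric; its volume function is the total Lebesgue measure of the closed ball about $(o,o')$. $\alpha^{(n)}$ is the law on $G^2$ of the randomly ordered pair of endpoints of a uniform random edge contained in the ball of radius $n$ but not in the ball of radius $n-1$; convergence is as measures on $\overline G^2$. $\partial G\subset\partial E$, where $f\in\partial G$ is extended by $f(z)=\min\{f(x)+s,f(y)+1-s\}$ at the point $z$ of the edge $xy$ at distance $s$ from $x$. For $t\in[0,1)$, $\nu_t$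 (the conditional law of a boundary nucleus given that the fractional part of its delay is $t$) is the push-forward of $\alpha$ under $(f,g)\mapsto[(\max(f,g)+t)\wedge(\min(f,g)+2-t)]-t$, with pointwise max, min. *)

(* Defs.v *)
From HB Require Import structures.
From mathcomp Require Import all_boot all_order all_algebra finmap.
From mathcomp Require Import all_classical all_reals all_analysis.

Set Implicit Arguments.
Unset Strict Implicit.
Unset Printing Implicit Defensive.

Import Order.TTheory GRing.Theory Num.Theory.
Import numFieldTopology.Exports numFieldNormedType.Exports.

Local Open Scope classical_set_scope.
Local Open Scope ring_scope.

Record rooted_graph := RootedGraph {
  vertex :> choiceType;
  adj : rel vertex;
  org : vertex }.

Arguments adj {G} : rename.
Arguments org {G} : rename.

Section Graphs.
Variable G : rooted_graph.
Implicit Types (x y u v : G) (r s : nat -> G).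

Definition walk_of_length x y (n : nat) : Prop :=
  exists s : seq G, [/\ path adj x s, last x s = y & size s = n].

(* The graph distance; its value 0 on pairs that are not joined by a walk is
   irrelevant, all graphs below being connected. *)
Definition gdist x y : nat :=
  if pselect (exists n, `[< walk_of_length x y n >]) is left ex
  then ex_minn ex else 0%N.

Definition nbr_set x : set G := [set y | adj x y].

Definition degree x : nat := #|` fset_set (nbr_set x)|.

Definition regular_tree (k : nat) : Prop :=
  [/\ symmetric (@adj G) /\ irreflexive (@adj G),
      forall x y, exists n, walk_of_length x y n,
      forall c : seq G, cycle adj c -> uniq c -> (size c <= 2)%N &
      forall x, (nbr_set x #= `I_k)%card].

(* The vertices of the geodesics between [u] and [v]. *)
Definition geod u v : set G :=
  [set x | (gdist u x + gdist x v)%N = gdist u v].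

(* An end of a tree is a class of rays, two rays being equivalent when they
   have a common tail. *)
Definition is_ray r : Prop := (forall n, adj (r n) (r n.+1)) /\ injective r.

Definition cofinal_rays r s : Prop :=
  exists m n, forall k, r (m + k)%N = s (n + k)%N.

Definition tree_end :=
  {A : set (nat -> G) |
    exists2 r, is_ray r & A = [set s | is_ray s /\ cofinal_rays r s]}.

Implicit Type w : tree_end.

Definition geod_end u w : set G :=
  [set x | exists r n, [/\ sval w r, r 0%N = u & r n = x]].

(* The filter "x tends to w": by [geod org x y], the vertex x lies beyond the
   vertex y of the ray from the root to w. *)
Definition end_filter w : set_system G :=
  filter_from (geod_end org w) (fun y => [set x | geod org x y]).

Definition busemann (R : realType) w y : R :=
  lim (((gdist y x)%:R - (gdist org x)%:R : R) @[x --> end_filter w]).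

End Graphs.

Record htree := HTree {
  htree_graph :> rooted_graph;
  end0 : tree_end htree_graph }.

Arguments end0 {T} : rename.

Section Height.
Variable T : htree.
Implicit Types u v x : T.

(* u /\ v, the common vertex of the geodesics u v, u end0 and v end0. *)
Definition confluent u v : T :=
  xget u (geod u v `&` geod_end u end0 `&` geod_end v end0).

Definition height u : int :=
  (gdist u (confluent u org))%:Z - (gdist org (confluent u org))%:Z.

Lemma height_org : height org = 0.
Proof. by rewrite /height subrr. Qed.

End Height.

Section DiestelLeader.
Variables T T' : htree.

Definition dl_vertex := {x : T * T' | height x.1 + height x.2 == 0}.

HB.instance Definition _ := Choice.on dl_vertex.

Definition dl_adj : rel dl_vertex :=
  fun x y => adj (val x).1 (val y).1 && adj (val x).2 (val y).2.

Lemma dl_org_subproof :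
  height (org : T, org : T').1 + height (org : T, org : T').2 == 0.
Proof. by rewrite !height_org addr0. Qed.

Definition dl_org : dl_vertex := exist _ (org, org) dl_org_subproof.

Definition DL : rooted_graph := RootedGraph dl_adj dl_org.

Definition dl_fst (x : DL) : T := (val x).1.
Definition dl_snd (x : DL) : T' := (val x).2.

End DiestelLeader.

Arguments dl_fst {T T'} x.
Arguments dl_snd {T T'} x.

Record mspace (R : realType) := MSpace {
  mcarrier : choiceType;
  mdist : mcarrier -> mcarrier -> R;
  morg : mcarrier }.

Definition mpoint (R : realType) (M : mspace R) : Type := mcarrier M.

Coercion mpoint : mspace >-> Sortclass.

HB.instance Definition _ (R : realType) (M : mspace R) :=
  Choice.copy (mpoint M) (mcarrier M).

HB.instance Definition _ (R : realType) (M : mspace R) :=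
  isSubBaseTopological.Build (mpoint M) (I := set (mpoint M))
    [set B | exists (x : M) (r : R), B = [set y : M | mdist x y < r]] id.

Section Horoboundary.
Variables (R : realType) (M : mspace R).

(* All functions M -> R, with uniform convergence on compact sets. The
   horocompactification is a subset of it, and measures on (parts of) the
   horocompactification are Borel measures on [fspace] carried by it. *)
Definition fspace := {family compact, M -> R}.

HB.instance Definition _ := Uniform.on fspace.
HB.instance Definition _ := isPointed.Build fspace (fun=> 0).

Definition horofun (x : M) : fspace :=
  fun y => mdist y x - mdist (morg M) x.

Definition lipschitz1_0 : set fspace :=
  [set f | f (morg M) = 0 /\ forall x y : M, `|f x - f y| <= mdist x y].

Definition hbar : set fspace := closure (range horofun) `&` lipschitz1_0.

Definition hboundary : set fspace := hbar `\` range horofun.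

End Horoboundary.

Arguments hbar {R} M.
Arguments hboundary {R} M.

Definition gspace (R : realType) (G : rooted_graph) : mspace R :=
  @MSpace R G (fun x y => (gdist x y)%:R) org.

HB.instance Definition _ (X Y : ptopologicalType) := Pointed.on (X * Y)%type.

Definition borel (X : ptopologicalType) := g_sigma_algebraType (@open X).

HB.instance Definition _ (X : ptopologicalType) := Measurable.on (borel X).

Definition same_measure d (X : measurableType d) (R : realType)
    (mu nu : set X -> \bar R) : Prop :=
  forall A, measurable A -> mu A = nu A.

Definition weak_cvg (R : realType) (X : ptopologicalType) (K : set X)
    (mu_ : nat -> {measure set (borel X) -> \bar R})
    (mu : {measure set (borel X) -> \bar R}) : Prop :=
  forall f : X -> R, {within K, continuous f} ->
    (exists M : R, forall x, K x -> `|f x| <= M) ->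
    (\int[mu_ n]_(x in (K : set (borel X))) (f x)%:E)%E @[n --> \oo] -->
    (\int[mu]_(x in (K : set (borel X))) (f x)%:E)%E.

Section UniformLaw.
Context d (X : measurableType d) (R : realType) (U : choiceType).
Variables (phi : U -> X) (B : set U).

Let pts := [seq phi x | x <- fset_set B].

Definition uniform_law : {measure set X -> \bar R} :=
  mscale (R := R) ((size pts)%:R^-1)%:nng
    (msum (fun k => \d_(nth point pts k)) (size pts)).

End UniformLaw.

Definition log_regularly_varying (R : realType) (f : nat -> R) (b : R) : Prop :=
  f n.+1 / f n @[n --> \oo] --> expR b.

Section Growth.
Variables (R : realType) (G : rooted_graph).

Definition gball (n : nat) : set G := [set x | (gdist org x <= n)%N].

Definition gball_size (n : nat) : R := #|` fset_set (gball n)|%:R.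

Definition uniform_ball (n : nat) :
    {measure set (borel (fspace (gspace R G))) -> \bar R} :=
  uniform_law R
    (fun x : G => horofun (x : gspace R G) : borel (fspace (gspace R G)))
    (gball n).

(* The two properties required of a vertex-measured graph in the definition of
   its ideal Poisson--Voronoi tessellations: positive index [b], and boundary
   measure [nu0]. *)
Definition ipvt_ready (b : R)
    (nu0 : probability (borel (fspace (gspace R G))) R) : Prop :=
  [/\ 0 < b, log_regularly_varying gball_size b,
      weak_cvg (hbar (gspace R G)) uniform_ball nu0 &
      nu0 (hboundary (gspace R G)) = 1%E].

End Growth.

Definition ends (T : htree) := tree_end T.

Section Ends.
Variable T : htree.

HB.instance Definition _ := gen_eqMixin (ends T).
HB.instance Definition _ := gen_choiceMixin (ends T).
HB.instance Definition _ := isPointed.Build (ends T) (end0 : ends T).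

(* The topology of the space of ends, generated by the sets of the ends w such
   that the ray u w contains v. *)
HB.instance Definition _ :=
  isSubBaseTopological.Build (ends T) (I := set (ends T))
    [set B | exists u v : T, B = [set w : ends T | geod_end u w v]] id.

End Ends.

Section HarmonicMeasure.
Variable R : realType.

Definition simple_random_walk d (Omega : measurableType d)
    (P : probability Omega R) (G : rooted_graph) (x0 : G) (X : nat -> Omega -> G)
    : Prop :=
  (forall n x, measurable [set w | X n w = x]) /\
  forall (n : nat) (x : nat -> G),
    P [set w | forall i, (i <= n)%N -> X i w = x i] =
    ((x 0%N == x0)%:R *
     \prod_(i < n) ((adj (x i) (x i.+1))%:R / (degree (x i))%:R))%:E.

Definition harmonic_measure (T : htree) (mu : probability (borel (ends T)) R)
    : Prop :=
  exists d (Omega : measurableType d) (P : probability Omega R)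
    (X : nat -> Omega -> T) (Z : Omega -> borel (ends T)),
    [/\ simple_random_walk P org X,
        measurable_fun setT Z,
        {ae P, forall w, X n w @[n --> \oo] --> end_filter (Z w)} &
        same_measure mu (pushforward P Z)].

Definition end_fst (T T' : htree) (w : borel (ends T)) :
    borel (fspace (gspace R (DL T T'))) :=
  fun y : DL T T' => busemann R w (dl_fst y).

Definition end_snd (T T' : htree) (w : borel (ends T')) :
    borel (fspace (gspace R (DL T T'))) :=
  fun y : DL T T' => busemann R w (dl_snd y).

End HarmonicMeasure.

Arguments end_fst R T T' w : clear implicits.
Arguments end_snd R T T' w : clear implicits.

HB.instance Definition _ := isPointed.Build int 0.
HB.instance Definition _ := @isMeasurable.Build default_measure_display
  int discrete_measurable discrete_measurable0
  discrete_measurableC discrete_measurableU.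

Section IPVT.
Variable R : realType.

(* The random points [pts i], i in nat, form a Poisson point process with
   intensity measure [Lambda] (of infinite total mass). *)
Definition poisson_process d (Omega : measurableType d)
    (P : probability Omega R) d' (S : measurableType d')
    (Lambda : set S -> \bar R) (pts : nat -> Omega -> S) : Prop :=
  (forall i, measurable_fun setT (pts i)) /\
  forall (k : nat) (A : 'I_k -> set S),
    (forall j, measurable (A j)) -> trivIset setT A ->
    (forall j, (Lambda (A j) < +oo)%E) ->
    forall n : 'I_k -> nat,
      P [set w | forall j,
           counting [set i | A j (pts i w)] = ((n j)%:R : R)%:E] =
      (\prod_(j < k) (expR (- fine (Lambda (A j))) *
         fine (Lambda (A j)) ^+ n j / (n j)`!%:R))%:E.

Definition delay_intensity (b xi : R) (i : int) : R :=
  (expR b - 1) * (expR b) `^ (i%:~R - 1 + xi).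

Definition nuclei_intensity (G : rooted_graph)
    (nu0 : probability (borel (fspace (gspace R G))) R) (beta : int -> R)
    (A : set (borel (fspace (gspace R G)) * int)) : \bar R :=
  \esum_(i in [set: int]) ((beta i)%:E * nu0 (ysection A i))%E.

Definition voronoi_cell (G : rooted_graph) (theta : nat -> fspace (gspace R G))
    (delta : nat -> int) (i : nat) : set G :=
  [set y | forall j,
     theta i y + (delta i)%:~R <= theta j y + (delta j)%:~R].

(* The collection of the [C i], i in nat, is a version of IPVT_xi(G). *)
Definition is_IPVT (G : rooted_graph) (xi : R) d (Omega : measurableType d)
    (P : probability Omega R) (C : nat -> Omega -> set G) : Prop :=
  exists (b : R) (nu0 : probability (borel (fspace (gspace R G))) R)
    (theta : nat -> Omega -> borel (fspace (gspace R G)))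
    (delta : nat -> Omega -> int),
    [/\ ipvt_ready b nu0,
        poisson_process P (nuclei_intensity nu0 (delay_intensity b xi))
          (fun i w => (theta i w, delta i w)),
        forall i w, hboundary (gspace R G) (theta i w) &
        forall i w, C i w = voronoi_cell (theta^~ w) (delta^~ w) i].

Definition measurable_family (V : Type) : set (set (set V)) :=
  <<s [set [set S : set V | S y] | y in [set: V]] >>.

(* Equality in distribution of unordered collections (multisets) of sets: the
   numbers of members in finitely many measurable families have the same joint
   law. *)
Definition eq_collection_law (V : Type)
    d1 (Omega1 : measurableType d1) (P1 : probability Omega1 R)
    (C1 : nat -> Omega1 -> set V)
    d2 (Omega2 : measurableType d2) (P2 : probability Omega2 R)
    (C2 : nat -> Omega2 -> set V) : Prop :=
  forall (k : nat) (A : 'I_k -> set (set V)),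
    (forall j, measurable_family (A j)) ->
    forall n : 'I_k -> \bar R,
      P1 [set w | forall j, counting [set i | A j (C1 i w)] = n j] =
      P2 [set w | forall j, counting [set i | A j (C2 i w)] = n j].

End IPVT.

Section EdgeMeasured.
Variables (R : realType) (G : rooted_graph).

(* The point at distance s from x of the edge x y, in barycentric
   coordinates. *)
Definition bary (x y : G) (s : R) : G -> R :=
  fun v => (1 - s) * (v == x)%:R + s * (v == y)%:R.

Definition epoint := {a : G -> R |
  (exists x, a = bary x x 0) \/
  (exists x y s, [/\ adj x y, 0 <= s <= 1 & a = bary x y s])}.

HB.instance Definition _ := gen_eqMixin epoint.
HB.instance Definition _ := gen_choiceMixin epoint.

Definition evertex (x : G) : epoint :=
  exist _ (bary x x 0) (or_introl (ex_intro _ x erefl)).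

Definition on_edge (z : epoint) (x y : G) (s : R) : Prop :=
  [/\ adj x y, 0 <= s <= 1 & sval z = bary x y s].

(* [chain_length z w l]: there is a path of length l from z to w made of
   finitely many segments, each of them within an edge. *)
Inductive chain_length : epoint -> epoint -> R -> Prop :=
| chain_nil z : chain_length z z 0
| chain_cons z u w x y s t l : on_edge z x y s -> on_edge u x y t ->
    chain_length u w l -> chain_length z w (`|s - t| + l).

Definition edist (z w : epoint) : R := inf [set l | chain_length z w l].

Definition espace : mspace R := @MSpace R epoint edist (evertex org).

(* Lebesgue measure; each edge occurs twice in the sum, once for each of its
   orientations. *)
Definition edge_lebesgue (A : set epoint) : \bar R :=
  ((2^-1)%:E * \esum_(xy in [set xy : G * G | adj xy.1 xy.2])
     (@lebesgue_measure R)
       [set s : R | exists2 z, on_edge z xy.1 xy.2 s & A z])%E.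

Definition eball (r : R) : set epoint :=
  [set z | edist (evertex org) z <= r].

Definition evolume (r : R) : R := fine (edge_lebesgue (eball r)).

Definition edge_set (x y : G) : set epoint :=
  [set z | exists s, on_edge z x y s].

Definition eshell (n : nat) : set (G * G) :=
  [set xy | [/\ adj xy.1 xy.2, edge_set xy.1 xy.2 `<=` eball n%:R &
    ~ (edge_set xy.1 xy.2 `<=` eball (n%:R - 1))]].

Notation F := (fspace (gspace R G)).

Definition alpha_ (n : nat) : {measure set (borel (F * F)%type) -> \bar R} :=
  uniform_law R
    (fun xy : G * G => (horofun (xy.1 : gspace R G),
                        horofun (xy.2 : gspace R G)) : borel (F * F)%type)
    (eshell n).

(* The extension of [f] to the points of the edges. All the representations
   of a point z give the same value when [f] is 1-Lipschitz, so that the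
   infimum is that value; for other functions it is a minimum over the (finitely
   many) representations of z. *)
Definition extend (f : borel F) : borel (fspace espace) :=
  fun z : espace => inf [set r | exists x y s,
    on_edge z x y s /\ r = Num.min (f x + s) (f y + 1 - s)].

Definition nucleus_map (t : R) (fg : borel (F * F)%type) :
    borel (fspace espace) :=
  fun z : espace =>
    Num.min (Num.max (extend fg.1 z) (extend fg.2 z) + t)
            (Num.min (extend fg.1 z) (extend fg.2 z) + 2 - t) - t.

Definition nu_ (alpha : probability (borel (F * F)%type) R) (t : R) :
    set (borel (fspace espace)) -> \bar R :=
  pushforward alpha (nucleus_map t).

End EdgeMeasured.

(* Main.v *)
(* The distance of DL(p,q) is d + d' - |k|, with d and d' the tree distances of
   the coordinates and k their height difference. With m = max(p,q), up to o(m^n)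
   vertices of the n-ball have one coordinate of large positive height; near the
   origin, the horofunction of such a vertex is the Busemann function of the
   ancestor of that coordinate, and counting by levels shows that these ancestors
   become uniformly distributed. This gives nu0 as a mixture of the harmonic
   measures, in which the second tree has weight 0 when p > q. The endpoints of
   most edges have the same horofunction near the origin, so that alpha is the
   image of nu0 under the diagonal map. For p > q the nuclei of DL(p,q) are the
   nuclei of T composed with the projection, and the law of the cells only depends
   on the intensity of the Poisson process. *)
Require Import Defs.
From HB Require Import structures.
From mathcomp Require Import all_boot all_order all_algebra finmap.
From mathcomp Require Import zify ring lra.
From mathcomp Require Import all_classical all_reals all_analysis measurable_realfun.

Set Implicit Arguments.
Unset Strict Implicit.
Unset Printing Implicit Defensive.

Import Order.TTheory GRing.Theory Num.Theory.
Import numFieldTopology.Exports numFieldNormedType.Exports.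

Local Open Scope classical_set_scope.
Local Open Scope ring_scope.

(** * Graphs and trees *)

(** Over a vertex of T at level r with nonnegative height lie exactly q^((n-r)/2) vertices of the
    n-ball, exponent rounded down, and T has about p^r vertices at level r. For q <= p the sum over
    r has order p^n and is carried by r near n; for p < q it is o(q^n). Bounded heights contribute
    only about n m^(n/2). Divided by m^n, all counts obey linear recurrences with a contracting
    coefficient. Weak convergence reduces to counting because horofunctions of a graph are
    integer-valued: functions close on a ball agree there, so that the compactification splits into
    finitely many clopen agreement classes at each radius. The harmonic measure is known only as the
    law of the limit of some walk; its values on cylinders come from symmetry, the number of n-step
    walks to a vertex depending only on its level. A Poisson process is specified by counts on
    disjoint sets of finite intensity, while equality in law of tessellations concerns numbers of
    cells in measurable families. These numbers have to be exhibited as measurable functions of such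
    counts. *)

Definition connected_graph (G : rooted_graph) : Prop :=
  symmetric (@adj G) /\ forall x y : G, exists n, walk_of_length x y n.

Section GraphDistance.
Variable G : rooted_graph.
Implicit Types x y z : G.

Lemma walk_cons x z y n :
  adj x z -> walk_of_length z y n -> walk_of_length x y n.+1.
Proof. by move=> xz [s [ps ls <-]]; exists (z :: s); rewrite /= xz. Qed.

Lemma walk_uncons x y n :
  walk_of_length x y n.+1 -> exists2 z, adj x z & walk_of_length z y n.
Proof.
by case=> -[|z s] [] //= /andP[xz ps] ls [<-]; exists z => //; exists s.
Qed.

Lemma walk0 x y : walk_of_length x y 0 <-> x = y.
Proof.
split=> [[[|z s] [_ /= ls //]]|->]; last by exists [::].
Qed.

Lemma gdist_le x y n : walk_of_length x y n -> (gdist x y <= n)%N.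
Proof.
move=> w; rewrite /gdist; case: pselect => // ex.
by case: ex_minnP => k _; apply; apply/asboolP.
Qed.

Hypothesis cG : connected_graph G.
Let symG : symmetric (@adj G) := proj1 cG.

Lemma gdist_walk x y : walk_of_length x y (gdist x y).
Proof.
rewrite /gdist; case: pselect => [ex|[]]; first by case: ex_minnP => k /asboolP.
by have [n wn] := proj2 cG x y; exists n; apply/asboolP.
Qed.

Lemma gdist_eq0 x y : (gdist x y == 0%N) = (x == y).
Proof.
apply/eqP/eqP => [d0|->]; first by have := gdist_walk x y; rewrite d0 walk0.
by apply/eqP; rewrite -leqn0; apply: gdist_le; apply/walk0.
Qed.

Lemma gdistxx x : gdist x x = 0%N.
Proof. by apply/eqP; rewrite gdist_eq0. Qed.

Lemma walk_sym x y n : walk_of_length x y n -> walk_of_length y x n.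
Proof.
move=> [s [ps ls <-]]; exists (rev (belast x s)); split.
- by rewrite -ls rev_path (eq_path (e' := adj)).
- by case: s ps ls => [|z s] //= _ _; rewrite rev_cons last_rcons.
- by rewrite size_rev size_belast.
Qed.

Lemma gdistC x y : gdist x y = gdist y x.
Proof.
by apply/eqP; rewrite eqn_leq !gdist_le //; apply: walk_sym; apply: gdist_walk.
Qed.

Lemma walk_cat x y z m n :
  walk_of_length x y m -> walk_of_length y z n -> walk_of_length x z (m + n).
Proof.
move=> [s [ps ls <-]] [t [pt lt <-]]; exists (s ++ t).
by rewrite cat_path ps ls pt last_cat ls size_cat.
Qed.

Lemma gdist_triangle x y z : (gdist x z <= gdist x y + gdist y z)%N.
Proof. by apply: gdist_le; apply: (walk_cat (y := y)); apply: gdist_walk. Qed.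

Lemma adj_gdist1 x y : adj x y -> (gdist x y <= 1)%N.
Proof. by move=> xy; apply: gdist_le; exists [:: y]; rewrite /= xy. Qed.

Lemma adj_gdist_le x y z : adj x y -> (gdist x z <= (gdist y z).+1)%N.
Proof.
by move=> xy; apply: gdist_le; apply: (walk_cons xy); apply: gdist_walk.
Qed.

Lemma adj_gdist_le_sym x y z : adj x y -> (gdist y z <= (gdist x z).+1)%N.
Proof. by rewrite symG; apply: adj_gdist_le. Qed.

Lemma gdist_step x y :
  (0 < gdist x y)%N -> exists2 z, adj x z & (gdist z y).+1 = gdist x y.
Proof.
case d: (gdist x y) => [//|n] _; have := gdist_walk x y; rewrite d.
move=> /walk_uncons[z xz wz]; exists z => //; apply/eqP; rewrite eqSS eqn_leq.
by rewrite gdist_le //= -ltnS -d; apply: adj_gdist_le.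
Qed.

Lemma gdist_stepr x y :
  (0 < gdist x y)%N -> exists2 z, adj y z & (gdist x z).+1 = gdist x y.
Proof.
rewrite gdistC => /gdist_step[z yz dz]; exists z => //.
by rewrite [gdist x z]gdistC.
Qed.

Lemma gdist_at x y k : (k <= gdist x y)%N ->
  exists2 z, gdist x z = k & geod x y z.
Proof.
move=> /subnK; move: (_ - _)%N => j; elim: j k => [|j IH] k kj.
  by exists y; [rewrite -kj|rewrite /geod /= gdistxx // addn0].
have [|z dz gz] := IH k.+1; first by rewrite -kj addnS.
have [|w zw dw] := @gdist_stepr x z; first by rewrite dz.
exists w; first by move: dw; rewrite dz => -[].
apply/eqP; rewrite /geod /= eqn_leq gdist_triangle andbT.
have := adj_gdist_le_sym y zw; rewrite /geod /= in gz; lia.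
Qed.

End GraphDistance.

(** Connectedness is not assumed: that a walk realizes the distance is part of the conclusion,
    because for [DL] the distance formula and the connectedness are obtained together. *)
Lemma gdist_unique (G : rooted_graph) (y : G) (D : G -> nat) :
  symmetric (@adj G) -> D y = 0%N ->
  (forall x z, adj x z -> (D x <= (D z).+1)%N) ->
  (forall x, D x = 0%N -> x = y) ->
  (forall x, (0 < D x)%N -> exists2 z, adj x z & (D z).+1 = D x) ->
  forall x, walk_of_length x y (gdist x y) /\ gdist x y = D x.
Proof.
move=> symG Dy DL D0 Dstep x.
have wD n z : D z = n -> walk_of_length z y n.
  elim: n z => [|n IH] z Dz; first by apply/walk0/D0.
  have [|u zu Du] := Dstep z; first by rewrite Dz.
  by apply: (walk_cons zu); apply: IH; apply/eqP; rewrite -eqSS Du Dz.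
have Dw n z : walk_of_length z y n -> (D z <= n)%N.
  elim: n z => [|n IH] z; first by move=> /walk0 ->; rewrite Dy.
  by move=> /walk_uncons[u zu /IH]; rewrite -ltnS; apply/leq_trans/DL.
suff dD : gdist x y = D x by rewrite dD; split=> //; apply: wD.
apply/eqP; rewrite eqn_leq gdist_le //=; last exact: wD.
rewrite /gdist; case: pselect => [ex|[]]; first by case: ex_minnP => k /asboolP /Dw.
by exists (D x); apply/asboolP/wD.
Qed.

Section Tree.
Variables (k : nat) (T : rooted_graph).
Hypothesis hT : regular_tree T k.
Implicit Types u v w x y z a b : T.

Lemma tree_connected : connected_graph T.
Proof. by case: hT => -[]. Qed.
Let cT := tree_connected.

Lemma tree_sym : symmetric (@adj T).
Proof. by case: hT => -[]. Qed.

Lemma tree_irr : irreflexive (@adj T).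
Proof. by case: hT => -[]. Qed.

(* Two neighbours of [v], neither further from [a] than [v], would be joined
   by a path avoiding [v], which closes up to a cycle through [v]. *)
Lemma closer_nbr_unique a v x y : adj v x -> adj v y ->
  (gdist x a <= gdist v a)%N -> (gdist y a <= gdist v a)%N -> x = y.
Proof.
move=> vx vy xa ya; apply/eqP/negP => /negP xy.
have avoid n z : gdist z a = n -> (n <= gdist v a)%N -> z != v ->
    exists2 s, path adj z s /\ last z s = a & v \notin z :: s.
  elim: n z => [|n IH] z dz nv zv.
    move/eqP: dz; rewrite (gdist_eq0 cT) => /eqP <-; exists [::] => //.
    by rewrite inE eq_sym.
  have [|w zw dw] := gdist_step cT (x := z) (y := a); first by rewrite dz.
  have {}dw : gdist w a = n by move: dw; rewrite dz => -[].
  have wv : w != v by apply/eqP => wv; move: nv; rewrite -wv dw ltnn.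
  have [s [ps ls] vs] := IH w dw (ltnW nv) wv.
  by exists (w :: s); rewrite /= ?zw // inE negb_or vs eq_sym zv.
have nv z : adj v z -> z != v by apply: contraTneq => ->; rewrite tree_irr.
have [s [ps ls] vs] := avoid _ x erefl xa (nv _ vx).
have [t [pt lt] vt] := avoid _ y erefl ya (nv _ vy).
have [p pp [lp vp]] : exists2 p, path adj x p & last x p = y /\ v \notin x :: p.
  exists (s ++ rev (belast y t)).
    rewrite cat_path ps ls -lt rev_path (eq_path (e' := adj)) ?pt //.
    by move=> ? ?; rewrite tree_sym.
  rewrite last_cat; split.
    by case: t {pt vt} lt ls => [|z t] /= lt ls; rewrite ?ls // rev_cons last_rcons.
  rewrite -cat_cons mem_cat negb_or vs mem_rev /=.
  by apply: contra vt; apply: mem_belast.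
case/shortenP: pp lp => p' pp' up' sub lp'.
have [_ _ acyclic _] := hT.
suff: (size [:: v, x & p'] <= 2)%N.
  by case: p' lp' {pp' up' sub} => [/= xy'|//]; rewrite xy' eqxx in xy.
apply: acyclic; first by rewrite /= vx rcons_path pp' lp' tree_sym vy.
rewrite cons_uniq up' andbT; apply: contra vp.
by rewrite !inE => /orP[->//|/sub ->]; rewrite orbT.
Qed.

(** Trees are bipartite: if x and y were equally far from a, then y and the neighbour of x on the
    way to a would both be neighbours of x not further from a than x, hence equal. *)
Lemma adj_gdist_neq a x y : adj x y -> gdist x a <> gdist y a.
Proof.
move=> xy dxy; case: (posnP (gdist x a)) => [|/(gdist_step cT)[z xz dz]].
  move=> /[dup]; rewrite {2}dxy => /eqP + /eqP; rewrite !(gdist_eq0 cT).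
  by move=> /eqP xa /eqP ya; move: xy; rewrite xa ya tree_irr.
have zy : z = y by apply: (@closer_nbr_unique a x); rewrite // -?dz -?dxy // -dz.
by move: dz; rewrite zy -dxy => /eqP; rewrite -[X in _ == X]addn0 -addn1 eqn_add2l.
Qed.

Lemma adj_gdistP a x y : adj x y ->
  gdist x a = (gdist y a).+1 \/ gdist y a = (gdist x a).+1.
Proof.
move=> xy; have := @adj_gdist_neq a x y xy.
have := adj_gdist_le cT a xy; have := adj_gdist_le_sym cT a xy; lia.
Qed.

Lemma further_nbr a v x y : adj v x -> adj v y -> x != y ->
  gdist v a = (gdist x a).+1 -> gdist y a = (gdist v a).+1.
Proof.
move=> vx vy xy dx; case: (adj_gdistP a vy) => // dy.
by case/eqP: xy; apply: (@closer_nbr_unique a v); rewrite ?dx ?dy //; lia.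
Qed.

(** Each vertex of the geodesic from x to b is further from a than the previous one, since turning
    back would be the only way to approach a. *)
Lemma gdist_separate a u x b : adj u x ->
  gdist x a = (gdist u a).+1 -> gdist u b = (gdist x b).+1 ->
  gdist a b = ((gdist u a).+1 + gdist x b)%N.
Proof.
have [n dx] : exists n, gdist x b = n by exists (gdist x b).
elim: n u x dx => [|n IH] u x dx ux xa ub.
  move/eqP: dx; rewrite (gdist_eq0 cT) => /eqP <-.
  by rewrite (gdistxx cT) addn0 -xa (gdistC cT).
have [|z xz dz] := gdist_step cT (x := x) (y := b); first by rewrite dx.
have uz : u != z by apply/eqP => uz; rewrite -uz in dz; lia.
have za : gdist z a = (gdist x a).+1.
  by apply: (@further_nbr a x u z) => //; rewrite tree_sym.
have zb : gdist z b = n by move: dz; rewrite dx => -[].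
rewrite (IH x z zb xz za (esym dz)); lia.
Qed.

(* The subtree hanging from [u], seen from [a], is reached only through [u]. *)
Lemma gdist_beyond a u v b : geod a v u -> (gdist b a <= gdist u a)%N ->
  gdist b v = (gdist b u + gdist u v)%N.
Proof.
rewrite /geod /= => guv ba; apply/eqP; rewrite eqn_leq gdist_triangle //=.
have [n bu] : exists n, gdist b u = n by exists (gdist b u).
case: n bu => [|n] bu.
  by move/eqP: bu; rewrite (gdist_eq0 cT) => /eqP ->; rewrite (gdistxx cT).
have [|x ux dx] := gdist_step cT (x := u) (y := b).
  by rewrite (gdistC cT) bu.
case: (posnP (gdist u v)) => [uv0|].
  have /eqP := uv0; rewrite (gdist_eq0 cT) => /eqP <-.
  by rewrite (gdistxx cT) addn0.
move=> /(gdist_step cT)[z uz dz].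
have xz : x != z.
  apply/eqP => xz; rewrite -xz in uz dz.
  have xa : gdist x a = (gdist u a).+1.
    case: (adj_gdistP a ux) => // ua.
    have := gdist_triangle cT a x v; rewrite (gdistC cT a x); rewrite (gdistC cT a u) in guv.
    lia.
  have := gdist_separate ux xa (esym dx).
  rewrite (gdistC cT a b); lia.
have dz' := further_nbr (a := b) ux uz xz (esym dx).
have := gdist_separate uz dz' (esym dz); rewrite (gdistC cT b u); lia.
Qed.

Lemma geod_unique a v x y : geod a v x -> geod a v y -> gdist a x = gdist a y ->
  x = y.
Proof.
move=> gx gy dxy; apply/eqP; rewrite -(gdist_eq0 cT).
have := gdist_beyond gx (b := y).
rewrite (gdistC cT y a) (gdistC cT x a) dxy leqnn => /(_ isT).
rewrite /geod /= in gx gy; rewrite (gdistC cT x y); lia.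
Qed.

Lemma geod_trans a u v w : geod a v u -> geod a w v -> geod a w u.
Proof.
rewrite /geod /= => gu gv; have := gdist_triangle cT u v w.
have := gdist_triangle cT a u w; lia.
Qed.

Lemma geod_refl a v : geod a v v.
Proof. by rewrite /geod /= (gdistxx cT) addn0. Qed.

Lemma geod_le a u v w : geod a w u -> geod a w v -> (gdist a u <= gdist a v)%N ->
  geod a v u.
Proof.
move=> gu gv duv.
have [x dx gx] := gdist_at cT duv.
suff -> : u = x by [].
by apply: (geod_unique gu); rewrite ?dx //; apply: geod_trans gx gv.
Qed.

End Tree.

(** * Ends and heights *)

Section Ends.
Variables (k : nat) (T : rooted_graph).
Hypothesis hT : regular_tree T k.
Implicit Types (u v x y z a b : T) (r s : nat -> T) (w : tree_end T).

Let cT := tree_connected hT.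
Let symT := tree_sym hT.

(** The only neighbour nearer to a is the vertex that the ray has just left, and injectivity forbids
    returning to it. *)
Lemma ray_inc a r n : is_ray r -> gdist (r n.+1) a = (gdist (r n) a).+1 ->
  forall i, gdist (r (n + i)%N) a = (gdist (r n) a + i)%N.
Proof.
move=> [radj rinj] dn; suff H i : gdist (r (n + i).+1) a = (gdist (r (n + i)%N) a).+1.
  by elim=> [|i IH]; rewrite ?addn0 // !addnS H IH.
elim: i => [|i IH]; rewrite ?addn0 // addnS.
apply: (@further_nbr _ _ hT a _ (r (n + i)%N)) => //; first by rewrite symT.
by apply/eqP => /rinj; lia.
Qed.

Lemma ray_dist r : is_ray r -> forall n i, gdist (r (n + i)%N) (r n) = i.
Proof.
move=> rr n i; rewrite ray_inc ?(gdistxx cT) //; have [/(_ n) rn _] := rr.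
by case: (adj_gdistP hT (r n) rn); rewrite (gdistxx cT).
Qed.

Lemma ray_escape r a : is_ray r ->
  exists n, gdist (r n.+1) a = (gdist (r n) a).+1.
Proof.
move=> [radj rinj]; apply: contrapT => /forallNP ninc.
have dec n : (gdist (r n) a + n)%N = gdist (r 0%N) a.
  elim: n => [|n IH]; first by rewrite addn0.
  by case: (adj_gdistP hT a (radj n)) => [dn|/ninc//]; rewrite -IH dn addnS.
have := dec (gdist (r 0%N) a).+1; lia.
Qed.

Lemma end_is_ray w r : sval w r -> is_ray r.
Proof. by case: w => A /= [r0 rr0 ->] []. Qed.

Lemma cofinal_sym r s : cofinal_rays r s -> cofinal_rays s r.
Proof. by move=> [m [n e]]; exists n, m => i; rewrite e. Qed.

Lemma cofinal_trans r s t :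
  cofinal_rays r s -> cofinal_rays s t -> cofinal_rays r t.
Proof.
move=> [m [n e]] [m' [n' e']]; exists (m + m')%N, (n' + n)%N => i.
by rewrite -addnA e addnCA e' addnA.
Qed.

Lemma end_cofinal w r s : sval w r -> sval w s -> cofinal_rays r s.
Proof.
case: w => A /= [r0 rr0 ->] [_ +] [_ +]; move/cofinal_sym.
exact: cofinal_trans.
Qed.

Lemma end_closed w r s : sval w r -> is_ray s -> cofinal_rays r s -> sval w s.
Proof.
case: w => A /= [r0 rr0 ->] [_ c0] rs c; split=> //.
exact: cofinal_trans c0 c.
Qed.

(** Some tail of a ray of w recedes from u, its i-th vertex being at distance e + i; prepending a
    neighbour nearer to u lowers e until the ray starts at u. *)
Lemma end_ray_exists w u : exists r, sval w r /\ r 0%N = u.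
Proof.
suff H e r : sval w r -> (forall i, gdist (r i) u = (e + i)%N) ->
    exists s, sval w s /\ s 0%N = u.
  have [r wr] : exists r, sval w r.
    by case: (w) => A /= [r0 rr0 ->]; exists r0; split=> //; exists 0%N, 0%N.
  have [n rn] := ray_escape u (end_is_ray wr).
  apply: (H _ (fun i => r (n + i)%N)) (ray_inc (end_is_ray wr) rn).
  apply: (end_closed wr); last by exists n, 0%N.
  have [ra ri] := end_is_ray wr; split=> [i|i j /ri]; last exact: addnI.
  by rewrite addnS.
elim: e r => [|e IH] r wr dr.
  by exists r; split=> //; apply/eqP; rewrite -(gdist_eq0 cT) dr.
have [|z rz dz] := gdist_step cT (x := r 0%N) (y := u); first by rewrite dr.
pose r' i := if i is j.+1 then r j else z.
have dr' i : gdist (r' i) u = (e + i)%N.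
  by case: i => [|i] /=; [move: dz; rewrite dr; lia|rewrite dr addnS].
apply: (IH r') => //; apply: (end_closed wr); last by exists 0%N, 1%N.
split=> [[|i]|i j rij]; first by rewrite symT.
  by have [+ _] := end_is_ray wr; apply.
by have := dr' i; rewrite rij dr'; lia.
Qed.

Definition rayto w u : nat -> T := xget (fun=> u) [set r | sval w r /\ r 0%N = u].

Lemma raytoP w u : sval w (rayto w u) /\ rayto w u 0%N = u.
Proof.
have [r ru] := end_ray_exists w u; rewrite /rayto.
by case: xgetP => [s _ //|/(_ r)].
Qed.

Lemma end_ray_unique w r s : sval w r -> sval w s -> r 0%N = s 0%N -> r = s.
Proof.
move=> wr ws rs0; have [rr rs] := (end_is_ray wr, end_is_ray ws).
have [m [n e]] := end_cofinal wr ws.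
have mn : m = n.
  have /(congr1 (fun x => gdist x (r 0%N))) := e 0%N.
  by rewrite !addn0 (ray_dist rr 0) rs0 (ray_dist rs 0).
move: e; rewrite -mn => e {n mn}; apply/funext => i.
have [mi|im] := leqP m i; first by rewrite -(subnKC mi) e.
have em := e 0%N; rewrite !addn0 in em.
apply: (geod_unique hT (a := r 0%N) (v := r m)).
- rewrite /geod /= (gdistC cT) (ray_dist rr 0) (gdistC cT) (gdistC cT (r 0%N)).
  by rewrite (ray_dist rr 0) -{1}(subnKC (ltnW im)) (ray_dist rr) subnKC // ltnW.
- rewrite /geod /= em rs0 (gdistC cT) (ray_dist rs 0) (gdistC cT) (gdistC cT (s 0%N)).
  by rewrite (ray_dist rs 0) -{1}(subnKC (ltnW im)) (ray_dist rs) subnKC // ltnW.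
- by rewrite (gdistC cT) (ray_dist rr 0) rs0 (gdistC cT) (ray_dist rs 0).
Qed.

Lemma raytoE w r : sval w r -> rayto w (r 0%N) = r.
Proof. by move=> wr; have [? ?] := raytoP w (r 0%N); apply: (end_ray_unique (w := w)). Qed.

(** The parent of u in the genealogy of the tree as seen from w. Heights, confluents and distances
    are all computed by iterating it. *)
Definition par w u : T := rayto w u 1%N.

Lemma rayto_iter w u n : rayto w u n = iter n (par w) u.
Proof.
elim: n u => [|n IH] u; first by have [] := raytoP w u.
have [wr r0] := raytoP w u; rewrite iterSr -IH /par.
suff /raytoE -> : sval w (fun i => rayto w u i.+1) by [].
apply: (end_closed wr); last by exists 1%N, 0%N => i.
have [ra ri] := end_is_ray wr.
by split=> [i|i j /ri []].
Qed.

Lemma iter_par_ray w u : is_ray (fun n => iter n (par w) u).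
Proof.
rewrite -(_ : rayto w u = fun n => iter n (par w) u); last first.
  by apply/funext => n; rewrite rayto_iter.
by apply: (@end_is_ray w); have [] := raytoP w u.
Qed.

Lemma geod_endE u w : geod_end u w = range (fun n => iter n (par w) u).
Proof.
apply/seteqP; split=> x /=.
  by move=> [r [n [wr <- <-]]]; exists n => //; rewrite -rayto_iter raytoE.
move=> [n _ <-]; exists (rayto w u), n; have [? ?] := raytoP w u.
by split=> //; rewrite rayto_iter.
Qed.

Lemma gdist_iter_par w u n : gdist u (iter n (par w) u) = n.
Proof. by rewrite (gdistC cT) (ray_dist (iter_par_ray w u) 0). Qed.

Lemma iter_par_inj w u : injective (fun n => iter n (par w) u).
Proof. by have [] := iter_par_ray w u. Qed.

Lemma adj_par w u : adj u (par w u).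
Proof. by have [/(_ 0%N)] := iter_par_ray w u. Qed.

Lemma adj_parP w u v : adj u v -> v = par w u \/ u = par w v.
Proof.
move=> uv; have [->|/eqP vp] := eqVneq v (par w u); [by left|right].
have dv n : gdist (iter n (par w) u) v = n.+1.
  have d0 : gdist u v = 1%N.
    by have := adj_gdistP hT v uv; rewrite (gdistxx cT); case.
  have := @ray_inc v (fun i => iter i (par w) u) 0%N (iter_par_ray w u).
  rewrite /= => ->; first by rewrite d0 add1n.
  apply: (@further_nbr _ _ hT v u v) => //; first exact: adj_par.
    exact/eqP.
  by rewrite (gdistxx cT).
(* If v is not the parent of u, then v followed by the ray of u is again a ray to w, so that u is
   the parent of v. *)
pose r i := if i is j.+1 then iter j (par w) u else v.
suff wr : sval w r by rewrite /par -[v]/(r 0%N) raytoE.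
have [wu _] := raytoP w u; apply: (end_closed wu).
  split=> [[|i]|[|i] [|j]] //=; first by rewrite symT.
  - by have [+ _] := iter_par_ray w u; apply.
  - by move=> vj; have := dv j; rewrite -vj (gdistxx cT).
  - by move=> vj; have := dv i; rewrite vj (gdistxx cT).
  - by move=> /iter_par_inj ->.
by exists 0%N, 1%N => i; rewrite rayto_iter.
Qed.

Lemma par_merge w u v : exists i j, iter i (par w) u = iter j (par w) v.
Proof.
have [[wu _] [wv _]] := (raytoP w u, raytoP w v).
have [m [n /(_ 0%N)]] := end_cofinal wu wv.
by rewrite !addn0 !rayto_iter; exists m, n.
Qed.

(** Take the first common ancestor: by minimality of i the two branches meet only there, so that
    their concatenation is the geodesic. *)
Lemma confluent_exists w u v : exists i j,
  [/\ iter i (par w) u = iter j (par w) v & gdist u v = (i + j)%N].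
Proof.
pose P i := `[< exists j, iter i (par w) u = iter j (par w) v >].
have ex : exists i, P i.
  by have [i [j e]] := par_merge w u v; exists i; apply/asboolP; exists j.
case: (ex_minnP ex) => i /asboolP[j e] min; exists i, j; split=> //.
case: i e min => [|i] e min.
  by rewrite /= in e; rewrite e (gdistC cT) gdist_iter_par.
have dc : gdist (iter i.+1 (par w) u) v = j by rewrite e (gdistC cT) gdist_iter_par.
have ic := adj_par w (iter i (par w) u); rewrite symT in ic.
have := gdist_separate hT ic (a := v) (b := u).
rewrite -iterS dc ![gdist (iter _ _ u) u](gdistC cT) !gdist_iter_par.
rewrite (gdistC cT v u) => H; rewrite H //; first by lia.
case: (adj_gdistP hT v ic); rewrite -iterS dc // => dj.
case: j e dc dj {H} => [//|j] e dc [dj].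
suff /asboolP/min : exists j, iter i (par w) u = iter j (par w) v by rewrite ltnn.
exists j; apply: (closer_nbr_unique hT (v := iter i.+1 (par w) u) (a := v)) => //.
- by rewrite e iterS symT; apply: adj_par.
- by rewrite dc -dj.
- by rewrite dc (gdistC cT) gdist_iter_par.
Qed.

(** This is [height] for an arbitrary end. For [end0] the two terms are convertible, which is what
    [DL_height] uses. *)
Definition hgt w u : int :=
  let c := xget u (geod u org `&` geod_end u w `&` geod_end org w) in
  (gdist u c)%:Z - (gdist org c)%:Z.

Lemma hgtE w u i j : iter i (par w) u = iter j (par w) org ->
  hgt w u = i%:Z - j%:Z.
Proof.
move=> e; rewrite /hgt; case: xgetP => [c _ [[_ ]]|none].
  rewrite !geod_endE => -[m _ <-] [n _ e'].
  rewrite -[in gdist org _]e' !gdist_iter_par.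
  have : iter (i + n) (par w) u = iter (j + m) (par w) u.
    by rewrite addnC iterD e -iterD addnC iterD e' -iterD.
  by move=> /iter_par_inj; lia.
have [i' [j' [e' duo]]] := confluent_exists w u org.
case: (none (iter i' (par w) u)); split; [split|].
- rewrite /geod /= {2}e' gdist_iter_par [gdist _ org](gdistC cT) gdist_iter_par.
  by rewrite duo.
- by rewrite geod_endE; exists i'.
- by rewrite geod_endE e'; exists j'.
Qed.

Lemma hgt_iter w u : exists N, forall n, (N <= n)%N -> exists m : nat,
  m%:Z = n%:Z + hgt w u /\ iter n (par w) org = iter m (par w) u.
Proof.
have [i [j e]] := par_merge w u org; exists j => n /subnK <-.
exists (n - j + i)%N; split; first by rewrite (hgtE e); lia.
by rewrite !iterD e.
Qed.

Lemma hgt_par w u : hgt w (par w u) = hgt w u - 1.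
Proof.
have [i [j e]] := par_merge w u org.
rewrite (hgtE e) (@hgtE w (par w u) i j.+1); first by lia.
by rewrite -iterSr iterS e.
Qed.

Lemma hgt_org w : hgt w org = 0.
Proof. by rewrite (@hgtE w org 0 0). Qed.

Lemma adj_hgt w u v : adj u v -> hgt w v = hgt w u - 1 \/ hgt w v = hgt w u + 1.
Proof. by move=> /(adj_parP w)[] ->; rewrite hgt_par; [left|right; lia]. Qed.

Lemma hgt_iter_par w u n : hgt w (iter n (par w) u) = hgt w u - n%:Z.
Proof.
elim: n => [|n IH]; first by rewrite subr0.
by rewrite iterS hgt_par IH; lia.
Qed.

Lemma hgt_merge w u v : exists i j, [/\ iter i (par w) u = iter j (par w) v,
  gdist u v = (i + j)%N & hgt w u - hgt w v = i%:Z - j%:Z].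
Proof.
have [i [j [e duv]]] := confluent_exists w u v; exists i, j; split=> //.
by have := congr1 (hgt w) e; rewrite !hgt_iter_par; lia.
Qed.

Lemma hgt_lipschitz w u v : `|hgt w u - hgt w v| <= (gdist u v)%:Z.
Proof. by have [i [j [_ -> ->]]] := hgt_merge w u v; lia. Qed.

(** The inequality is strict exactly when v is not a descendant of u; the geodesic from u to v then
    begins with the parent of u. *)
Lemma gdist_par w u v : hgt w v - hgt w u < (gdist u v)%:Z ->
  gdist u v = (gdist (par w u) v).+1.
Proof.
have [i [j [e guv duv]]] := hgt_merge w u v; rewrite guv.
case: i e guv duv => [|i] e guv duv; first by lia.
move=> _; have : (gdist (par w u) v <= i + j)%N.
  rewrite (leq_trans (gdist_triangle cT _ (iter i (par w) (par w u)) _)) //.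
  by rewrite gdist_iter_par leq_add2l -iterSr e (gdistC cT) gdist_iter_par.
by case: (adj_gdistP hT v (adj_par w u)) => //; lia.
Qed.

Lemma end_filter_proper w : ProperFilter (end_filter w).
Proof.
apply: filter_from_proper; last first.
  by move=> y _; exists y; exact: (geod_refl hT).
apply: filter_from_filter; first by exists org; rewrite geod_endE; exists 0%N.
move=> x y; rewrite geod_endE => -[n _ <-] [m _ <-].
exists (iter (maxn n m) (par w) org); first by exists (maxn n m).
have H i : (i <= maxn n m)%N -> geod org (iter (maxn n m) (par w) org) (iter i (par w) org).
  move=> /subnK im; rewrite -{1}im iterD /geod /= !gdist_iter_par.
  by rewrite -iterD gdist_iter_par addnC.
by move=> z gz; split; apply: (geod_trans hT _ gz); apply: H; rewrite ?leq_maxl ?leq_maxr.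
Qed.

(** Beyond a vertex far enough along the ray from the root, the difference of distances is constant,
    so the limit is that of an eventually constant function. *)
Lemma busemannE (R : realType) w u : busemann R w u = (hgt w u)%:~R.
Proof.
have [N HN] := hgt_iter w u; pose n := maxn N (gdist u org).
have [m [mE nm]] := HN n (leq_maxl _ _).
have eF := end_filter_proper w.
rewrite /busemann; apply: cvg_lim => //; apply: cvg_near_cst.
exists (iter n (par w) org); first by rewrite geod_endE; exists n.
move=> x gx; rewrite (gdist_beyond hT gx (b := u)).
  move: gx; rewrite /geod /= => <-; rewrite gdist_iter_par.
  have /(congr1 (fun i : int => i%:~R : R)) := mE; rewrite intrD -!pmulrn => mR.
  by rewrite nm gdist_iter_par !natrD mR opprD addrACA subrr addr0 addrAC subrr add0r.
by rewrite [X in (_ <= X)%N](gdistC cT) gdist_iter_par leq_maxr.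
Qed.

End Ends.

(** * The distance of the Diestel--Leader graph *)

Section Cardinality.
Implicit Types V W : choiceType.

Definition ncard V (A : set V) : nat := #|` fset_set A|.

Lemma ncard_seq V (A : set V) (s : seq V) : uniq s -> (forall x, A x <-> x \in s) ->
  finite_set A /\ ncard A = size s.
Proof.
move=> us As; have -> : A = [set` s] by apply/seteqP; split=> x /As.
split=> //; apply/perm_size/uniq_perm => // x.
by rewrite in_fset_set //; apply/idP/idP; rewrite inE.
Qed.

Lemma ncard_mem V (A : set V) x : finite_set A -> (x \in fset_set A) <-> A x.
Proof. by move=> fA; rewrite in_fset_set // inE. Qed.

Lemma ncard_count V (A : set V) (P : pred V) : finite_set A ->
  ncard (A `&` [set x | P x]) = count P (fset_set A).
Proof.
move=> fA; rewrite -size_filter; apply: (proj2 (ncard_seq _ _)).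
  by rewrite filter_uniq // fset_uniq.
by move=> x; rewrite mem_filter in_fset_set //; split=> [[xA ->]|/andP[? /set_mem]//]; apply/mem_set.
Qed.

Lemma ncard_le V (A B : set V) : finite_set B -> A `<=` B -> (ncard A <= ncard B)%N.
Proof.
move=> fB AB; apply: fsubset_leq_card; rewrite -fset_set_sub //.
exact: sub_finite_set AB fB.
Qed.

Lemma ncard0 V : ncard (set0 : set V) = 0%N.
Proof. by rewrite /ncard fset_set0 cardfs0. Qed.

Lemma ncard_set1 V (x : V) : ncard [set x] = 1%N.
Proof. by rewrite /ncard fset_set1 cardfs1. Qed.

Lemma ncard_gt0 V (A : set V) : finite_set A -> A !=set0 -> (0 < ncard A)%N.
Proof.
by move=> fA [x Ax]; rewrite -(ncard_set1 x) ncard_le // => _ ->.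
Qed.

Lemma ncardU V (A B : set V) : finite_set A -> finite_set B ->
  A `&` B = set0 -> ncard (A `|` B) = (ncard A + ncard B)%N.
Proof.
move=> fA fB AB; rewrite /ncard fset_setU // cardfsU -fset_setI // AB fset_set0.
by rewrite cardfs0 subn0.
Qed.

Lemma ncardU_le V (A B : set V) : finite_set A -> finite_set B ->
  (ncard (A `|` B) <= ncard A + ncard B)%N.
Proof. by move=> fA fB; rewrite /ncard fset_setU // cardfsU leq_subr. Qed.

Lemma ncardID V (A : set V) (P : set V) : finite_set A ->
  ncard A = (ncard (A `&` P) + ncard (A `&` ~` P))%N.
Proof.
move=> fA; rewrite -ncardU -?setIUr ?setUv ?setIT //.
- exact: finite_setIl.
- exact: finite_setIl.
- by rewrite setIACA setICr setI0.
Qed.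

Lemma ncard_image V W (f : V -> W) (A : set V) : finite_set A ->
  {in A &, injective f} -> ncard (f @` A) = ncard A.
Proof.
move=> fA fi; rewrite /ncard fset_set_image // card_in_imfset //=.
by move=> x y; rewrite !in_fset_set //; apply: fi.
Qed.

Lemma ncard_bij V W (f : V -> W) (A : set V) (B : set W) : finite_set A ->
  {in A &, injective f} -> f @` A = B -> ncard B = ncard A.
Proof. by move=> fA fi <-; apply: ncard_image. Qed.

Lemma ncard_fibers V W (f : V -> W) (A : set V) (s : seq W) : finite_set A ->
  uniq s -> (forall x, A x -> f x \in s) ->
  ncard A = (\sum_(w <- s) ncard (A `&` [set x | f x = w]))%N.
Proof.
move=> fA us As; rewrite {1}/ncard -sum1_size.
have e w : ncard (A `&` [set x | f x = w]) = (\sum_(x <- fset_set A) (f x == w))%N.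
  rewrite -big_mkcond sum1_count -ncard_count //; congr ncard.
  by apply/seteqP; split=> x [Ax /eqP ?]; split=> //; apply/eqP.
rewrite (eq_bigr _ (fun w _ => e w)) exchange_big /= big_seq [RHS]big_seq; apply: eq_bigr => x.
rewrite ncard_mem // => /As fxs; rewrite (bigD1_seq (f x)) //= eqxx big1 //.
by move=> w; rewrite eq_sym => /negbTE ->.
Qed.

Lemma ncard_fibers_nat V (f : V -> nat) (A : set V) n : finite_set A ->
  (forall x, A x -> (f x <= n)%N) ->
  ncard A = (\sum_(i < n.+1) ncard (A `&` [set x | f x = i]))%N.
Proof.
move=> fA An; rewrite (@ncard_fibers _ _ f A (index_iota 0 n.+1)) ?iota_uniq //.
  by rewrite big_mkord.
by move=> x /An; rewrite mem_index_iota.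
Qed.

Lemma ncard_sigma V W (A : set V) (B : V -> set W) : finite_set A ->
  (forall x, A x -> finite_set (B x)) ->
  finite_set [set xy | A xy.1 /\ B xy.1 xy.2] /\
  ncard [set xy | A xy.1 /\ B xy.1 xy.2] = (\sum_(x <- fset_set A) ncard (B x))%N.
Proof.
move=> fA fB.
have fS : finite_set [set xy | A xy.1 /\ B xy.1 xy.2].
  have -> : [set xy | A xy.1 /\ B xy.1 xy.2] =
      \bigcup_(x in A) ([set x] `*` B x).
    by apply/seteqP; split=> -[x y] /=; [move=> [? ?]; exists x|move=> [z ? [/= -> ?]]].
  by apply: bigcup_finite => // x Ax; apply: finite_setX => //; apply: fB.
split=> //; rewrite (@ncard_fibers _ _ fst _ (fset_set A)) ?fset_uniq //; last first.
  by move=> [x y] [/= Ax _]; apply/ncard_mem.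
apply: eq_big_seq => x /ncard_mem => /(_ fA) Ax.
rewrite -(ncard_image (f := pair x) (fB _ Ax)); last by move=> ? ? _ _ [].
congr ncard; apply/seteqP; split=> [[x' y] [[/= _ ?] <-]|_ [y ? <-]] //=.
by exists y.
Qed.

End Cardinality.

(** * Parents, children and the distance formula *)

Section Neighbours.
Variables (k : nat) (T : rooted_graph).
Hypothesis hT : regular_tree T k.
Implicit Types u v x y : T.

Lemma ncard_nbr x : finite_set (nbr_set x) /\ ncard (nbr_set x) = k.
Proof.
have [_ _ _ /(_ x) nk] := hT; split; last exact: card_fset_set nk.
by apply/finite_setP; exists k.
Qed.

Definition children w u : set T := [set v | adj u v /\ par w v = u].

Lemma childrenE w u : children w u = nbr_set u `\ par w u.
Proof.
apply/seteqP; split=> v /=.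
  move=> [uv vu]; split=> // vp.
  have := hgt_par hT w u; rewrite -vp; have := hgt_par hT w v; rewrite vu; lia.
by move=> [uv vp]; split=> //; case: (adj_parP hT w uv).
Qed.

Lemma ncard_children w u :
  finite_set (children w u) /\ ncard (children w u) = k.-1.
Proof.
have [fu cu] := ncard_nbr u; rewrite childrenE; split; first exact: finite_setD.
have := ncardID [set par w u] fu.
have -> : nbr_set u `&` [set par w u] = [set par w u].
  by apply/seteqP; split=> v /= => [[] //|->]; split=> //; apply: adj_par hT _ _.
by rewrite ncard_set1 cu -setDE => ->.
Qed.

(** A case analysis prepared for linear arithmetic: the geodesic from u to y makes i steps to
    parents and then j steps to children, and the last clause says how a move of u to its parent
    changes its length. *)
Lemma par_cases w u y : exists i j : nat, [/\ gdist u y = (i + j)%N,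
  hgt w u - hgt w y = i%:Z - j%:Z, hgt w (par w u) = hgt w u - 1 &
  ((exists2 i', i = i'.+1 & gdist (par w u) y = (i' + j)%N) \/
   (i = 0%N /\ gdist (par w u) y = j.+1))].
Proof.
have [i [j [e duy dh]]] := hgt_merge hT w u y; exists i, j.
split=> //; first exact: hgt_par hT _ _.
have [lt|ge] := ltP (hgt w y - hgt w u) (gdist u y)%:Z.
  have := gdist_par hT lt; case: i e duy dh => [|i] e duy dh; first by lia.
  by rewrite duy => -[dp]; left; exists i.
right; have i0 : i = 0%N by lia.
split=> //; case: (adj_gdistP hT y (adj_par hT w u)) => // dp; last by lia.
have := hgt_lipschitz hT w y (par w u); rewrite (hgt_par hT) (gdistC (tree_connected hT)); lia.
Qed.

Lemma child_towards w u y : (0 < gdist u y)%N ->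
  hgt w y - hgt w u = (gdist u y)%:Z ->
  exists v, [/\ adj u v, par w v = u & gdist u y = (gdist v y).+1].
Proof.
move=> /(gdist_step (tree_connected hT))[v uv <-] dh; exists v; split=> //.
case: (adj_parP hT w uv) => // vp; have := hgt_lipschitz hT w y v.
rewrite vp (hgt_par hT) (gdistC (tree_connected hT)) -vp; lia.
Qed.

End Neighbours.

Section DLDistance.
Variables (p q : nat) (T T' : htree).
Hypotheses (hp : (0 < p)%N) (hq : (0 < q)%N).
Hypotheses (hT : regular_tree T p.+1) (hT' : regular_tree T' q.+1).
Implicit Types x y z : DL T T'.

Let symT := tree_sym hT.
Let symT' := tree_sym hT'.

Lemma DL_height x : hgt end0 (dl_fst x) + hgt end0 (dl_snd x) = 0.
Proof. exact/eqP/(valP x). Qed.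

Lemma DL_ext x y : dl_fst x = dl_fst y -> dl_snd x = dl_snd y -> x = y.
Proof.
by case: x y => [[u u'] e] [[v v'] e'] /= uv uv'; apply/val_inj; congr pair.
Qed.

Lemma DL_mk (u : T) (u' : T') : hgt end0 u + hgt end0 u' = 0 ->
  exists x, dl_fst x = u /\ dl_snd x = u'.
Proof.
by move=> /eqP e; exists (exist _ (u, u') e).
Qed.

Lemma DL_sym : symmetric (@adj (DL T T')).
Proof. by move=> x y; rewrite /adj /= /dl_adj symT symT'. Qed.

Lemma DL_adjP x y : adj x y <-> adj (dl_fst x) (dl_fst y) /\ adj (dl_snd x) (dl_snd y).
Proof. by split=> [/andP|H]; last exact/andP. Qed.

Lemma DL_adj_cases x y : adj x y ->
  (dl_fst y = par end0 (dl_fst x) /\ dl_snd x = par end0 (dl_snd y)) \/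
  (dl_fst x = par end0 (dl_fst y) /\ dl_snd y = par end0 (dl_snd x)).
Proof.
move=> /DL_adjP[a a']; have [hx hy] := (DL_height x, DL_height y).
case: (adj_parP hT end0 a) => e; case: (adj_parP hT' end0 a') => e'.
- by move: hy; rewrite e e' (hgt_par hT) (hgt_par hT'); lia.
- by left.
- by right.
- by move: hx; rewrite e e' (hgt_par hT) (hgt_par hT'); lia.
Qed.

Definition dl_dist x y : nat :=
  (gdist (dl_fst x) (dl_fst y) + gdist (dl_snd x) (dl_snd y) -
   `|hgt end0 (dl_fst x) - hgt end0 (dl_fst y)|)%N.

(** A move to the parent in one tree is a move to a child in the other. On a walk from x to y the
    height in T must reach that of the confluent in T, i below the start, and that of the confluent
    in T', i' above it. Visiting first the extreme opposite to the final height is optimal, and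
    saves exactly the height difference on the sum of the tree distances. *)
Lemma dl_distP x y : walk_of_length x y (gdist x y) /\ gdist x y = dl_dist x y.
Proof.
have lip u u' : adj u u' -> (dl_dist u y <= (dl_dist u' y).+1)%N.
  have := DL_height y; have := DL_height u; have := DL_height u'; rewrite /dl_dist.
  move=> hu' hu hy /DL_adj_cases[] [e e'].
    have [i [j [d1 d2 d3 d4]]] := par_cases hT end0 (dl_fst u) (dl_fst y).
    have [i' [j' [d1' d2' d3' d4']]] := par_cases hT' end0 (dl_snd u') (dl_snd y).
    rewrite -e -e' in d3 d4 d3' d4'.
    by case: d4 => [[? ? d4]|[? d4]]; case: d4' => [[? ? d4']|[? d4']]; lia.
  have [i [j [d1 d2 d3 d4]]] := par_cases hT end0 (dl_fst u') (dl_fst y).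
  have [i' [j' [d1' d2' d3' d4']]] := par_cases hT' end0 (dl_snd u) (dl_snd y).
  rewrite -e -e' in d3 d4 d3' d4'.
  by case: d4 => [[? ? d4]|[? d4]]; case: d4' => [[? ? d4']|[? d4']]; lia.
move: x; apply: gdist_unique => //; first exact: DL_sym.
- by rewrite /dl_dist (gdistxx (tree_connected hT)) (gdistxx (tree_connected hT')).
- move=> x; rewrite /dl_dist => D0; apply: DL_ext; apply/eqP.
    rewrite -(gdist_eq0 (tree_connected hT)).
    have := hgt_lipschitz hT end0 (dl_fst x) (dl_fst y).
    have := hgt_lipschitz hT' end0 (dl_snd x) (dl_snd y).
    have := DL_height y; have := DL_height x; lia.
  rewrite -(gdist_eq0 (tree_connected hT')).
  have := hgt_lipschitz hT end0 (dl_fst x) (dl_fst y).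
  have := hgt_lipschitz hT' end0 (dl_snd x) (dl_snd y).
  have := DL_height y; have := DL_height x; lia.
move=> x D0.
have [c [ac cp]] : exists c, adj (dl_fst x) c /\ par end0 c = dl_fst x.
  have [fc cc] := ncard_children hT end0 (dl_fst x); apply: contrapT => none.
  have : children end0 (dl_fst x) = set0.
    by apply/seteqP; split=> // c cc'; apply: none; exists c.
  by move=> c0; move: cc; rewrite c0 ncard0 /=; lia.
have [c' [ac' cp']] : exists c, adj (dl_snd x) c /\ par end0 c = dl_snd x.
  have [fc cc] := ncard_children hT' end0 (dl_snd x); apply: contrapT => none.
  have : children end0 (dl_snd x) = set0.
    by apply/seteqP; split=> // c' cc'; apply: none; exists c'.
  by move=> c0; move: cc; rewrite c0 ncard0 /=; lia.
have [ap ap'] := (adj_par hT end0 (dl_fst x), adj_par hT' end0 (dl_snd x)).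
have [hx hy] := (DL_height x, DL_height y).
have goA c1 : adj (dl_snd x) c1 -> par end0 c1 = dl_snd x ->
    exists z, [/\ adj x z, dl_fst z = par end0 (dl_fst x) & dl_snd z = c1].
  move=> a1 p1; have [|z [z1 z2]] := @DL_mk (par end0 (dl_fst x)) c1.
    by have := hgt_par hT' end0 c1; rewrite p1 (hgt_par hT); lia.
  by exists z; split=> //; apply/DL_adjP; rewrite z1 z2.
have goB c1 : adj (dl_fst x) c1 -> par end0 c1 = dl_fst x ->
    exists z, [/\ adj x z, dl_fst z = c1 & dl_snd z = par end0 (dl_snd x)].
  move=> a1 p1; have [|z [z1 z2]] := @DL_mk c1 (par end0 (dl_snd x)).
    by have := hgt_par hT end0 c1; rewrite p1 (hgt_par hT'); lia.
  by exists z; split=> //; apply/DL_adjP; rewrite z1 z2.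
have [i [j [d1 d2 d3 d4]]] := par_cases hT end0 (dl_fst x) (dl_fst y).
have [i' [j' [d1' d2' d3' d4']]] := par_cases hT' end0 (dl_snd x) (dl_snd y).
have [ic [jc [e1 e2 e3 e4]]] := par_cases hT end0 c (dl_fst y).
have [ic' [jc' [e1' e2' e3' e4']]] := par_cases hT' end0 c' (dl_snd y).
rewrite cp in e3 e4; rewrite cp' in e3' e4'; rewrite /dl_dist in D0.
have ij : i%:Z - j%:Z = j'%:Z - i'%:Z by lia.
have chA : (0 < i)%N -> (gdist c (dl_fst y) = i.+1 + j)%N.
  by case: e4 => [[? ? ?]|[? ?]]; lia.
have chA' : (0 < i')%N -> (gdist c' (dl_snd y) = i'.+1 + j')%N.
  by case: e4' => [[? ? ?]|[? ?]]; lia.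
have ch0 : i = 0%N -> j = 0%N -> gdist c (dl_fst y) = 1%N.
  by case: e4 => [[? ? ?]|[? ?]]; lia.
have ch0' : i' = 0%N -> j' = 0%N -> gdist c' (dl_snd y) = 1%N.
  by case: e4' => [[? ? ?]|[? ?]]; lia.
have upA : (0 < i)%N -> (gdist (par end0 (dl_fst x)) (dl_fst y)).+1 = (i + j)%N.
  by case: d4 => [[? ? ?]|[? ?]]; lia.
have upA' : (0 < i')%N -> (gdist (par end0 (dl_snd x)) (dl_snd y)).+1 = (i' + j')%N.
  by case: d4' => [[? ? ?]|[? ?]]; lia.
move=> {d4 d4' e1 e2 e4 e1' e2' e4'}.
(* For i < j the walk moves to parents in T, any child serving in T', until i = 0; then it moves in
   T to the child towards y. The case j < i mirrors this in T'. For i = j it moves to the parent in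
   T, or in T' if i = 0. *)
have [lt|gt|eq] := ltgtP i j.
- have [i0|i0] := posnP i.
    have [||v [xv pv dv]] := @child_towards _ _ hT end0 (dl_fst x) (dl_fst y); [lia|lia|].
    have [z [az z1 z2]] := goB v xv pv; exists z => //; rewrite /dl_dist z1 z2.
    by have := hgt_par hT end0 v; rewrite pv; have := upA'; lia.
  have [z [az z1 z2]] := goA c' ac' cp'; exists z => //; rewrite /dl_dist z1 z2.
  by have := upA i0; have := chA'; lia.
- have [i0|i0] := posnP i'.
    have [||v [xv pv dv]] := @child_towards _ _ hT' end0 (dl_snd x) (dl_snd y); [lia|lia|].
    have [z [az z1 z2]] := goA v xv pv; exists z => //; rewrite /dl_dist z1 z2.
    by have := upA; lia.
  have [z [az z1 z2]] := goB c ac cp; exists z => //; rewrite /dl_dist z1 z2.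
  by have := upA' i0; have := chA; lia.
- have [i0|i0] := posnP i.
    have [z [az z1 z2]] := goB c ac cp; exists z => //; rewrite /dl_dist z1 z2.
    by have := upA'; have := ch0; lia.
  have [z [az z1 z2]] := goA c' ac' cp'; exists z => //; rewrite /dl_dist z1 z2.
  by have := upA i0; have [i0'|i0'] := posnP i'; [have := ch0'|have := chA']; lia.
Qed.

Lemma DL_connected : connected_graph (DL T T').
Proof.
split; first exact: DL_sym.
by move=> x y; exists (gdist x y); apply: (proj1 (dl_distP x y)).
Qed.

Lemma DL_gdist x y : gdist x y = dl_dist x y.
Proof. exact: (proj2 (dl_distP x y)). Qed.

(* Both coordinates of a walk change parity at every step. *)
Lemma DL_adj_dist x y z : adj x y ->
  gdist x z = (gdist y z).+1 \/ gdist y z = (gdist x z).+1.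
Proof.
move=> xy; have := adj_gdist_le DL_connected z xy.
have := adj_gdist_le_sym DL_connected z xy; rewrite !DL_gdist /dl_dist.
have := DL_height x; have := DL_height y; have := DL_height z.
have := adj_hgt hT end0 (proj1 (proj1 (DL_adjP x y) xy)).
have [i1 [j1 [_ -> ?]]] := hgt_merge hT end0 (dl_fst x) (dl_fst z).
have [i2 [j2 [_ -> ?]]] := hgt_merge hT end0 (dl_fst y) (dl_fst z).
have [i3 [j3 [_ -> ?]]] := hgt_merge hT' end0 (dl_snd x) (dl_snd z).
have [i4 [j4 [_ -> ?]]] := hgt_merge hT' end0 (dl_snd y) (dl_snd z).
by move=> [] *; lia.
Qed.

End DLDistance.

(** * Counting vertices *)

Lemma finite_ball (G : rooted_graph) (x : G) n : connected_graph G ->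
  (forall y : G, finite_set (nbr_set y)) ->
  finite_set [set y | (gdist x y <= n)%N].
Proof.
move=> cG fG; elim: n => [|n IH].
  have -> : [set y | (gdist x y <= 0)%N] = [set x]; last exact: finite_set1.
  by apply/seteqP; split=> y /=; rewrite leqn0 gdist_eq0 //; [move=> /eqP ->|move=> ->].
suff : [set y | (gdist x y <= n.+1)%N] `<=`
    [set y | (gdist x y <= n)%N] `|`
    \bigcup_(z in [set y | (gdist x y <= n)%N]) nbr_set z.
  move=> /sub_finite_set; apply; rewrite finite_setU; split=> //.
  exact: bigcup_finite.
move=> y /=; have [d0|d0] := posnP (gdist x y); first by left => /=; rewrite d0.
have [z yz <-] := gdist_stepr cG d0; rewrite ltnS => dz.
by right; exists z => //=; rewrite /nbr_set /= (proj1 cG).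
Qed.

Lemma ncard_bigcup_le (V : choiceType) (F : nat -> set V) n :
  (forall i, finite_set (F i)) ->
  finite_set (\bigcup_(i < n) F i) /\
  (ncard (\bigcup_(i < n) F i) <= \sum_(i < n) ncard (F i))%N.
Proof.
move=> fF; elim: n => [|n [fn IH]].
  by rewrite bigcup_mkord !big_ord0 ncard0; split.
rewrite bigcup_mkord !big_ord_recr /= -bigcup_mkord; split.
  by rewrite finite_setU.
by rewrite (leq_trans (ncardU_le fn (fF n))) // leq_add2r.
Qed.

Section TreeCounting.
Variables (k : nat) (T : rooted_graph).
Hypothesis hT : regular_tree T k.+1.
Implicit Types (u v x y : T) (w : tree_end T).
Let cT := tree_connected hT.
Let symT := tree_sym hT.

Lemma tree_ball_finite n : finite_set [set v : T | (gdist org v <= n)%N].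
Proof. by apply: finite_ball => // y; have [] := ncard_nbr hT y. Qed.

Lemma further_nbrs u : (0 < gdist org u)%N ->
  ncard [set v | adj u v /\ gdist org v = (gdist org u).+1] = k.
Proof.
move=> u0; have [fu cu] := ncard_nbr hT u.
have [z uz dz] := gdist_stepr cT u0.
have -> : [set v | adj u v /\ gdist org v = (gdist org u).+1] = nbr_set u `\ z.
  apply/seteqP; split=> v /=.
    by move=> [uv dv]; split=> // vz; rewrite vz in dv; lia.
  move=> [uv vz]; split=> //; rewrite ![gdist org _](gdistC cT).
  apply: (further_nbr hT uz uv); first by apply/eqP => zv; apply: vz.
  by rewrite ![gdist _ org](gdistC cT).
have := ncardID [set z] fu; rewrite setIC.
have -> : [set z] `&` nbr_set u = [set z].
  by apply/seteqP; split=> v /= => [[] //|->].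
by rewrite ncard_set1 cu -setDE => -[].
Qed.

Definition cap u r : set T := [set v | geod org v u /\ gdist org v = (gdist org u + r)%N].

Lemma cap_finite u r : finite_set (cap u r).
Proof. by apply: sub_finite_set (tree_ball_finite (gdist org u + r)) => v [_ /= ->]. Qed.

Lemma ncard_layers (A : set T) n m : (forall v, A v -> gdist org v = n) ->
  (forall v, A v -> ncard [set w | adj v w /\ gdist org w = n.+1] = m) ->
  ncard [set w | gdist org w = n.+1 /\ exists2 v, A v & adj v w] = (ncard A * m)%N.
Proof.
move=> An Am.
have fA : finite_set A by apply: sub_finite_set (tree_ball_finite n) => v /An /= ->.
have fB v : A v -> finite_set [set w | adj v w /\ gdist org w = n.+1].
  by move=> _; apply: sub_finite_set (tree_ball_finite n.+1) => w [_ /= ->].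
have [fS cS] := ncard_sigma fA fB.
rewrite (@ncard_bij _ _ snd _ _ fS); last first.
- apply/seteqP; split=> [_ [[v w] /= [Av [vw dw]] <-] /=|w [dw [v Av vw]]].
    by split=> //; exists v.
  by exists (v, w).
- move=> [v w] [v' w'] /set_mem /= [Av [vw dw]] /set_mem /= [Av' [vw' dw']] ww'.
  rewrite -{}ww' in vw' dw' *; congr pair.
  apply: (closer_nbr_unique hT (v := w) (a := org)); rewrite 1?symT //.
    by rewrite ![gdist _ org](gdistC cT) dw (An _ Av).
  by rewrite ![gdist _ org](gdistC cT) dw (An _ Av').
rewrite cS (eq_big_seq (fun=> m)); last by move=> v /(ncard_mem _ fA)/Am.
by rewrite big_const_seq count_predT iter_addn_0 mulnC.
Qed.

Lemma ncard_cap u r : (0 < gdist org u)%N -> ncard (cap u r) = (k ^ r)%N.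
Proof.
move=> u0; elim: r => [|r IH].
  rewrite (_ : cap u 0 = [set u]) ?ncard_set1 //; apply/seteqP; split=> v /=.
    move=> [gv dv]; apply: (geod_unique hT (geod_refl hT org v) gv).
    by rewrite dv addn0.
  by move=> ->; split; [exact: (geod_refl hT)|rewrite addn0].
rewrite expnSr -IH -(@ncard_layers (cap u r) (gdist org u + r)%N) => [|v []//|].
  congr ncard; apply/seteqP; split=> w.
    move=> [gw dw]; split; first by rewrite dw addnS.
    have [|v wv dv] := gdist_stepr cT (x := org) (y := w); first by rewrite dw; lia.
    have gv : geod org w v.
      rewrite /geod /= -dv; have := adj_gdist1 wv; rewrite (gdistC cT).
      have := gdist_triangle cT org v w; lia.
    exists v; last by rewrite symT.
    split; last by move: dw; rewrite -dv addnS => -[].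
    by apply: (geod_le hT gw gv); move: dw; rewrite -dv addnS => -[->]; rewrite leq_addr.
  move=> [dw [v [gv dv] vw]]; split; last by rewrite dw addnS.
  apply: (geod_trans hT gv); rewrite /geod /= dv dw.
  have := adj_gdist1 vw; have := gdist_triangle cT org v w; lia.
move=> v [gv dv]; rewrite -dv further_nbrs // dv; lia.
Qed.

Lemma ncard_sphere n : ncard [set v : T | gdist org v = n.+1] = (k.+1 * k ^ n)%N.
Proof.
elim: n => [|n IH].
  rewrite expn0 muln1 -[RHS](proj2 (ncard_nbr hT org)); congr ncard.
  apply/seteqP; split=> v /=.
    move=> dv; have [|z vz dz] := gdist_stepr cT (x := org) (y := v); first by rewrite dv.
    have /eqP : gdist org z = 0%N by move: dz; rewrite dv => -[].
    by rewrite (gdist_eq0 cT) => /eqP ->; rewrite /nbr_set /= symT.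
  move=> ov; have := adj_gdistP hT org ov.
  by rewrite (gdistxx cT) (gdistC cT) => -[].
rewrite expnSr mulnA -IH -(@ncard_layers [set v | gdist org v = n.+1] n.+1) //.
  congr ncard; apply/seteqP; split=> w /= => [dw|[]//]; split=> //.
  have [|v wv dv] := gdist_stepr cT (x := org) (y := w); first by rewrite dw.
  by exists v; [move: dv; rewrite dw => -[]|rewrite symT].
by move=> v /= dv; rewrite -dv further_nbrs // dv.
Qed.

Lemma ncard_fiber w j c : finite_set [set v | iter j (par w) v = c] /\
  ncard [set v | iter j (par w) v = c] = (k ^ j)%N.
Proof.
elim: j => [|j [fj IH]].
  rewrite (_ : [set v | _] = [set c]) ?ncard_set1; first by split=> //; apply: finite_set1.
  by apply/seteqP; split.
have fB v : [set v | iter j (par w) v = c] v -> finite_set (children w v).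
  by move=> _; have [] := ncard_children hT w v.
have [fS cS] := ncard_sigma fj fB.
have e : snd @` [set xy | iter j (par w) xy.1 = c /\ children w xy.1 xy.2] =
    [set v | iter j.+1 (par w) v = c].
  apply/seteqP; split=> [_ [[v x] /= [<- [vx xv] <-] /=]|x xc].
    by rewrite -iterS iterSr xv.
  exists (par w x, x); split=> //=; first by rewrite -iterSr.
  by split=> //; rewrite symT; apply: adj_par hT _ _.
rewrite -e; split; first exact: finite_image.
rewrite ncard_image //; last first.
  by move=> [v x] [v' x'] /set_mem /= [_ [_ <-]] /set_mem /= [_ [_ <-]] /= ->.
rewrite cS (eq_big_seq (fun=> k)).
  by rewrite big_const_seq count_predT iter_addn_0 -/(ncard _) IH -expnS.
by move=> v _; have [_ ->] := ncard_children hT w v.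
Qed.

(** If v first meets the ray of the root after i steps, and the root after j, then i + j = r and i -
    j < N, so that 2 i < r + N. Such v are descendants of generation i of one vertex of the ray, and
    the powers k^i are summed as a geometric series. The halved exponent is what makes low vertices
    negligible. *)
Lemma ncard_low w r (N : nat) : (1 < k)%N ->
  (ncard [set v | gdist org v = r /\ (hgt w v < N%:Z)%R] <= k ^ ((r + N)./2.+1))%N.
Proof.
move=> k1; pose F i := [set v | iter i (par w) v = iter (r - i) (par w) org].
have fF i : finite_set (F i) by have [] := ncard_fiber w i (iter (r - i) (par w) org).
have [fU cU] := ncard_bigcup_le (r + N)./2.+1 fF.
apply: (@leq_trans (\sum_(i < (r + N)./2.+1) ncard (F i))%N); last first.
  rewrite (eq_bigr (fun i : 'I__ => k ^ i)%N) => [|i _]; last first.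
    by have [_ ->] := ncard_fiber w i (iter (r - i) (par w) org).
  elim: (_./2.+1) => [|m IH]; first by rewrite big_ord0.
  rewrite big_ord_recr /= expnS.
  have : (2 * k ^ m <= k * k ^ m)%N by rewrite leq_mul2r k1 orbT.
  lia.
apply: (leq_trans _ cU); apply: ncard_le => // v [dv hv].
have [i [j [e dvo dh]]] := hgt_merge hT w v org.
rewrite (gdistC cT) dv in dvo; rewrite (hgt_org hT w) in dh.
exists i => /=; first by lia.
by rewrite /F /= e; congr iter; lia.
Qed.

End TreeCounting.

Section DLSwap.
Variables (T T' : htree).

(** Carries every statement about first coordinates over to second coordinates. *)
Definition dl_swap (x : DL T T') : DL T' T :=
  exist _ ((val x).2, (val x).1) (etrans (congr1 (eq_op^~ 0) (addrC _ _)) (valP x)).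

End DLSwap.

Lemma dl_swapK (T T' : htree) : cancel (@dl_swap T T') (@dl_swap T' T).
Proof. by move=> x; apply: val_inj => /=; case: (val x). Qed.

Lemma gdist_swap p q (T T' : htree) (hp : (0 < p)%N) (hq : (0 < q)%N)
    (hT : regular_tree T p.+1) (hT' : regular_tree T' q.+1) (x y : DL T T') :
  gdist (dl_swap x) (dl_swap y) = gdist x y.
Proof.
rewrite (DL_gdist hp hq hT hT') (DL_gdist hq hp hT' hT) /dl_dist /dl_fst /dl_snd /=.
rewrite addnC; congr subn.
have h (z : DL T T') : hgt end0 (sval z).2 = - hgt end0 (sval z).1.
  by apply/eqP; rewrite -addr_eq0 addrC; exact: (valP z).
by rewrite !h opprK addrC distnC.
Qed.

Section DLCounting.
Variables (p q : nat) (T T' : htree).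
Hypotheses (hp : (1 < p)%N) (hq : (1 < q)%N).
Hypotheses (hT : regular_tree T p.+1) (hT' : regular_tree T' q.+1).
Implicit Types x y z : DL T T'.

Let hp0 : (0 < p)%N := ltnW hp.
Let hq0 : (0 < q)%N := ltnW hq.
Let cT' := tree_connected hT'.

Lemma DL_nbr x : finite_set (nbr_set x) /\ ncard (nbr_set x) = (p + q)%N.
Proof.
pose u := dl_fst x; pose u' := dl_snd x.
have [fu cu] := ncard_children hT end0 u.
have [fu' cu'] := ncard_children hT' end0 u'.
pose A := (fun v => (v, par end0 u')) @` children end0 u.
pose B := pair (par end0 u) @` children end0 u'.
have e : val @` nbr_set x = A `|` B.
  apply/seteqP; split=> [_ [y xy <-]|].
    have /DL_adjP[a a'] := xy.
    case: (DL_adj_cases hp0 hq0 hT hT' xy) => -[e e']; [right|left].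
      exists (dl_snd y); first by split.
      by rewrite -e /dl_fst /dl_snd; case: (val y).
    by exists (dl_fst y) => //; rewrite -e'; rewrite /dl_fst /dl_snd; case: (val y).
  have hx := DL_height x; rewrite -/u -/u' in hx.
  move=> _ [] [v [uv vu] <-].
    have [|y [y1 y2]] := @DL_mk T T' v (par end0 u').
      by have := hgt_par hT end0 v; rewrite vu (hgt_par hT'); lia.
    exists y; last by rewrite -y1 -y2 /dl_fst /dl_snd; case: (val y).
    by apply/DL_adjP; rewrite y1 y2; split=> //; apply: adj_par hT' _ _.
  have [|y [y1 y2]] := @DL_mk T T' (par end0 u) v.
    by have := hgt_par hT' end0 v; rewrite vu (hgt_par hT); lia.
  exists y; last by rewrite -y1 -y2 /dl_fst /dl_snd; case: (val y).
  by apply/DL_adjP; rewrite y1 y2; split=> //; apply: adj_par hT _ _.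
have fA : finite_set A by apply: finite_image.
have fB : finite_set B by apply: finite_image.
have fAB : finite_set (A `|` B) by rewrite finite_setU.
have fN : finite_set (nbr_set x).
  apply: sub_finite_set (finite_preimage (f := val) (in2W val_inj) fAB).
  by move=> y xy; suff : (A `|` B) (val y) by []; rewrite -e; exists y.
split=> //; rewrite -(ncard_image fN (in2W val_inj)) e ncardU //.
- rewrite !ncard_image // ?cu ?cu' //; first by move=> v v' _ _ [].
  by move=> v v' _ _ [].
- apply/seteqP; split=> // z [[v [uv vu] <-] [v' _ [vp _]]].
  by have := hgt_par hT end0 u; rewrite vp; have := hgt_par hT end0 v; rewrite vu; lia.
Qed.

Lemma DL_ball_finite n : finite_set [set x : DL T T' | (gdist org x <= n)%N].
Proof.
apply: finite_ball; first exact: (DL_connected hp0 hq0 hT hT').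
by move=> y; have [] := DL_nbr y.
Qed.

Lemma DL_gdist_org x : gdist org x =
  (gdist org (dl_fst x) + gdist org (dl_snd x) - `|hgt end0 (dl_fst x)|)%N.
Proof.
by rewrite (DL_gdist hp0 hq0 hT hT') /dl_dist [hgt _ (dl_fst org)](hgt_org hT) sub0r abszN.
Qed.

Lemma DL_fst_le x : (gdist org (dl_fst x) <= gdist org x)%N.
Proof.
have := hgt_lipschitz hT' end0 (dl_snd x) org; rewrite (hgt_org hT') (gdistC cT').
rewrite DL_gdist_org; have := DL_height x; lia.
Qed.

(** Let v have height K. A vertex v' of height -K that meets the ray of the root after i steps is at
    distance 2 i + K from the root; the K cancels in the distance formula, leaving the condition i
    <= J. These v' are the J-th generation below one vertex of the ray. *)
Lemma DL_over (v : T) n : 0 <= hgt end0 v -> (gdist org v <= n)%N ->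
  ncard [set v' : T' | hgt end0 v + hgt end0 v' = 0 /\
    (gdist org v + gdist org v' - `|hgt end0 v| <= n)%N] =
  (q ^ ((n - gdist org v)./2))%N.
Proof.
move=> hv dv; pose J := ((n - gdist org v)./2)%N.
have [K hK] : exists K : nat, hgt end0 v = K%:Z by exists `|hgt end0 v|%N; lia.
rewrite -(proj2 (ncard_fiber hT' end0 J (iter (J + K) (par end0) org))).
congr ncard; apply/seteqP; split=> v' /=.
  have [i [j [e dvo dh]]] := hgt_merge hT' end0 v' org.
  rewrite (hgt_org hT' end0) in dh; rewrite (gdistC cT') dvo => -[hv' dn].
  have iJ : (i <= J)%N by rewrite /J; lia.
  rewrite -(subnK iJ) iterD e -iterD; congr iter; lia.
move=> e; have hv' := hgtE hT' e; split; first by lia.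
have := gdist_triangle cT' org (iter (J + K) (par end0) org) v'.
rewrite (gdist_iter_par hT') -e [gdist (iter _ _ _) v'](gdistC cT') (gdist_iter_par hT') /J; lia.
Qed.

Lemma DL_count (A : set T) n :
  ncard [set x : DL T T' | [/\ (gdist org x <= n)%N, 0 <= hgt end0 (dl_fst x) &
    A (dl_fst x)]] =
  (\sum_(r < n.+1) ncard [set v : T | [/\ gdist org v = r, (0 <= hgt end0 v)%R & A v]] *
    q ^ ((n - r)./2))%N.
Proof.
set X := [set x | _].
have fX : finite_set X by apply: sub_finite_set (DL_ball_finite n) => x [].
rewrite (@ncard_fibers_nat _ (fun x => gdist org (dl_fst x)) _ n fX); last first.
  by move=> x [dx _ _]; apply: leq_trans dx; apply: DL_fst_le.
apply: eq_bigr => r _.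
pose V := [set v : T | [/\ gdist org v = r, 0 <= hgt end0 v & A v]].
pose B (v : T) := [set v' : T' | hgt end0 v + hgt end0 v' = 0 /\
    (gdist org v + gdist org v' - `|hgt end0 v| <= n)%N].
have fV : finite_set V by apply: sub_finite_set (tree_ball_finite hT r) => v [/= ->].
have fB v : V v -> finite_set (B v).
  move=> _; apply: sub_finite_set (tree_ball_finite hT' (n + `|hgt end0 v|)%N) => v' [_ /=].
  lia.
have [fS cS] := ncard_sigma fV fB.
have fX' : finite_set (X `&` [set x | gdist org (dl_fst x) = r]) by apply: finite_setIl.
transitivity (ncard (val @` (X `&` [set x | gdist org (dl_fst x) = r]))).
  by rewrite (ncard_image fX') //; apply: in2W; apply: val_inj.
transitivity (ncard [set xy | V xy.1 /\ B xy.1 xy.2]).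
  congr ncard; apply/seteqP; split.
    move=> _ [x [[dx hx Ax] rx] <-]; split=> //; split; first exact: DL_height.
    by rewrite -DL_gdist_org.
  move=> [v v'] [[/= dv hv Av] [/= hh dn]].
  have [x [x1 x2]] := DL_mk hh; exists x; last first.
    by rewrite -x1 -x2 /dl_fst /dl_snd -surjective_pairing.
  by split; [split|]; rewrite /= ?DL_gdist_org x1 ?x2.
rewrite cS (eq_big_seq (fun=> q ^ ((n - r)./2))%N).
  by rewrite big_const_seq count_predT iter_addn_0 mulnC.
move=> v /(ncard_mem _ fV)[dv hv Av]; rewrite -dv; apply: DL_over => //.
by rewrite dv -ltnS.
Qed.

End DLCounting.

(** * Asymptotics of the counts *)

Lemma halfSS n : n.+2./2 = n./2.+1. Proof. by lia. Qed.

Section Contraction.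
Variable R : realType.
Implicit Types (x y : nat -> R) (c l : R).

(** Two-step recurrences are the natural ones here, because the halved exponents in the counts grow
    once every two steps. *)
Lemma cvg_contraction2 c x y l : 0 <= c < 1 ->
  (forall n, x n.+2 = c * x n + y n) -> y n @[n --> \oo] --> l ->
  x n @[n --> \oo] --> l / (1 - c).
Proof.
move=> /andP[c0 c1] rec yl; pose L := l / (1 - c).
have c10 : 0 < 1 - c by rewrite subr_gt0.
have LE : L = c * L + l by rewrite /L; field; lra.
apply/cvgrPdist_le => /= e e0.
have e2 : 0 < e / 2 * (1 - c) by rewrite mulr_gt0 // divr_gt0.
have /cvgrPdist_le/(_ _ e2)[N _ HN] := yl.
(* The excess of the error over e/2. From N on, two steps multiply it by at most c, whatever its
   sign. *)
pose w n := `|L - x n| - e / 2.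
have wS n : (N <= n)%N -> w n.+2 <= c * w n.
  move=> Nn; rewrite /w rec {1}LE.
  have -> : c * L + l - (c * x n + y n) = c * (L - x n) + (l - y n) by ring.
  have := ler_normD (c * (L - x n)) (l - y n); rewrite normrM (ger0_norm c0).
  have := HN n Nn; rewrite /=; lra.
pose M := Num.max 0 (Num.max (w N) (w N.+1)).
have M0 : 0 <= M by rewrite /M le_max lexx.
have wM n : w (N + n)%N <= c ^+ n./2 * M /\ w (N + n.+1)%N <= c ^+ n.+1./2 * M.
  elim: n => [|n [IH1 IH2]]; first by rewrite addn0 addn1 !expr0 !mul1r /M !le_max !lexx !orbT.
  split=> //; rewrite addnS addnS (le_trans (wS _ _)) ?leq_addr //.
  by rewrite halfSS exprS -mulrA ler_wpM2l.
have : (fun k => c ^+ k * M) k @[k --> \oo] --> (0 * M : R).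
  by apply: cvgMl; apply: cvg_expr; rewrite ger0_norm.
rewrite mul0r => /cvgr0Pnorm_le/(_ (e / 2)); case; first by rewrite divr_gt0.
move=> K _ HK; exists (N + K.*2)%N => // n /= Kn.
have -> : n = (N + (n - N))%N by lia.
have := proj1 (wM (n - N)%N).
have /= := HK ((n - N)./2)%N; rewrite ger0_norm ?mulr_ge0 ?exprn_ge0 //.
move=> /(_ _)/le_trans H1 /le_trans /(_ (H1 _ _ (lexx _))); rewrite /w -/L => H2.
have : `|L - x (N + (n - N))%N| - e / 2 <= e / 2 by apply: H2; rewrite /=; lia.
lra.
Qed.

Lemma cvg_contraction c x y l : 0 <= c < 1 ->
  (forall n, x n.+1 = c * x n + y n) -> y n @[n --> \oo] --> l ->
  x n @[n --> \oo] --> l / (1 - c).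
Proof.
move=> /andP[c0 c1] rec yl.
have -> : l / (1 - c) = (c * l + l) / (1 - c ^+ 2).
  by field; apply/andP; split; nra.
apply: (@cvg_contraction2 (c ^+ 2) x (fun n => c * y n + y n.+1)).
- by rewrite exprn_ge0 //= expr_lt1.
- by move=> n; rewrite !rec; ring.
- by apply: cvgD; [apply: cvgMr|rewrite (cvg_shiftS y)].
Qed.

End Contraction.

Section CountAsymptotics.
Variable R : realType.
Implicit Types p q m : nat.

(** The main term for the vertices whose first coordinate lies beyond a fixed vertex: p^j such
    coordinates j levels further on, each with the number of second coordinates given by
    [DL_over]. *)
Definition weighted_count p q n : nat := (\sum_(j < n.+1) p ^ j * q ^ ((n - j)./2))%N.

Lemma weighted_countS p q n :
  weighted_count p q n.+1 = (p * weighted_count p q n + q ^ (n.+1./2))%N.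
Proof.
rewrite /weighted_count big_ord_recl expn0 mul1n subn0 addnC big_distrr /=.
by congr addn; apply: eq_bigr => i _; rewrite /bump /= add1n subSS expnS mulnA.
Qed.

Lemma weighted_countSS p q n :
  weighted_count p q n.+2 = (q * weighted_count p q n + (p ^ n.+1 + p ^ n.+2))%N.
Proof.
rewrite /weighted_count !big_ord_recr /= subnn subSnn !muln1 -addnA; congr addn.
rewrite mulnDr big_distrr /= subnn muln1; congr addn.
  apply: eq_bigr => i _; rewrite !subSn; last 2 first.
  - by rewrite ltnW.
  - by rewrite (leq_trans (ltnW (ltn_ord i))).
  by rewrite /= expnS mulnCA.
rewrite subSn ?leqnSn // subSnn /= expn1 mulnC //.
Qed.

(* The limit of [weighted_count p q n / m ^ n], where m is the larger of p and q:
   for q <= p it is the sum over i of [q ^ i./2 / p ^ i]. *)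
Definition mass p q : R :=
  if (q <= p)%N then p%:R * (p.+1%:R) / (p%:R ^+ 2 - q%:R) else 0.

Lemma mass_gt0 p q : (1 < p)%N -> (q <= p)%N -> 0 < mass p q.
Proof.
move=> p1 qp; rewrite /mass qp divr_gt0 ?mulr_gt0 ?ltr0n //; first by lia.
rewrite subr_gt0 -natrX ltr_nat; nia.
Qed.

Lemma mass_ge0 p q : (1 < p)%N -> 0 <= mass p q.
Proof.
by move=> p1; have [qp|pq] := leqP q p; [rewrite ltW ?mass_gt0|rewrite /mass leqNgt pq].
Qed.

Lemma natr_invlt1 m : (1 < m)%N -> 0 <= (m%:R^-1 : R) < 1.
Proof. by move=> m1; rewrite invr_ge0 ler0n invf_lt1 ?ltr0n ?ltr1n // ltnW. Qed.

Lemma cvg_half_power m (b : nat) : (1 < m)%N ->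
  (m ^ ((n + b)./2))%:R / m%:R ^+ n @[n --> \oo] --> (0 : R).
Proof.
move=> m1; have m0 : m%:R != 0 :> R by rewrite pnatr_eq0; lia.
rewrite -[0](mul0r (1 - m%:R^-1)^-1).
apply: (cvg_contraction2 (y := fun=> 0)); [exact: natr_invlt1| |exact: cvg_cst].
move=> n; rewrite addr0 !addSn halfSS expnS natrM !exprS.
by field; rewrite m0 expf_neq0.
Qed.

Lemma cvg_nat_half_power m (b : nat) : (1 < m)%N ->
  (n.+1 * m ^ ((n + b)./2))%:R / m%:R ^+ n @[n --> \oo] --> (0 : R).
Proof.
move=> m1; have m0 : m%:R != 0 :> R by rewrite pnatr_eq0; lia.
rewrite -[0](mul0r (1 - m%:R^-1)^-1).
apply: (cvg_contraction2 (c := m%:R^-1) (y :=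
  fun n => (2 / m%:R) * ((m ^ ((n + b)./2))%:R / m%:R ^+ n))).
- exact: natr_invlt1.
- move=> n; rewrite !addSn halfSS expnS !natrM !exprS.
  by rewrite -[n.+3]addn2 natrD; field; rewrite m0 expf_neq0.
- by rewrite -[X in _ --> X](mulr0 (2 / m%:R)); apply: cvgMr; apply: cvg_half_power.
Qed.

(** Which end of the sum is split off depends on the larger degree. For q <= p, removing the last
    two terms gives the ratio q / p^2 and a constant forcing term; for p < q, removing the first
    term gives the ratio p / q and a forcing term that vanishes. *)
Lemma cvg_weighted_count p q : (1 < p)%N -> (1 < q)%N ->
  (weighted_count p q n)%:R / (maxn p q)%:R ^+ n @[n --> \oo] --> mass p q.
Proof.
move=> p1 q1; rewrite /mass; have [qp|pq] := leqP q p.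
  have p0 : p%:R != 0 :> R by rewrite pnatr_eq0; lia.
  have D0 : p%:R ^+ 2 - q%:R != 0 :> R.
    by rewrite subr_eq0 -natrX eqr_nat; apply/eqP; nia.
  have -> : p%:R * (p.+1%:R) / (p%:R ^+ 2 - q%:R) =
      (1 / p%:R + 1) / (1 - q%:R / p%:R ^+ 2) :> R.
    by rewrite -addn1 natrD; field; rewrite p0 D0.
  apply: (cvg_contraction2 (y := fun=> 1 / p%:R + 1)); last exact: cvg_cst.
    have pp : 0 < p%:R :> R by rewrite ltr0n; lia.
    by rewrite divr_ge0 ?exprn_ge0 ?ler0n //= ltr_pdivrMr ?exprn_gt0 // mul1r -natrX ltr_nat; nia.
  move=> n; rewrite weighted_countSS !natrD !natrM !natrX !exprS.
  by field; rewrite p0 expf_neq0.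
have q0 : q%:R != 0 :> R by rewrite pnatr_eq0; lia.
rewrite -[0](mul0r (1 - p%:R / q%:R)^-1).
apply: (cvg_contraction (c := p%:R / q%:R) (y :=
  fun n => q%:R^-1 * ((q ^ ((n + 1)./2))%:R / q%:R ^+ n))).
- rewrite divr_ge0 ?ler0n //= ltr_pdivrMr ?ltr0n; last by lia.
  by rewrite mul1r ltr_nat.
- move=> n; rewrite weighted_countS addn1 !natrD !natrM !exprS.
  by field; rewrite q0 expf_neq0.
- by rewrite -[X in _ --> X](mulr0 q%:R^-1); apply: cvgMr; apply: cvg_half_power.
Qed.

Definition low_count p q N n : nat :=
  (\sum_(r < n.+1) p ^ ((r + N)./2.+1) * q ^ ((n - r)./2))%N.

(** The two exponents add up to at most (n + N + 2) / 2, so each of the n+1 terms is of the order of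
    the square root of m^n. *)
Lemma cvg_low_count p q N : (1 < p)%N -> (1 < q)%N ->
  (low_count p q N n)%:R / (maxn p q)%:R ^+ n @[n --> \oo] --> (0 : R).
Proof.
move=> p1 q1; set m := maxn p q; have m1 : (1 < m)%N by rewrite /m; lia.
apply: (squeeze_cvgr (f := fun=> 0)
  (h := fun n => (n.+1 * m ^ ((n + N.+2)./2))%:R / m%:R ^+ n)); last 2 first.
- exact: cvg_cst.
- exact: cvg_nat_half_power.
near=> n; rewrite divr_ge0 ?exprn_ge0 //=.
rewrite ler_pM2r ?invr_gt0 ?exprn_gt0 ?ltr0n 1?ltnW //.
rewrite ler_nat -[X in (_ <= X * _)%N]card_ord -sum_nat_const leq_sum // => r _.
apply: (@leq_trans (m ^ ((r + N)./2.+1) * m ^ ((n - r)./2))%N).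
  have lem a e : (a <= m)%N -> (a ^ e <= m ^ e)%N by case: e => // e; rewrite leq_exp2r.
  by rewrite leq_mul // lem // /m; lia.
rewrite -expnD leq_exp2l //; have := ltn_ord r; lia.
Unshelve. all: by end_near. Qed.

End CountAsymptotics.

Section Ancestors.
Variables (k : nat) (T : rooted_graph).
Hypothesis hT : regular_tree T k.

Definition anc r (v : T) : T := xget org [set u | gdist org u = r /\ geod org v u].

Lemma ancP r v : (r <= gdist org v)%N -> gdist org (anc r v) = r /\ geod org v (anc r v).
Proof.
move=> rv; have [u du gu] := gdist_at (tree_connected hT) rv.
by rewrite /anc; case: xgetP => [x _ //|/(_ u)[]].
Qed.

Lemma anc_unique r v u : gdist org u = r -> geod org v u -> anc r v = u.
Proof.
move=> du gu; have rv : (r <= gdist org v)%N by move: gu; rewrite /geod /= du; lia.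
have [d g] := ancP rv; apply: (geod_unique hT g gu); by rewrite d du.
Qed.

End Ancestors.

Section DLAsymptotics.
Variables (R : realType) (p q : nat) (T T' : htree).
Hypotheses (hp : (1 < p)%N) (hq : (1 < q)%N).
Hypotheses (hT : regular_tree T p.+1) (hT' : regular_tree T' q.+1).
Let m := maxn p q.
Definition dl_above N (A : set T) n : set (DL T T') :=
  [set x | [/\ (gdist org x <= n)%N, N%:Z <= hgt end0 (dl_fst x) & A (dl_fst x)]].

Lemma dl_above_finite N A n : finite_set (dl_above N A n).
Proof. by apply: sub_finite_set (DL_ball_finite hp hq hT hT' n) => x []. Qed.

(** Without the height condition ([b] instead of [a]) the sum is exactly a [weighted_count], shifted
    by the level of u; the condition costs at most [low_count]. The root is excluded because it has
    one more outward neighbour than the other vertices. *)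
Lemma dl_above_cvg (u : T) N : (0 < gdist org u)%N ->
  (ncard (dl_above N [set v | geod org v u] n))%:R / m%:R ^+ n @[n --> \oo] -->
  (mass R p q / m%:R ^+ gdist org u).
Proof.
move=> u0; set r0 := gdist org u.
have m0 : 0 < m%:R :> R by rewrite ltr0n /m; lia.
pose a r := ncard [set v : T |
  [/\ gdist org v = r, (0 <= hgt end0 v)%R & (N%:Z <= hgt end0 v)%R /\ geod org v u]].
pose b r := ncard [set v : T | gdist org v = r /\ geod org v u].
have fb r : finite_set [set v : T | gdist org v = r /\ geod org v u].
  by apply: sub_finite_set (tree_ball_finite hT r) => v [/= ->].
have cE n : ncard (dl_above N [set v | geod org v u] n) =
    (\sum_(r < n.+1) a r * q ^ ((n - r)./2))%N.
  rewrite -(DL_count hp hq hT hT' (fun v => (N%:Z <= hgt end0 v)%R /\ geod org v u)).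
  congr ncard; apply/seteqP; split=> x /=; first by move=> [? ? ?]; split=> //; lia.
  by move=> [? ? []].
have ab r : (a r <= b r)%N by apply: ncard_le => // v [dv _ [_ gv]].
have ba r : (b r <= a r + p ^ ((r + N)./2.+1))%N.
  apply: (leq_trans _ (leq_add (leqnn _) (ncard_low hT end0 r N hp))).
  rewrite /b (ncardID [set v | (N%:Z <= hgt end0 v)%R] (fb r)) leq_add ?ncard_le //.
  - apply: sub_finite_set (fb r) => v [? _ []] //.
  - by move=> v [[dv gv] /= hv]; split=> //; lia.
  - by apply: sub_finite_set (tree_ball_finite hT r) => v [/= ->].
  - by move=> v [[dv gv] /= hv]; split=> //; move/negP: hv; rewrite -ltNge.
have bE i : b (r0 + i)%N = (p ^ i)%N.
  rewrite -(ncard_cap hT i u0); congr ncard.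
  by apply/seteqP; split=> v [].
have b0 i : (i < r0)%N -> b i = 0%N.
  move=> ir; rewrite /b (_ : [set v | _] = set0) ?ncard0 //.
  by apply/seteqP; split=> // v [dv]; rewrite /geod /= dv -/r0; lia.
have bV i : (\sum_(r < (i + r0).+1) b r * q ^ ((i + r0 - r)./2))%N = weighted_count p q i.
  have -> : (i + r0).+1 = (r0 + i.+1)%N by lia.
  rewrite big_split_ord /= big1 ?add0n; last first.
    by move=> j _; rewrite (b0 _ (ltn_ord j)) mul0n.
  by apply: eq_bigr => j _; rewrite bE (addnC i) subnDl.
have lowE n : (\sum_(r < n.+1) b r * q ^ ((n - r)./2) <=
    ncard (dl_above N [set v | geod org v u] n) + low_count p q N n)%N.
  by rewrite cE /low_count -big_split leq_sum // => r _ /=; rewrite -mulnDl leq_mul2r ba orbT.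
have upE n : (ncard (dl_above N [set v | geod org v u] n) <=
    \sum_(r < n.+1) b r * q ^ ((n - r)./2))%N.
  by rewrite cE leq_sum // => r _; rewrite leq_mul2r ab orbT.
pose S n := (\sum_(r < n.+1) b r * q ^ ((n - r)./2))%N.
have Vc : (S n)%:R / m%:R ^+ n @[n --> \oo] --> mass R p q / m%:R ^+ r0.
  rewrite -(cvg_shiftn r0 (fun n => (S n)%:R / m%:R ^+ n : R^o)) /=.
  under eq_fun => n do rewrite /S bV exprD invfM mulrA.
  by apply: cvgMl; apply: cvg_weighted_count.
apply: (squeeze_cvgr (f := fun n => (S n)%:R / m%:R ^+ n -
    (low_count p q N n)%:R / m%:R ^+ n) (h := fun n => (S n)%:R / m%:R ^+ n)) => //; last first.
  by rewrite -[X in _ --> X]subr0; apply: cvgB => //; apply: cvg_low_count.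
near=> n; rewrite -mulrBl !ler_pM2r ?invr_gt0 ?exprn_gt0 // ler_nat upE andbT.
by rewrite lerBlDr -natrD ler_nat lowE.
Unshelve. all: by end_near. Qed.

Definition tree_frac (P : set T) r : R :=
  (ncard [set u : T | gdist org u = r /\ P u])%:R / (p.+1 * p ^ r.-1)%:R.

(* The limit of the number of vertices of the n-ball with a high first
   coordinate, divided by m ^ n. *)
Definition weight : R := p.+1%:R * mass R p q / p%:R.

(** A height of at least N forces the level to be at least r, so that the ancestor exists, and the
    count splits over the vertices of level r. They all have the same limit, which makes the
    ancestor asymptotically uniform. If p < q, both sides vanish with [mass]. *)
Lemma dl_above_frac_cvg (P : set T) r N : (0 < r <= N)%N ->
  (ncard (dl_above N [set v | P (anc r v)] n))%:R / m%:R ^+ n @[n --> \oo] -->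
  (weight * tree_frac P r).
Proof.
move=> /andP[r0 rN].
have m0 : m%:R != 0 :> R by rewrite pnatr_eq0 /m; lia.
have p0 : p%:R != 0 :> R by rewrite pnatr_eq0; lia.
pose S := [set u : T | gdist org u = r /\ P u].
have fS : finite_set S by apply: sub_finite_set (tree_ball_finite hT r) => v [/= ->].
have E n : ncard (dl_above N [set v | P (anc r v)] n) =
    (\sum_(u <- fset_set S) ncard (dl_above N [set v | geod org v u] n))%N.
  have rv (x : DL T T') : N%:Z <= hgt end0 (dl_fst x) -> (r <= gdist org (dl_fst x))%N.
    have := hgt_lipschitz hT end0 (dl_fst x) org; rewrite (hgt_org hT).
    by rewrite (gdistC (tree_connected hT)); lia.
  rewrite (@ncard_fibers _ _ (fun x => anc r (dl_fst x)) _ _ (dl_above_finite _ _ _) (fset_uniq (fset_set S))).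
    apply: eq_big_seq => u /(ncard_mem _ fS)[du Pu]; congr ncard.
    apply/seteqP; split=> x /=.
      by move=> [[dx hx Px] <-]; split=> //; have [] := ancP hT (rv _ hx).
    move=> [dx hx gx]; have e := anc_unique hT du gx.
    by split=> //; split=> //=; rewrite e.
  move=> x [dx hx Px]; apply/(ncard_mem _ fS); split=> //.
  by have [] := ancP hT (rv _ hx).
have -> : weight * tree_frac P r = \sum_(u <- fset_set S) mass R p q / m%:R ^+ r.
  rewrite big_const_seq count_predT iter_addr_0 /weight /tree_frac -/S -[size _]/(ncard S).
  rewrite -(mulr_natr (mass R p q / m%:R ^+ r)) natrM natrX /mass; case: leqP => [qp|_]; last by rewrite mulr0 !mul0r.
  have D0 : p%:R ^+ 2 - q%:R != 0 :> R.
    by rewrite subr_eq0 -natrX eqr_nat; apply/eqP; nia.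
  move: (ncard S) => c; clear S fS E; case: r r0 rN => [//|r] _ _; rewrite /m (maxn_idPl qp) /= (exprS _ r).
  by field; rewrite p0 D0 expf_neq0 //= nat1r pnatr_eq0.
under eq_fun => n do rewrite E natr_sum mulr_suml.
have H (s : seq T) : (forall u, u \in s -> gdist org u = r) ->
    \sum_(u <- s) ((ncard (dl_above N [set v | geod org v u] n))%:R / m%:R ^+ n)
      @[n --> \oo] --> \sum_(u <- s) mass R p q / m%:R ^+ r.
  elim: s => [|u s IH] us.
    by under eq_fun do rewrite big_nil; rewrite big_nil; apply: cvg_cst.
  under eq_fun do rewrite big_cons; rewrite big_cons; apply: cvgD.
    have du : gdist org u = r by apply: us; rewrite inE eqxx.
    by rewrite -{1}du; apply: dl_above_cvg; rewrite du.
  by apply: IH => v vs; apply: us; rewrite inE vs orbT.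
by apply: H => u /(ncard_mem _ fS)[].
Qed.

Lemma dl_low_cvg N :
  (ncard [set x : DL T T' | [/\ (gdist org x <= n)%N, 0 <= hgt end0 (dl_fst x) &
    hgt end0 (dl_fst x) < N%:Z]])%:R / m%:R ^+ n @[n --> \oo] --> (0 : R).
Proof.
apply: (squeeze_cvgr (f := fun=> 0)
  (h := fun n => (low_count p q N n)%:R / m%:R ^+ n)); last 2 first.
- exact: cvg_cst.
- exact: cvg_low_count.
have m0 : 0 < m%:R :> R by rewrite ltr0n /m; lia.
near=> n; rewrite divr_ge0 ?exprn_ge0 ?ler0n //= ler_pM2r ?invr_gt0 ?exprn_gt0 // ler_nat.
rewrite (DL_count hp hq hT hT' (fun v => (hgt end0 v < N%:Z)%R)) leq_sum // => r _.
rewrite leq_mul2r (leq_trans _ (ncard_low hT end0 r N hp)) ?orbT //.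
apply: ncard_le => [|v [dv _ hv]//].
by apply: sub_finite_set (tree_ball_finite hT r) => v [/= ->].
Unshelve. all: by end_near. Qed.

End DLAsymptotics.

(** * The horocompactification of a graph *)

Section FunctionSpace.
Variables (R : realType) (M : mspace R).
Implicit Types f g : fspace M.

Lemma fspace_cvg (F : set_system (fspace M)) (f : fspace M) : Filter F ->
  (forall A : set M, compact A -> F [set g | forall y, A y -> g y = f y]) ->
  F --> f.
Proof.
move=> FF FA; apply/fam_cvgP => A cA P /uniform_nbhs[E [entE EP]].
apply: (@filterS _ F _ [set g : fspace M | forall y, A y -> g y = f y]); last exact: FA.
by move=> g gf; apply: EP => y Ay; rewrite gf //; apply: entourage_refl.
Qed.

Lemma fspace_eval_nbhs f (y : M) (e : R) : 0 < e ->
  nbhs f [set g | `|f y - g y| < e].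
Proof.
move=> e0.
have : nbhs f [set g | forall z, [set y] z ->
    [set xy : R * R | ball xy.1 e xy.2] (f z, g z)].
  apply: fam_nbhs; last exact: compact_set1.
  exact: entourage_ball (PosNum e0).
by apply: filterS => g /(_ y erefl).
Qed.

Lemma fspace_eval_continuous (y : M) : continuous (fun f : fspace M => f y : R).
Proof.
move=> f; apply/(@cvgrPdist_lt _ _ _ _ (nbhs_filter f)) => e e0; exact: fspace_eval_nbhs.
Qed.

Lemma ball_nbhs (x : M) (r : R) (y : M) : Defs.mdist x y < r -> nbhs y [set z | Defs.mdist x z < r].
Proof.
move=> xy; apply: open_nbhs_nbhs; split=> //.
pose B := [set z : M | Defs.mdist x z < r].
exists [set B]; last by rewrite bigcup_set1.
move=> _ ->; exists [fset B]%fset; last by rewrite set_fset1 bigcap_set1.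
by move=> C /fset1P ->; apply/mem_set; exists x, r.
Qed.

End FunctionSpace.

Section GraphCompactification.
Variables (R : realType) (G : rooted_graph).
Hypothesis cG : connected_graph G.
Hypothesis fG : forall n, finite_set (@gball G n).
Notation M := (gspace R G).
Notation F := (fspace M).
Implicit Types (f g : F) (x y : M).

(** On [hbar] these relations describe the topology: two integer-valued functions that are closer
    than 1 on a ball are equal there. *)
Definition agree (r : nat) f g : Prop := forall y : G, (gdist org y <= r)%N -> f y = g y.

Lemma agree_refl r f : agree r f f. Proof. by []. Qed.
Lemma agree_sym r f g : agree r f g -> agree r g f.
Proof. by move=> fg y yr; rewrite fg. Qed.
Lemma agree_trans r f g h : agree r f g -> agree r g h -> agree r f h.
Proof. by move=> fg gh y yr; rewrite fg // gh. Qed.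
Lemma agree_le r r' f g : (r <= r')%N -> agree r' f g -> agree r f g.
Proof. by move=> rr fg y /leq_trans/(_ rr)/fg. Qed.

Lemma horofunE x (y : G) : horofun x y = (gdist y x)%:R - (gdist org x)%:R.
Proof. by []. Qed.

Lemma graph_compact_bounded (A : set M) : compact A ->
  exists r, forall y : G, A y -> (gdist org y <= r)%N.
Proof.
move=> /compact_near_coveringP cA.
have := cA nat \oo (fun r y => (gdist org (y : G) <= r)%N) _.
case=> [x Ax|r _ Hr]; last by exists r => y /(Hr r (leqnn r)).
near=> y r; have -> : y = x.
  have : Defs.mdist x y < 1 by near: y; apply: ball_nbhs; rewrite /= gdistxx // ltr01.
  by rewrite /= ltrn1 ltnS leqn0 gdist_eq0 // => /eqP.
by near: r; exists (gdist org (x : G)).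
Unshelve. all: by end_near. Qed.

Lemma nbhs_agree f (V : set F) : nbhs f V -> exists r, forall g, agree r f g -> V g.
Proof.
pose B r := [set g | agree r f g].
have FB : Filter (filter_from [set: nat] B).
  apply: filter_from_filter; first by exists 0%N.
  by move=> i j _ _; exists (maxn i j) => // g fg; split; apply: agree_le fg;
    rewrite ?leq_maxl ?leq_maxr.
suff cf : filter_from [set: nat] B --> f by move=> /cf[r _ H]; exists r.
apply: fspace_cvg => A /graph_compact_bounded[r Ar]; exists r => // g fg y /Ar yr.
by rewrite fg.
Qed.

Lemma horofun_int x (y : G) : exists i : int, horofun x y = i%:~R.
Proof.
by exists ((gdist y x)%:Z - (gdist org x)%:Z); rewrite horofunE intrB -!pmulrn.
Qed.

Lemma int_eq_lt1 (i j : int) : `|i%:~R - j%:~R : R| < 1 -> i = j.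
Proof.
rewrite -intrB -intr_norm -[1](mulr1z 1) ltr_int => ij; lia.
Qed.

(** Approximation on a ball by integer-valued functions improves to agreement, and a function
    agreeing on every ball with some horofunction satisfies the Lipschitz condition of [hbar]. *)
Lemma hbar_closureP f : (hbar M f <-> closure (range (@horofun R M)) f) /\
  (hbar M f <-> forall r, exists x : M, agree r f (horofun x)).
Proof.
have H1 : closure (range (@horofun R M)) f -> forall r, exists x : M, agree r f (horofun x).
  move=> clf.
  have near_r r (e : R) : 0 < e ->
      exists x : M, forall y : G, (gdist org y <= r)%N -> `|f y - horofun x y| < e.
    move=> e0.
    have : nbhs f [set g | forall y : M, @gball G r y -> `|f y - g y| < e].
      have : nbhs f [set g | forall y : M, @gball G r y ->
        [set xy : R * R | ball xy.1 e xy.2] (f y, g y)].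
        apply: fam_nbhs; first exact: entourage_ball (PosNum e0).
        exact/finite_compact/fG.
      by apply: filterS => g gf y /gf.
    by move=> /clf[g [[x _ <-] gf]]; exists x.
  move=> r; have [x Hx] := near_r r (1 / 2) ltac:(lra).
  exists x => y yr; have [i xi] := horofun_int x y.
  apply/eqP; rewrite -subr_eq0; apply/negPn/negP; rewrite -normr_gt0 => d0.
  (* If f differs from the first approximant at y, take a second one closer than this difference.
     The two integer values at y are less than 1 apart, hence equal, which is a contradiction. *)
  have [z Hz] := near_r r (Num.min (1 / 2) `|f y - horofun x y|) ltac:(rewrite lt_min d0; lra).
  have [j zj] := horofun_int z y.
  have := Hz y yr; rewrite lt_min => /andP[fz]; have := Hx y yr.
  rewrite xi zj in fz * => fx; suff -> : i = j by rewrite ltxx.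
  apply: int_eq_lt1; rewrite -[_ - _](subrKA (f y)) (le_lt_trans (ler_normD _ _)) //.
  by rewrite distrC; lra.
have H2 : (forall r, exists x : M, agree r f (horofun x)) -> hbar M f; last first.
  by split; [split=> [[//]|/H1/H2//]|split=> [[/H1//]|/H2//]].
move=> H; split; last split.
- move=> V /nbhs_agree[r Hr]; have [x fx] := H r.
  by exists (horofun x); split; [exists x|apply: Hr].
- by have [x ->] := H 0%N; rewrite ?horofunE ?subrr ?gdistxx.
move=> x y; have [z Hz] := H (maxn (gdist org (x : G)) (gdist org (y : G))).
rewrite (Hz x) ?leq_maxl // (Hz y) ?leq_maxr // !horofunE /=.
have := gdist_triangle cG x y z; have := gdist_triangle cG y x z.
rewrite (gdistC cG y x) => h1 h2.
rewrite opprB addrA subrK ler_norml -(ler_nat R) natrD in h1 *.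
rewrite -(ler_nat R) natrD in h2; lra.
Qed.

Lemma hbarP f : hbar M f <-> forall r, exists x : M, agree r f (horofun x).
Proof. exact: (proj2 (hbar_closureP f)). Qed.

Lemma hbar_closed : closed (hbar M).
Proof.
rewrite (_ : hbar M = closure (range (@horofun R M))); first exact: closed_closure.
by apply/seteqP; split=> f /(proj1 (hbar_closureP f)).
Qed.

Lemma hbar_int f (y : G) : hbar M f -> exists i : int, f y = i%:~R.
Proof.
by move=> /hbarP/(_ (gdist org y))[x ->] //; apply: horofun_int.
Qed.

Lemma hbar_bound f (y : G) : hbar M f -> `|f y| <= (gdist org y)%:R.
Proof.
move=> [_ [f0 /(_ y (org : G))]]; rewrite (f0 : f (org : G) = 0) subr0.
by rewrite /= (gdistC cG).
Qed.

Lemma hbar_agree_nbhs r f : hbar M f -> nbhs f [set g | hbar M g -> agree r f g].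
Proof.
move=> hf; have : nbhs f [set g | forall y : M, @gball G r y -> `|f y - g y| < 1].
  have : nbhs f [set g | forall y : M, @gball G r y ->
    [set xy : R * R | ball xy.1 1 xy.2] (f y, g y)].
    apply: fam_nbhs; first exact: entourage_ball (PosNum ltr01).
    exact/finite_compact/fG.
  by apply: filterS => g gf y /gf.
apply: filterS => g fg hg y yr.
have [[i fi] [j gj]] := (hbar_int y hf, hbar_int y hg).
by have := fg y yr; rewrite fi gj => /int_eq_lt1 ->.
Qed.

(** The value at y is an integer of absolute value at most the level of y, so an ultrafilter selects
    one value for each y; balls being finite, it then selects the values on a whole ball at once. *)
Lemma hbar_compact : compact (hbar M).
Proof.
rewrite compact_ultra => U UU UK.
have val y : exists c : R, U [set g : F | g y = c].
  pose n := gdist org (y : G).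
  pose P i := [set g : F | g y = (i%:Z - n%:Z)%:~R].
  have : U (\bigcup_(i < n.*2.+1) P i).
    apply: filterS UK => g hg; have [i gi] := hbar_int (y : G) hg.
    have := hbar_bound (y : G) hg; rewrite gi -intr_norm -[X in _ <= X]mulrz_nat ler_int natz.
    by move=> ibnd; exists (absz (i + n%:Z)); rewrite /P /= ?gi; [|congr _%:~R]; lia.
  elim: (n.*2.+1) => [|k IH].
    by rewrite bigcup_mkord big_ord0 => /filter_ex[].
  rewrite bigcup_mkord big_ord_recr /= -bigcup_mkord => Uk.
  have [|/(filterI Uk)] := in_ultra_setVsetC (P k) UU; first by exists (k%:Z - n%:Z)%:~R.
  by rewrite setIUl setICr setU0 => Uk'; apply: IH; apply: filterS Uk' => g [].
have [f Uf] := choice val.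
have Uag r : U [set g | agree r f g].
  have : forall s : seq G, U [set g : F | forall y : G, y \in s -> g y = f y].
    elim=> [|z s IH]; first by apply: filterS filterT => g _ y.
    apply: filterS (filterI (Uf z) IH) => g [gz gs] y.
    by rewrite inE => /predU1P[->|/gs].
  move=> /(_ (fset_set (@gball G r))); apply: filterS => g gs y yr.
  by rewrite gs // in_fset_set ?inE.
have fK : hbar M f.
  apply/hbarP => r; have /filter_ex[g [fg /hbarP/(_ r)[x gx]]] : U ([set g | agree r f g] `&` hbar M).
    exact: filterI.
  by exists x; apply: agree_trans gx.
exists f; split=> // V /nbhs_agree[r Hr]; apply: filterS (Uag r) => g.
exact: Hr.
Qed.

Lemma horofun_hbar x : hbar M (horofun x).
Proof. by apply/hbarP => r; exists x. Qed.

End GraphCompactification.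

(** * Weak convergence and cylinder sets *)

(* [E r x y] reads: the points x and y of the compact set K cannot be told apart
   at resolution r. *)
Record resolution (X : topologicalType) (K : set X) (E : nat -> X -> X -> Prop) : Prop :=
  Resolution {
    res_refl : forall r x, E r x x;
    res_sym : forall r x y, E r x y -> E r y x;
    res_trans : forall r x y z, E r x y -> E r y z -> E r x z;
    res_le : forall r r' x y, (r <= r')%N -> E r' x y -> E r x y;
    res_nbhs : forall x V, K x -> nbhs x V ->
      exists r, forall y, K y -> E r x y -> V y;
    res_open : forall r x, K x -> nbhs x [set y | K y -> E r x y] }.

Section Resolution.
Variables (R : realType) (X : ptopologicalType) (K : set X).
Variable E : nat -> X -> X -> Prop.
Hypotheses (cK : compact K) (clK : closed K) (HE : resolution K E).

Definition rclass r x : set X := K `&` E r x.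

Lemma borel_open (U : set X) : open U -> measurable (U : set (borel X)).
Proof. by move=> oU; apply: sub_sigma_algebra. Qed.

Lemma borel_closed (U : set X) : closed U -> measurable (U : set (borel X)).
Proof.
move=> cU; rewrite -[U]setCK; apply: (@measurableC _ (borel X)).
by apply: borel_open; exact: closed_openC.
Qed.

(** A class is the trace on the closed set K of an open set, because each of its points is interior
    to it relative to K. *)
Lemma rclass_measurable r x : measurable (rclass r x : set (borel X)).
Proof.
have [[y [Ky Exy]]|none] := pselect (exists y, K y /\ E r x y); last first.
  rewrite (_ : rclass r x = set0); first exact: measurable0.
  by apply/seteqP; split=> // y [Ky Exy]; apply: none; exists y.
rewrite (_ : rclass r x = K `&` [set y | K y -> E r x y]°).
  apply: (@measurableI _ (borel X)); first exact: borel_closed.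
  by apply: borel_open; exact: open_interior.
apply/seteqP; split=> z [Kz]; last by move=> /interior_subset Ez; split=> //; apply: Ez.
move=> Exz; split=> //; apply: filterS (res_open HE r Kz) => t Ezt /Ezt.
exact: res_trans HE _ _ _ _ Exz.
Qed.

(** Compactness gives finitely many representatives; they are thinned out so that the classes become
    disjoint and masses can be added. *)
Lemma resolution_reps r : exists s : seq X, [/\ forall x, x \in s -> K x,
  forall y, K y -> exists2 x, x \in s & E r x y, uniq s &
  {in s &, forall x y, E r x y -> x = y}].
Proof.
have [s sK sE] : exists2 s : seq X, forall x, x \in s -> K x &
    forall y, K y -> exists2 x, x \in s & E r x y.
  move: (cK); rewrite compact_cover => /(_ X K (fun x => [set y | K y -> E r x y]°)).
  case=> [x Kx|x Kx|D DK DE]; first exact: open_interior.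
    by exists x => //; apply: res_open.
  exists D => [x /DK/set_mem//|y Ky].
  by have [x xD /interior_subset/(_ Ky)] := DE y Ky; exists x.
suff [s' [ss' sE' us inj]] : exists s', [/\ {subset s' <= s},
    forall x, x \in s -> exists2 y, y \in s' & E r y x, uniq s' &
    {in s' &, forall x y, E r x y -> x = y}].
  exists s'; split=> // [x /ss'/sK//|y Ky].
  have [x xs xy] := sE y Ky; have [z zs zx] := sE' x xs.
  by exists z => //; apply: (res_trans HE) xy.
elim: s {sK sE} => [|x s [s' [ss' sE' us inj]]]; first by exists [::].
have [[y ys' Exy]|none] := pselect (exists2 y, y \in s' & E r x y).
  exists s'; split=> // [z /ss'|z]; first by rewrite inE => ->; rewrite orbT.
  rewrite inE => /predU1P[->|/sE'//]; exists y => //; exact: (res_sym HE).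
exists (x :: s'); split=> [z|z| |].
- by rewrite !inE => /predU1P[->|/ss' ->]; rewrite ?eqxx ?orbT.
- rewrite inE => /predU1P[->|/sE'[y ys' yz]].
    by exists x; [rewrite inE eqxx|exact: (res_refl HE)].
  by exists y => //; rewrite inE ys' orbT.
- rewrite /= us andbT; apply/negP => xs'; apply: none; exists x => //.
  exact: (res_refl HE).
- move=> y z; rewrite !inE => /predU1P[->|ys] /predU1P[->|zs] Eyz //.
  + by case: none; exists z.
  + by case: none; exists y => //; apply: (res_sym HE).
  + exact: inj.
Qed.

Lemma resolution_uniform (f : X -> R) (e : R) : 0 < e -> {within K, continuous f} ->
  exists r, forall x y, K x -> K y -> E r x y -> `|f x - f y| <= e.
Proof.
move=> e0 cf; have /compact_near_coveringP cov := cK.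
have := cov nat \oo (fun r x => K x -> forall y, K y -> E r x y -> `|f x - f y| <= e) _.
case=> [x Kx|r _ Hr]; last by exists r => x y Kx; apply: Hr => //=.
have : nbhs x [set y | K y -> `|f x - f y| <= e / 2].
  have /subspace_continuousP/(_ x Kx)/cvgrPdist_le := cf.
  by move=> /(_ (e / 2)); apply; rewrite divr_gt0.
move=> /(res_nbhs HE Kx)[r Hr]; exists ([set y | K y -> E r x y], [set i | (r <= i)%N]).
  by split; [exact: res_open|exists r].
move=> [y i] [/= Exy ri] Ky z Kz /(res_le HE ri) Eyz.
have Ey := Hr y Ky (Exy Ky) Ky.
have Ez := Hr z Kz (res_trans HE (Exy Ky) Eyz) Kz.
rewrite -(subrKA (f x)) (le_trans (ler_normD _ _)) // distrC.
by rewrite (le_trans (lerD Ey Ez)) // -splitr.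
Qed.

Lemma within_continuous_measurable (f : X -> R) : {within K, continuous f} ->
  measurable_fun (K : set (borel X)) f.
Proof.
move=> cf; apply: (measurability _ (RGenInftyO.measurableE R)).
move=> _ [_ [x ->] <-].
have /continuousP/(_ [set` `]-oo, x[]) : continuous (f : subspace K -> R) := cf.
have oI : open `]-oo, x[%classic by rewrite set_itvE; exact: open_lt.
move=> /(_ oI) /open_subspaceP[V oV VK].
rewrite setIC -VK; apply: (@measurableI _ (borel X)); first exact: borel_open.
exact: borel_closed.
Qed.

Lemma integral_approx (mu : {measure set (borel X) -> \bar R}) (f : X -> R) (M e : R)
    (r : nat) (s : seq X) : (mu K <= 1)%E -> {within K, continuous f} ->
  (forall x, K x -> `|f x| <= M) -> 0 <= e ->
  (forall x, x \in s -> K x) -> (forall y, K y -> exists2 x, x \in s & E r x y) ->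
  uniq s -> {in s &, forall x y, E r x y -> x = y} ->
  (forall x y, K x -> K y -> E r x y -> `|f x - f y| <= e) ->
  exists2 I : R, (\int[mu]_(x in (K : set (borel X))) (f x)%:E)%E = I%:E &
    `|I - \sum_(x <- s) f x * fine (mu (rclass r x))| <= e.
Proof.
move=> mK cf fM e0 sK sE us inj fe.
have mKK : measurable (K : set (borel X)) by exact: borel_closed.
have mf := within_continuous_measurable cf.
have Koo : (mu K < +oo)%E by apply: le_lt_trans mK _; rewrite ltry.
have fI : mu.-integrable (K : set (borel X)) (EFin \o f).
  apply: measurable_bounded_integrable => //; exists M; split; first exact: num_real.
  by move=> y My x Kx; apply: le_trans (fM x Kx) (ltW My).
have indI x : mu.-integrable (K : set (borel X)) (EFin \o (\1_(rclass r x) : X -> R)).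
  apply: measurable_bounded_integrable => //.
    by apply: measurable_indic; exact: rclass_measurable.
  exists 1; split; first exact: num_real.
  move=> y y1 z _; apply: le_trans (ltW y1).
  by rewrite /= indicE; case: (_ \in _); rewrite ?normr1 ?normr0.
pose h x (y : X) : \bar R := ((f x)%:E * ((EFin \o (\1_(rclass r x) : X -> R)) y))%E.
have hI x : mu.-integrable (K : set (borel X)) (h x) by apply: integrableZl.
pose g y := (\sum_(x <- s) h x y)%E.
have gI : mu.-integrable (K : set (borel X)) g by apply: integrable_sum.
have class_fin x : mu (rclass r x) \is a fin_num.
  rewrite ge0_fin_numE // (le_lt_trans _ Koo) // le_measure ?inE //.
    exact: rclass_measurable.
  by move=> y [].
have intg : (\int[mu]_(x in (K : set (borel X))) g x)%E =
    (\sum_(x <- s) f x * fine (mu (rclass r x)))%:E.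
  rewrite integral_sum // -sumEFin; apply: eq_bigr => x _.
  rewrite integralZl // EFinM fineK //; congr (_ * _)%E.
  rewrite integral_indic //; last exact: rclass_measurable.
  by rewrite setIC setIA setIid.
exists (fine (\int[mu]_(x in (K : set (borel X))) (f x)%:E)%E).
  by rewrite fineK //; apply: integrable_fin_num.
rewrite -lee_fin -abse_EFin EFinB fineK; last exact: integrable_fin_num.
rewrite -intg -integralB //.
have mfg := measurable_int _ (integrableB mKK fI gI).
apply: (le_trans (le_abse_integral _ mKK mfg)).
apply: (@le_trans _ _ (e%:E * mu K)%E); last first.
  by rewrite -[leRHS]mule1 lee_wpmul2l ?lee_fin.
apply: integral_le_bound => //; apply: aeW => y Ky /=.
have [x xs xy] := sE y Ky; suff -> : g y = (f x)%:E.
  by rewrite -EFinB lee_fin distrC; apply: fe => //; apply: sK.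
have hy z : h z y = (f z * \1_(rclass r z) y)%:E by [].
rewrite /g (bigD1_seq x) //= big_seq_cond big1 ?adde0 => [|z /andP[zs zx]].
  by rewrite hy indicE mem_set ?mulr1.
rewrite hy indicE memNset ?mulr0 // => -[_ zy]; case/eqP: zx.
by apply: inj => //; apply: (res_trans HE) zy (res_sym HE xy).
Qed.

(** A continuous function on K is uniformly close to one that is constant on the finitely many
    classes of some resolution, and the integral of the latter is a finite combination of class
    masses. *)
Theorem weak_cvg_of_classes (mu : nat -> {measure set (borel X) -> \bar R})
    (nu : {measure set (borel X) -> \bar R}) :
  (forall n, mu n K <= 1)%E -> (nu K <= 1)%E ->
  (forall r x, K x -> fine (mu n (rclass r x)) @[n --> \oo] --> fine (nu (rclass r x))) ->
  weak_cvg K mu nu.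
Proof.
move=> mu1 nu1 cl f cf [M fM].
have approx e : 0 < e -> exists (r : nat) (s : seq X), [/\ forall x, x \in s -> K x,
    forall n, exists2 I : R, (\int[mu n]_(x in (K : set (borel X))) (f x)%:E)%E = I%:E &
    `|I - \sum_(x <- s) f x * fine (mu n (rclass r x))| <= e &
    exists2 I : R, (\int[nu]_(x in (K : set (borel X))) (f x)%:E)%E = I%:E &
    `|I - \sum_(x <- s) f x * fine (nu (rclass r x))| <= e].
  move=> e0; have [r Hr] := resolution_uniform e0 cf.
  have [s [sK sE us inj]] := resolution_reps r.
  exists r, s; split=> // [n|].
    exact: (integral_approx (mu1 n) cf fM (ltW e0) sK sE us inj Hr).
  exact: (integral_approx nu1 cf fM (ltW e0) sK sE us inj Hr).
have [r0 [s0 [_ An [J JE _]]]] := approx 1 ltr01.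
rewrite JE.
have /choice[I IE] n : exists I : R,
    (\int[mu n]_(x in (K : set (borel X))) (f x)%:E)%E = I%:E.
  by have [I IE _] := An n; exists I.
under eq_fun => n do rewrite IE.
apply/cvg_EFin; first by near=> n.
apply/cvgrPdist_le => e e0; have e4 : 0 < e / 4 by rewrite divr_gt0.
have [r [s [sK An' [J' J'E HJ]]]] := approx _ e4.
move: J'E; rewrite JE => -[J'E]; rewrite -{}J'E in HJ.
have : \sum_(x <- s) f x * fine (mu n (rclass r x)) @[n --> \oo] -->
    \sum_(x <- s) f x * fine (nu (rclass r x)).
  elim: s sK {An' HJ} => [|x s IH] sK.
    by under eq_fun do rewrite big_nil; rewrite big_nil; apply: cvg_cst.
  under eq_fun do rewrite big_cons; rewrite big_cons; apply: cvgD.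
    by apply: cvgMr; apply: cl; apply: sK; rewrite inE eqxx.
  by apply: IH => y ys; apply: sK; rewrite inE ys orbT.
move=> /cvgrPdist_le/(_ _ e4); apply: filterS => n; rewrite /= => Hn.
have [I' I'E HI] := An' n; move: I'E; rewrite IE => -[I'E]; rewrite -{}I'E in HI.
rewrite ler_norml; move: HI HJ Hn; rewrite !ler_norml; lra.
Unshelve. all: by end_near. Qed.

Lemma class_indic_continuous r x : {within K, continuous (\1_(rclass r x) : X -> R)}.
Proof.
apply/subspace_continuousP => y Ky; apply: cvg_near_cst.
apply: filterS (res_open HE r Ky) => z /= H Kz; have Eyz := H Kz.
suff : \1_(rclass r x) z = \1_(rclass r x) y :> R by [].
rewrite !indicE; congr (_ (nat_of_bool _)); apply/idP/idP => /set_mem[_ xz]; apply/mem_set.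
  by split=> //; apply: (res_trans HE) xz (res_sym HE Eyz).
by split=> //; apply: (res_trans HE) xz Eyz.
Qed.

Lemma weak_cvg_class (mu : nat -> {measure set (borel X) -> \bar R})
    (nu : {measure set (borel X) -> \bar R}) r x :
  weak_cvg K mu nu -> mu n (rclass r x) @[n --> \oo] --> nu (rclass r x).
Proof.
have mKK : measurable (K : set (borel X)) by exact: borel_closed.
have intE (m : {measure set (borel X) -> \bar R}) :
    (\int[m]_(y in (K : set (borel X))) (\1_(rclass r x) y)%:E)%E = m (rclass r x).
  rewrite integral_indic //; last exact: rclass_measurable.
  by rewrite setIC setIA setIid.
move=> /(_ _ (@class_indic_continuous r x)) H; rewrite -intE.
have -> : (fun n => mu n (rclass r x)) =
    (fun n => \int[mu n]_(y in (K : set (borel X))) (\1_(rclass r x) y)%:E)%E.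
  by apply/funext => n; rewrite intE.
apply: H; exists 1 => y _.
by rewrite indicE; case: (_ \in _) => /=; rewrite ?normr1 ?normr0.
Qed.

(** Indicators of classes are continuous on K, so the limit determines the class masses. The trace
    on K of an open set is an increasing union of finite disjoint unions of classes, and the open
    sets form a generating family stable under intersection. *)
Theorem weak_cvg_unique (mu : nat -> {measure set (borel X) -> \bar R})
    (nu nu' : probability (borel X) R) :
  weak_cvg K mu nu -> weak_cvg K mu nu' -> nu K = 1%E -> nu' K = 1%E ->
  same_measure nu nu'.
Proof.
move=> cnu cnu' nuK nuK'.
have mKK : measurable (K : set (borel X)) by exact: borel_closed.
have eqc r x : nu (rclass r x) = nu' (rclass r x).
  apply: (@cvg_unique _ (@ereal_hausdorff R) (mu n (rclass r x) @[n --> \oo]));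
  exact: weak_cvg_class.
have capK (m : probability (borel X) R) (U : set X) : measurable (U : set (borel X)) ->
    m K = 1%E -> m U = m (U `&` K).
  move=> mU mK; transitivity (m (U `\` K) + m (U `&` K))%E; first exact: measureDI.
  rewrite (_ : m (U `\` K) = 0%E) ?add0e //.
  apply/eqP; rewrite eq_le measure_ge0 andbT.
  have <- : m (~` K) = 0%E by rewrite probability_setC // mK subee.
  by apply: le_measure; rewrite ?inE; [exact: measurableD|exact: measurableC|move=> y []].
have eqU (U : set X) : open U -> nu U = nu' U.
  move=> oU; have mU := borel_open oU; rewrite (capK nu) // (capK nu') //.
  pose Ur r := [set y | K y /\ forall z, K z -> E r y z -> U z].
  have UE : U `&` K = \bigcup_r Ur r.
    apply/seteqP; split=> [y [Uy Ky]|y [r _ [Ky HU]]].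
      have [r Hr] := res_nbhs HE Ky (open_nbhs_nbhs (conj oU Uy)).
      by exists r => //; split.
    by split=> //; apply: HU Ky (res_refl HE _ _).
  have Urs r : exists s : seq X, [/\ uniq s, {in s &, forall x y, E r x y -> x = y} &
      Ur r = \big[setU/set0]_(x <- s) rclass r x].
    have [s [sK sE us inj]] := resolution_reps r.
    exists [seq x <- s | `[< Ur r x >]]; split.
    - exact: filter_uniq.
    - by move=> x y; rewrite !mem_filter => /andP[_ xs] /andP[_ ys]; apply: inj.
    - rewrite -bigcup_seq; apply/seteqP; split=> [y [Ky HU]|y [x /= ]].
        have [x xs xy] := sE y Ky; exists x => //=.
        rewrite mem_filter xs andbT; apply/asboolP; split=> [|z Kz xz]; first exact: sK.
        by apply: HU => //; apply: (res_trans HE) (res_sym HE xy) xz.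
      rewrite mem_filter => /andP[/asboolP[Kx HU] _] [Ky xy]; split=> // z Kz yz.
      by apply: HU => //; apply: (res_trans HE) xy yz.
  have mUr r : measurable (Ur r : set (borel X)).
    have [s [_ _ ->]] := Urs r.
    by apply: (@bigsetU_measurable _ (borel X)) => x _; apply: rclass_measurable.
  have eqr r : nu (Ur r) = nu' (Ur r).
    have [s [us inj ->]] := Urs r.
    have sum (m : probability (borel X) R) : m (\big[setU/set0]_(x <- s) rclass r x) =
        (\sum_(x <- s) m (rclass r x))%E.
      elim: s us inj => [|x s IH] us inj; first by rewrite !big_nil measure0.
      have us' : uniq s by case/andP: us.
      have inj' : {in s &, forall x y, E r x y -> x = y}.
        by move=> y z ys zs; apply: inj; rewrite inE ?ys ?zs orbT.
      rewrite !big_cons -(IH us' inj'); apply: measureU.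
      - exact: rclass_measurable.
      - by apply: (@bigsetU_measurable _ (borel X)) => y _; apply: rclass_measurable.
      - rewrite -bigcup_seq; apply/seteqP; split=> // y [[_ xy] [z zs [_ zy]]].
        have xz : x = z.
          apply: inj; rewrite ?inE ?eqxx ?zs ?orbT //.
          by apply: (res_trans HE) xy (res_sym HE zy).
        by move: us => /andP[]; rewrite xz zs.
    by rewrite !sum; apply: eq_bigr => x _; apply: eqc.
  have nd : nondecreasing_seq Ur.
    move=> i j ij; apply/subsetPset => y [Ky HU]; split=> // z Kz yz.
    by apply: HU => //; apply: (res_le HE ij).
  have mUU : measurable (\bigcup_r Ur r : set (borel X)).
    by apply: (@bigcupT_measurable _ (borel X)).
  have c1 := nondecreasing_cvg_mu (mu := nu) mUr mUU nd.
  have c2 := nondecreasing_cvg_mu (mu := nu') mUr mUU nd.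
  rewrite UE; apply: (@cvg_unique _ (@ereal_hausdorff R) (nu \o Ur @ \oo)) => //; rewrite [X in X @ _](_ : _ = nu' \o Ur) //.
  by apply/funext => r /=; apply: eqr.
move=> A mA; apply: (@measure_unique _ R (borel X) (@open X) (fun=> setT)) => //.
- by move=> U V oU oV; apply: openI.
- by move=> _; apply: openT.
- by rewrite bigcup_const.
- by move=> _; apply: le_lt_trans (probability_le1 nu measurableT) _; rewrite ltry.
Qed.

End Resolution.

(** * The harmonic measure of a cylinder *)

Section FiniteUnions.
Context d (X : measurableType d) (R : realType) (mu : {measure set X -> \bar R}).

Lemma measure_finite_union (U : choiceType) (A : set U) (F : U -> set X) (c : \bar R) :
  finite_set A -> trivIset A F -> (forall i, A i -> measurable (F i)) ->
  (forall i, A i -> mu (F i) = c) ->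
  mu (\bigcup_(i in A) F i) = ((ncard A)%:R%:E * c)%E.
Proof.
move=> fA tF mF cF; rewrite measure_fin_bigcup // fsbig_finite //=.
rewrite (eq_big_seq (fun=> c)); last by move=> i /(ncard_mem _ fA)/cF.
rewrite big_const_seq count_predT -/(ncard A).
elim: (ncard A) => [|n IH] /=; first by rewrite mul0e.
by rewrite IH -natr1 EFinD ge0_muleDl ?lee_fin ?ler0n ?ler01 // mul1e addeC.
Qed.

Lemma measure_bigcup_finite (U : choiceType) (A : set U) (F : U -> set X) :
  finite_set A -> (forall i, A i -> measurable (F i)) ->
  measurable (\bigcup_(i in A) F i).
Proof. exact: fin_bigcup_measurable. Qed.

End FiniteUnions.

Lemma sum_if (V : eqType) (s : seq V) (P : pred V) (a b : nat) :
  (\sum_(y <- s) (if P y then a else b) = count P s * a + count (predC P) s * b)%N.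
Proof.
elim: s => [|y s IH]; first by rewrite big_nil.
by rewrite big_cons IH /=; case: (P y) => /=; lia.
Qed.

Section Walks.
Variables (p : nat) (T : rooted_graph).
Hypotheses (hp : (0 < p)%N) (hT : regular_tree T p.+1).
Implicit Types (x y u v : T) (s : seq T).
Let cT := tree_connected hT.
Let symT := tree_sym hT.

Definition walks n : set (seq T) := [set s | path adj org s /\ size s = n].

Lemma walks_rcons n s y : walks n.+1 (rcons s y) <-> walks n s /\ adj (last org s) y.
Proof.
rewrite /walks /= rcons_path size_rcons; split=> [[/andP[ps ly] [ss]]//|[[ps ss] ly]].
by rewrite ps ly ss.
Qed.

Lemma walks_card n : finite_set (walks n) /\ ncard (walks n) = (p.+1 ^ n)%N.
Proof.
elim: n => [|n [fW IH]].
  apply: (@ncard_seq _ _ [:: [::]]) => // s; rewrite inE /walks /=.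
  by split=> [[_ /eqP]|/eqP ->//]; rewrite size_eq0.
have fN s : walks n s -> finite_set (nbr_set (last org s)).
  by move=> _; have [] := ncard_nbr hT (last org s).
have [fS cS] := ncard_sigma fW fN.
have e : (fun xy => rcons xy.1 xy.2) @`
    [set xy | walks n xy.1 /\ nbr_set (last org xy.1) xy.2] = walks n.+1.
  apply/seteqP; split=> [_ [[s y] [/= sW ly] <-]|s].
    by apply/walks_rcons.
  case/lastP: s => [[_ //]|s y] /walks_rcons[sW ly].
  by exists (s, y).
rewrite -e; split; first exact: finite_image.
rewrite ncard_image //; last first.
  by move=> [s y] [s' y'] _ _ /rcons_inj[-> ->].
rewrite cS (eq_big_seq (fun=> p.+1)).
  by rewrite big_const_seq count_predT iter_addn_0 -/(ncard _) IH -expnS.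
by move=> s _; have [_ ->] := ncard_nbr hT (last org s).
Qed.

Lemma walks_finite n (A : set (seq T)) : finite_set (walks n `&` A).
Proof. by apply: finite_setIl; have [] := walks_card n. Qed.

Definition walks_to n x : set (seq T) := walks n `&` [set s | last org s = x].

(** Radial functions are preserved by summation over neighbours. Applied to the number of walks
    ending at x, this shows by induction on the length that the number is radial. *)
Lemma nbr_sum (g : nat -> nat) : exists g' : nat -> nat, forall x,
  (\sum_(y <- fset_set (nbr_set x)) g (gdist org y))%N = g' (gdist org x).
Proof.
pose g' n := if n is n'.+1 then (g n' + p * g n'.+2)%N else (p.+1 * g 1)%N.
exists g' => x; have [fN cN] := ncard_nbr hT x.
case dx: (gdist org x) => [|n].
  rewrite (eq_big_seq (fun=> g 1)); first last.
    move=> y /(ncard_mem _ fN) xy; congr g; move/eqP: dx; rewrite (gdist_eq0 cT) => /eqP ox.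
    by rewrite ox in xy *; have := adj_gdistP hT x xy; rewrite (gdistxx cT) (gdistC cT) => -[].
  by rewrite big_const_seq count_predT iter_addn_0 -/(ncard _) cN mulnC.
have fx : ncard (nbr_set x `&` [set y | gdist org y == n.+2]) = p.
  rewrite -(@further_nbrs _ _ hT x) dx //; congr ncard.
  by apply/seteqP; split=> y [xy /eqP dy].
rewrite ncard_count // in fx.
rewrite (eq_big_seq (fun y => if gdist org y == n.+2 then g n.+2 else g n)); last first.
  move=> y /(ncard_mem _ fN) xy; have := adj_gdistP hT org xy.
  rewrite ![gdist _ org](gdistC cT) dx => -[[->]|->]; last by rewrite eqxx.
  by rewrite ifN //; apply/eqP; lia.
have cp := count_predC (fun y => gdist org y == n.+2) (fset_set (nbr_set x)).
rewrite fx -/(ncard _) cN in cp.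
by rewrite sum_if fx (_ : count _ _ = 1%N) /=; lia.
Qed.

Lemma walks_to_card n : exists g : nat -> nat, forall x,
  ncard (walks_to n x) = g (gdist org x).
Proof.
elim: n => [|n [g IH]].
  exists (fun d => (d == 0)%N : nat) => x; rewrite (gdist_eq0 cT).
  have [<-|ox] := eqVneq org x.
    rewrite (_ : walks_to 0 org = [set [::]]) ?ncard_set1 //.
    by apply/seteqP; split=> [s [[_ /eqP]]|_ -> //]; rewrite size_eq0 => /eqP.
  rewrite (_ : walks_to 0 x = set0) ?ncard0 //.
  apply/seteqP; split=> // s [[_ /eqP]]; rewrite size_eq0 => /eqP -> /= xo.
  by rewrite xo eqxx in ox.
have [g' Hg'] := nbr_sum g; exists g' => x; rewrite -Hg'.
have [fN cN] := ncard_nbr hT x.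
have fW y : nbr_set x y -> finite_set (walks_to n y) by move=> _; apply: walks_finite.
have [fS cS] := ncard_sigma fN fW.
rewrite -(eq_bigr _ (fun y _ => IH y)) -cS.
apply: (@ncard_bij _ _ (fun xy => rcons xy.2 x) _ _ fS).
  move=> [y s] [y' s'] /set_mem /= [_ [_ ys]] /set_mem /= [_ [_ ys']] /rcons_inj[ss'].
  by rewrite -ys -ys' ss'.
apply/seteqP; split=> [_ [[y s] [/= xy [sW sy]] <-]|s].
  by split; [apply/walks_rcons; rewrite /= sy symT|rewrite /= last_rcons].
case/lastP: s => [[[]//]|s y] [/walks_rcons[sW sy]]; rewrite /= last_rcons => yx.
by exists (last org s, s); rewrite /= -?yx //; split=> //; rewrite /nbr_set /= symT.
Qed.

Definition walks_beyond n u : set (seq T) := walks n `&` [set s | geod org (last org s) u].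

Lemma walk_last n s : walks n s -> (gdist org (last org s) <= n)%N.
Proof. by move=> [ps <-]; apply: gdist_le; exists s. Qed.

(** There are p^j endpoints j levels beyond u, and each is reached by a number of walks that depends
    only on its level. *)
Lemma walks_beyond_card n u v : (0 < gdist org u)%N -> gdist org u = gdist org v ->
  ncard (walks_beyond n u) = ncard (walks_beyond n v).
Proof.
move=> u0 uv; have [g Hg] := walks_to_card n.
suff H w : (0 < gdist org w)%N ->
    ncard (walks_beyond n w) = (\sum_(j < n.+1) p ^ j * g (gdist org w + j))%N.
  by rewrite !H ?uv // -uv.
move=> w0.
rewrite (@ncard_fibers_nat _ (fun s => gdist org (last org s) - gdist org w)%N _ n (walks_finite _ _)); last first.
  by move=> s [/walk_last sn _]; rewrite (leq_trans (leq_subr _ _)).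
apply: eq_bigr => j _; rewrite -(ncard_cap hT j w0).
pose A := walks_beyond n w `&` [set s | (gdist org (last org s) - gdist org w)%N = j].
have fA : finite_set A by rewrite /A /walks_beyond -setIA; apply: walks_finite.
have fC := cap_finite hT w j.
rewrite -/A (@ncard_fibers _ _ (last org) _ (fset_set (cap w j)) fA (fset_uniq _)); last first.
  move=> s [[_ gs] /= ds]; apply/(ncard_mem _ fC); split=> //.
  by move: gs; rewrite /geod /=; lia.
rewrite (eq_big_seq (fun=> g (gdist org w + j)%N)).
  by rewrite big_const_seq count_predT iter_addn_0 mulnC.
move=> x /(ncard_mem _ fC)[gx dx]; rewrite -dx -Hg; congr ncard.
apply/seteqP; split=> s; first by move=> [[[sW _] _] sx]; split.
by move=> [sW /= sx]; split=> //; split; [split=> //; rewrite /= sx|rewrite /= sx dx; lia].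
Qed.

End Walks.

Section EndCylinders.
Variables (k : nat) (T : htree).
Hypothesis hT : regular_tree T k.
Implicit Types (u v : T) (w : ends T).

Definition end_anc r w : T := iter r (par w) org.

Lemma gdist_end_anc r w : gdist org (end_anc r w) = r.
Proof. exact: gdist_iter_par hT _ _ _. Qed.

Lemma end_ancE r w u : gdist org u = r -> geod_end org w u <-> end_anc r w = u.
Proof.
move=> ur; rewrite (geod_endE hT); split=> [[n _ nu]|<-]; last by exists r.
by rewrite -nu (gdist_iter_par hT) in ur; rewrite /end_anc -ur.
Qed.

Lemma end_cyl_open u : open [set w : ends T | end_anc (gdist org u) w = u].
Proof.
have -> : [set w : ends T | end_anc (gdist org u) w = u] = [set w | geod_end org w u].
  by apply/seteqP; split=> w /= /end_ancE; apply.
pose B := [set w : ends T | geod_end org w u].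
exists [set B]; last by rewrite bigcup_set1.
move=> _ ->; exists [fset B]%fset; last by rewrite set_fset1 bigcap_set1.
by move=> C /fset1P ->; apply/mem_set; exists org, u.
Qed.

End EndCylinders.

Section Harmonic.
Variables (R : realType) (p : nat) (T : htree).
Hypotheses (hp : (1 < p)%N) (hT : regular_tree T p.+1).
Variable mu : probability (borel (ends T)) R.
Hypothesis hmu : harmonic_measure mu.
Let fsphere r : finite_set [set u : T | gdist org u = r].
Proof. by apply: sub_finite_set (tree_ball_finite hT r) => u /= ->. Qed.

(** The probability that the walk is beyond u at time n is a number of walks divided by (p+1)^n, the
    same for u and v. By the almost sure convergence to the limit end and dominated convergence it
    tends to the mass of the cylinder. *)
Lemma harmonic_cyl_eq (u v : T) : (0 < gdist org u)%N -> gdist org u = gdist org v ->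
  mu [set w | end_anc (gdist org u) w = u] = mu [set w | end_anc (gdist org v) w = v].
Proof.
move=> u0 uv; have [d [Om [P [X [Z [[mX lawX] mZ cXZ muE]]]]]] := hmu.
pose Ev n (s : seq T) := [set w | forall i, (i <= n)%N -> X i w = nth org (org :: s) i].
have mEv n s : measurable (Ev n s).
  rewrite (_ : Ev n s = \bigcap_(i in `I_n.+1) [set w | X i w = nth org (org :: s) i]).
    by apply: fin_bigcap_measurable => // i _; apply: mX.
  by apply/seteqP; split=> w H i; [rewrite /= ltnS|]; apply: H.
have PEv n s : walks n s -> P (Ev n s) = ((p.+1%:R ^+ n)^-1)%:E.
  move=> [ps ss]; rewrite lawX /= eqxx mul1r; congr EFin.
  rewrite (eq_bigr (fun=> p.+1%:R^-1)); first by rewrite prodr_const card_ord exprVn.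
  move=> i _; have [_ dx] := ncard_nbr hT (nth org (org :: s) i).
  have -> : degree (nth org (org :: s) i) = p.+1 := dx.
  by have /(pathP org)/(_ i) := ps; rewrite ss => /(_ (ltn_ord i)) /= ->; rewrite div1r.
have tEv n (A : set (seq T)) : trivIset (walks n `&` A) (Ev n).
  move=> s s' [[_ ss] _] [[_ ss'] _] [w [Hs Hs']]; apply: (@eq_from_nth _ org); first by rewrite ss ss'.
  by move=> i; rewrite ss => iN; have := Hs i.+1 iN; rewrite (Hs' i.+1 iN).
pose Dn n (A : set (seq T)) := \bigcup_(s in walks n `&` A) Ev n s.
have mDn n A : measurable (Dn n A).
  by apply: measure_bigcup_finite => [|s _//]; exact: walks_finite hT n A.
have PDn n A : P (Dn n A) = ((ncard (walks n `&` A))%:R%:E * ((p.+1%:R ^+ n)^-1)%:E)%E.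
  apply: measure_finite_union => //; first exact: walks_finite hT n A.
  by move=> s [sW _]; apply: PEv.
(* Only probabilities of individual trajectories are given; those of the trajectories along edges
   already sum to 1, so almost every trajectory follows edges. *)
have ae_walk : {ae P, forall w, forall n, Dn n setT w}.
  apply: ae_foralln => n; exists (~` Dn n setT); split=> //; first exact: measurableC.
  transitivity (1 - P (Dn n setT))%E; first exact: probability_setC.
  rewrite PDn setIT; have [_ ->] := walks_card hT n.
  by rewrite natrX -EFinM divff ?subee // expf_neq0 // pnatr_eq0.
pose A u0 := [set s : seq T | geod org (last org s) u0].
have lastE n s w : Ev n s w -> size s = n -> X n w = last org s.
  by move=> /(_ n (leqnn n)) -> ss; rewrite -ss -last_nth.
have lim u1 : P \o (fun n => Dn n (A u1)) @ \oo -->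
    mu [set w | end_anc (gdist org u1) w = u1].
  pose C := [set w : borel (ends T) | end_anc (gdist org u1) w = u1].
  have mC : measurable C by apply: sub_sigma_algebra; exact: end_cyl_open hT _.
  have mZC : measurable (Z @^-1` C) by rewrite -[_ @^-1` _]setTI; apply: mZ.
  have := @dominated_convergence _ _ _ P setT measurableT
    (fun n w => (\1_(Dn n (A u1)) w)%:E) (fun w => (\1_(Z @^-1` C) w)%:E) (cst 1%E).
  case.
  - by move=> n; apply/measurable_EFinP; apply: measurable_indic.
  - by apply/measurable_EFinP; apply: measurable_indic.
  - apply: filterS2 ae_walk cXZ => w Hw cw _.
    pose u2 := end_anc (gdist org u1) (Z w).
    have d2 : gdist org u2 = gdist org u1 by apply: gdist_end_anc hT _ _.
    have nearu2 : \forall n \near \oo, geod org (X n w) u2.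
      apply: (cw [set x | geod org x u2]); exists u2; first exact/(end_ancE hT _ d2).
      by [].
    apply: cvg_near_cst; apply: filterS nearu2 => n g2; congr EFin.
    have [s [[ps ss] _] Es] := Hw n.
    have Xs : X n w = last org s by apply: lastE Es ss.
    rewrite !indicE; congr (_ (nat_of_bool _)); apply/idP/idP => /set_mem.
      move=> [s' [[ps' ss'] gs'] Es']; apply/mem_set.
      have Xs' : X n w = last org s' by apply: lastE Es' ss'.
      rewrite /C /=; apply: (geod_unique hT g2) => //.
      by rewrite Xs'.
    rewrite /C /= => e; apply/mem_set; exists s => //; split=> //.
    by rewrite /A /= -Xs -e.
  - exact: finite_measure_integrable_cst.
  - apply: aeW => w n _; rewrite /= lee_fin indicE.
    by case: (_ \in _); rewrite ?normr1 ?normr0.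
  move=> _ _; rewrite integral_indic // setIT [mu _](muE _ mC).
  suff -> : P \o (fun n => Dn n (A u1)) = (fun n => \int[P]_x (\1_(Dn n (A u1)) x)%:E)%E by [].
  by apply/funext => n; rewrite /= integral_indic // setIT.
apply: (@cvg_unique _ (@ereal_hausdorff R) (P \o (fun n => Dn n (A u)) @ \oo)).
  exact: lim.
have -> : P \o (fun n => Dn n (A u)) = P \o (fun n => Dn n (A v)); last exact: lim.
apply: funext => n /=; rewrite !PDn.
by rewrite -/(walks_beyond n u) -/(walks_beyond n v) (walks_beyond_card (ltnW hp) hT n u0 uv).
Qed.

(** The cylinders of level r have equal masses with sum 1, so the vertex of level r on the random
    ray is uniform on its sphere. *)
Lemma harmonic_frac (P : set T) r : (0 < r)%N ->
  mu [set w | P (end_anc r w)] = (tree_frac R p P r)%:E.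
Proof.
move=> r0.
have mC (u : T) : measurable ([set w | end_anc (gdist org u) w = u] : set (borel (ends T))).
  by apply: sub_sigma_algebra; exact: end_cyl_open hT _.
have [u0 [du0 _]] : exists u0 : T, gdist org u0 = r /\ True.
  have [w _] : exists w : ends T, True by exists end0.
  by exists (end_anc r w); split=> //; apply: gdist_end_anc hT _ _.
set c := mu [set w | end_anc (gdist org u0) w = u0].
have cu (u : T) : gdist org u = r -> mu [set w | end_anc r w = u] = c.
  move=> du; rewrite -[in LHS]du /c; apply: harmonic_cyl_eq; rewrite ?du //.
have H (Q : set T) : mu [set w | Q (end_anc r w)] =
    ((ncard [set u : T | gdist org u = r /\ Q u])%:R%:E * c)%E.
  rewrite -(@measure_finite_union _ _ _ mu _ _ (fun u => [set w | end_anc r w = u])).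
  - congr (mu _); apply/seteqP; split=> [w Pw|w [u [_ Pu] /= e]]; last by rewrite e.
    by exists (end_anc r w) => //; split=> //; apply: gdist_end_anc hT _ _.
  - by apply: sub_finite_set (fsphere r) => u [].
  - by move=> u v _ _ [w [/= <- <-]].
  - by move=> u [<- _].
  - by move=> u [du _]; apply: cu.
have := H setT; rewrite [X in mu X](_ : _ = setT); last by apply/seteqP; split.
rewrite probability_setT [X in ncard X](_ : _ = [set u : T | gdist org u = r]); last first.
  by apply/seteqP; split=> u // [].
have := ncard_sphere hT r.-1; rewrite prednK // => ->.
have cfin : c \is a fin_num by apply: fin_num_measure.
rewrite H /tree_frac -(fineK cfin) -!EFinM => -[c1]; congr EFin.
have N0 : (p.+1 * p ^ r.-1)%:R != 0 :> R.
  by apply/eqP => N0; move: c1; rewrite N0 mul0r => /eqP; rewrite oner_eq0.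
by apply: (mulIf N0); rewrite divfK // -mulrA [fine c * _]mulrC -c1 mulr1.
Qed.

End Harmonic.

(** * Image, mixture and uniform measures *)

Section Probabilities.
Context (R : realType).

Lemma pushforward_probability d d' (X : measurableType d) (Y : measurableType d')
    (m : probability X R) (f : X -> Y) : measurable_fun setT f ->
  exists P : probability Y R, forall A, P A = pushforward m f A.
Proof. by move=> mf; exists (distribution m (mfun_Sub (mem_set mf))). Qed.

Lemma mixture_probability d (Y : measurableType d) (P Q : probability Y R) (c : R) :
  0 <= c <= 1 ->
  exists M : probability Y R, forall A, M A = (c%:E * P A + (1 - c)%:E * Q A)%E.
Proof.
move=> /andP[c0 c1]; have c1' : 0 <= 1 - c by rewrite subr_ge0.
pose M0 : {measure set Y -> \bar R} :=
  measure_add (mscale (NngNum c0) P) (mscale (NngNum c1') Q).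
have ME A : M0 A = (c%:E * P A + (1 - c)%:E * Q A)%E by exact: measure_addE.
have M1 : M0 setT = 1%E.
  by rewrite ME !probability_setT !mule1 -EFinD subrKC.
pose Mp : probability Y R := 
  HB.pack (M0 : set Y -> \bar R) (Measure.on M0) (Measure_isProbability.Build _ _ _ M0 M1).
by exists Mp.
Qed.

Lemma uniform_lawE d (X : measurableType d) (U : choiceType) (phi : U -> X) (B : set U)
    (C : set X) : finite_set B ->
  uniform_law R phi B C =
  ((ncard (B `&` [set x | C (phi x)]))%:R / (ncard B)%:R)%:E.
Proof.
move=> fB; rewrite /uniform_law /= /mscale /= /msum size_map -/(ncard B).
have -> : (\sum_(k < ncard B) \d_(nth point [seq phi x | x <- fset_set B] k) C)%E =
    (\sum_(x <- fset_set B) (\d_(phi x) C : \bar R))%E.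
  rewrite -(big_map phi xpredT (fun y => \d_y C : \bar R)) (big_nth point) big_mkord.
  by rewrite size_map.
under eq_bigr do rewrite diracE.
rewrite sumEFin -EFinM mulrC; congr (_ / _)%:E.
rewrite -natr_sum -big_mkcond sum1_count; congr _%:R.
have -> : B `&` [set x | C (phi x)] = B `&` [set x | phi x \in C].
  by congr (_ `&` _); apply/seteqP; split=> x /=; rewrite inE.
by rewrite ncard_count.
Qed.

(** Only an inequality, because the uniform law on an empty set is the zero measure; this happens
    for the edge shell of index 0. *)
Lemma uniform_law_le1 d (X : measurableType d) (U : choiceType) (phi : U -> X) (B : set U)
    (C : set X) : finite_set B -> (uniform_law R phi B C <= 1)%E.
Proof.
move=> fB; rewrite uniform_lawE // lee_fin; have [B0|B0] := posnP (ncard B).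
  by rewrite B0 invr0 mulr0.
by rewrite ler_pdivrMr ?ltr0n // mul1r ler_nat ncard_le.
Qed.

End Probabilities.

(** * Agreement on balls and boundary points *)

Section HbarResolution.
Variables (R : realType) (G : rooted_graph).
Hypothesis cG : connected_graph G.
Hypothesis fG : forall n, finite_set (@gball G n).
Notation M := (gspace R G).

(** The shift keeps the radius positive, as the formulas for cylinders of level r require. *)
Definition same_upto (r : nat) (f g : fspace M) : Prop := agree r.+1 f g.

Lemma hbar_resolution : resolution (hbar M) same_upto.
Proof.
split.
- by move=> r f; apply: agree_refl.
- by move=> r f g; apply: agree_sym.
- by move=> r f g h; apply: agree_trans.
- by move=> r r' f g rr; apply: agree_le.
- move=> f V hf /(nbhs_agree cG)[r Hr]; exists r => g _ fg; apply: Hr.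
  by apply: agree_le fg.
- by move=> r f hf; apply: hbar_agree_nbhs.
Qed.

Lemma hboundary_mem (f : fspace M) : hbar M f ->
  (forall n : nat, exists y : G, f y < - n%:R) -> hboundary M f.
Proof.
move=> hf unb; split=> // -[x _ xf]; have [y] := unb (gdist org (x : G)).
rewrite -xf horofunE ltNge => /negP; apply.
by rewrite lerBrDr addNr.
Qed.

(** If all approximants on large balls stayed in the ball of radius n, they would be finitely many,
    each failing at some vertex; a radius beyond these vertices is a contradiction. So some
    approximant is far away, and f equals -n at the vertex of level n on the way to it. *)
Lemma hboundary_unbounded (f : fspace M) : hboundary M f ->
  forall n : nat, exists y : G, f y <= - n%:R.
Proof.
move=> [hf nr] n; have /hbarP := hf; move=> /(_ cG fG) Hf.
have [x fx far] : exists2 x : M, agree n f (horofun x) & (n <= gdist org (x : G))%N.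
  apply: contrapT => none.
  have near_x r : (n <= r)%N -> exists2 x : M, agree r f (horofun x) & @gball G n x.
    move=> nr'; have [x fx] := Hf r; exists x => //; rewrite /gball /= leqNgt.
    by apply/negP => xn; apply: none; exists x; [apply: agree_le fx|apply: ltnW].
  have bad (x : G) : exists y : G, f y <> horofun (x : M) y.
    by apply/existsNP => H; apply: nr; exists x => //; apply/funext => y; rewrite H.
  have [y Hy] := choice bad.
  pose r := (n + \sum_(x <- fset_set (@gball G n)) gdist org (y x))%N.
  have [|x fx xn] := near_x r; first exact: leq_addr.
  apply: (Hy x); apply: fx; rewrite /r (big_rem (x : G)) /=; first by lia.
  by rewrite in_fset_set ?inE.
have [y dy gy] := gdist_at cG far; exists y.
rewrite fx ?dy // horofunE /= -gy natrD dy.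
by rewrite opprD addrCA (gdistC cG y) addrC; lra.
Qed.

End HbarResolution.

(** * The limit of the uniform measures on balls *)

Section TreeHorofunctions.
Variables (k : nat) (T : rooted_graph).
Hypothesis hT : regular_tree T k.
Implicit Types (u v b : T) (w : tree_end T).
Let cT := tree_connected hT.

Lemma gdist_iter_par_hgt w b n : (gdist org b <= n)%N ->
  (gdist b (iter n (par w) org))%:Z = n%:Z + hgt w b.
Proof.
move=> bn; have [N HN] := hgt_iter hT w b.
have [m [mE em]] := HN (maxn N n) (leq_maxl _ _).
have g : geod org (iter (maxn N n) (par w) org) (iter n (par w) org).
  have im := subnK (leq_maxr N n).
  rewrite -{1}im iterD /geod /= !(gdist_iter_par hT).
  by rewrite -iterD (gdist_iter_par hT) addnC.
have := gdist_beyond hT g (b := b); rewrite (gdistC cT b) (gdistC cT _ org).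
rewrite (gdist_iter_par hT) => /(_ bn).
move: g; rewrite /geod /= !(gdist_iter_par hT) em (gdist_iter_par hT); lia.
Qed.

(** Of the at least two children of a vertex at most one is nearer to the root, so the height can be
    raised while moving away from the root. *)
Lemma descend w u n : (2 < k)%N -> exists v, geod org v u /\ hgt w v = hgt w u + n%:Z.
Proof.
move=> k2; elim: n => [|n [v [gv hv]]].
  by exists u; split; [exact: (geod_refl hT)|rewrite addr0].
have [c [vc cv dc]] : exists c, [/\ adj v c, par w c = v & gdist org c = (gdist org v).+1].
  have [fc cc] := ncard_children hT w v.
  apply: contrapT => none.
  have close c : children w v c -> (gdist org c).+1 = gdist org v.
    move=> [vc cv]; have := adj_gdistP hT org vc; rewrite ![gdist _ org](gdistC cT).
    by move=> [-> //|dc]; case: none; exists c.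
  have : (ncard (children w v) <= 1)%N.
    have [->|/set0P[c Hc]] := eqVneq (children w v) set0; first by rewrite ncard0.
    rewrite -(ncard_set1 c) ncard_le //.
    move=> c' Hc'; have [[vc _] [vc' _]] := (Hc, Hc').
    apply: (closer_nbr_unique hT (a := org) vc' vc); rewrite ![gdist _ org](gdistC cT).
      by rewrite -(close _ Hc').
    by rewrite -(close _ Hc).
  rewrite cc; lia.
exists c; split; last by have := hgt_par hT w c; rewrite cv; lia.
apply: (geod_trans hT gv); rewrite /geod /= dc.
have := adj_gdist1 vc; have := gdist_triangle cT org v c; lia.
Qed.

Lemma height_onto w (i : int) : (2 < k)%N -> exists v, hgt w v = i.
Proof.
move=> k2; case: (lerP 0 i) => i0.
  have [v [_ hv]] := descend w org `|i|%N k2.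
  by exists v; rewrite hv (hgt_org hT); lia.
exists (iter `|i|%N (par w) org); rewrite (hgt_iter_par hT) (hgt_org hT); lia.
Qed.

Lemma anc_dist r v b : (r <= gdist org v)%N -> (gdist org b <= r)%N ->
  (gdist b v)%:Z - (gdist org v)%:Z = (gdist b (anc r v))%:Z - r%:Z.
Proof.
move=> rv br; have [da ga] := ancP hT rv.
have := gdist_beyond hT ga (b := b); rewrite (gdistC cT b org) (gdistC cT _ org) da.
by move=> /(_ br); move: ga; rewrite /geod /= da; lia.
Qed.

Lemma busemann_pat (R : realType) r w b : (gdist org b <= r)%N ->
  busemann R w b = (gdist b (iter r (par w) org))%:R - r%:R.
Proof.
move=> br; rewrite (busemannE hT).
have /(congr1 (fun i : int => i%:~R : R)) := gdist_iter_par_hgt w br.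
by rewrite intrD -!pmulrn => ->; rewrite addrAC subrr add0r.
Qed.

End TreeHorofunctions.

Section EndMaps.
Variables (R : realType) (k : nat) (T : htree) (G : rooted_graph).
Hypothesis hT : regular_tree T k.
Hypothesis cG : connected_graph G.
Variable pi : G -> T.
Hypothesis piE : forall y : G, (gdist org (pi y) <= gdist org y)%N.

(** Stated for a general [pi] in order to serve for both projections of [DL] and for the identity of
    the tree. *)
Definition end_map (w : borel (ends T)) : borel (fspace (gspace R G)) :=
  fun y : G => busemann R w (pi y).

(* The trace on the ball of radius r of the Busemann functions of the ends
   whose ray from the root passes through u, a vertex of level r. *)
Definition pat r (u : T) : fspace (gspace R G) := fun y : G => (gdist (pi y) u)%:R - r%:R.

Lemma end_map_pat r w : agree r (end_map w) (pat r (end_anc r w)).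
Proof. by move=> y yr; rewrite /end_map (busemann_pat hT R w (leq_trans (piE y) yr)). Qed.

(** The map is continuous: on a ball of radius r the function of an end depends only on the vertex
    of level r of its ray. *)
Lemma end_map_measurable : measurable_fun setT end_map.
Proof.
apply: (@measurability _ _ _ _ setT end_map (@open (fspace (gspace R G)))) => //.
move=> _ [U oU <-]; rewrite setTI.
suff oE : open ([set w | U (end_map w)] : set (ends T)) by exact: sub_sigma_algebra.
rewrite openE => w Uw.
have /(nbhs_agree cG)[r Hr] := open_nbhs_nbhs (conj oU (Uw : U (end_map w))).
have oC := end_cyl_open hT (end_anc r w); rewrite (gdist_end_anc hT) in oC.
apply: filterS (open_nbhs_nbhs (conj oC (erefl _))) => w' /= e.
apply: Hr; apply: (agree_trans (@end_map_pat r w)); rewrite -e.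
exact: (agree_sym (@end_map_pat r w')).
Qed.

Lemma end_map_class r (f : fspace (gspace R G)) :
  [set w | agree r f (end_map w)] =
  [set w | agree r f (pat r (end_anc r w))].
Proof.
apply/seteqP; split=> w fw /=; first exact: (agree_trans fw (@end_map_pat r w)).
exact: (agree_trans fw (agree_sym (@end_map_pat r w))).
Qed.

Lemma end_map_boundary (fG : forall n, finite_set (@gball G n)) (w : ends T) :
  (forall v, exists y, pi y = v) ->
  (forall r, exists x : G, agree r (pat r (end_anc r w)) (horofun (x : gspace R G))) ->
  hboundary (gspace R G) (end_map w).
Proof.
move=> onto app; apply: hboundary_mem => //.
  apply/(hbarP cG fG) => r; have [x Hx] := app r; exists x.
  exact: (agree_trans (@end_map_pat r w) Hx).
move=> n; have [y yE] := onto (iter n.+1 (par w) org); exists y.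
rewrite /end_map yE (busemannE hT) (hgt_iter_par hT) (hgt_org hT) sub0r.
by rewrite intrN ltrN2 -pmulrn ltr_nat.
Qed.

End EndMaps.

Section DLLimit.
Variables (R : realType) (p q : nat) (T T' : htree).
Hypotheses (hp : (1 < p)%N) (hq : (1 < q)%N).
Hypotheses (hT : regular_tree T p.+1) (hT' : regular_tree T' q.+1).
Notation G := (DL T T').
Let m := maxn p q.
Let hp0 : (0 < p)%N := ltnW hp.
Let hq0 : (0 < q)%N := ltnW hq.
Let cG : connected_graph G := DL_connected hp0 hq0 hT hT'.
Let fG n : finite_set (@gball G n) := DL_ball_finite hp hq hT hT' n.
Implicit Types x y : G.

Lemma dl_swap_le y : (gdist org (dl_snd y) <= gdist org y)%N.
Proof.
rewrite -(gdist_swap hp0 hq0 hT hT') (_ : dl_swap org = org); last exact: val_inj.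
exact: (DL_fst_le hq hp hT' hT (dl_swap y)).
Qed.

Lemma DL_fst_onto (v : T) : exists y : G, dl_fst y = v.
Proof.
have [|v' hv'] := @height_onto _ _ hT' end0 (- hgt end0 v); first by [].
by have [|y [yv _]] := @DL_mk T T' v v'; [rewrite hv' subrr|exists y].
Qed.

(* If the first coordinate of x has height at least r, then in T' the geodesic
   from any vertex of level at most r to x starts along the ray to the
   distinguished end; hence the horofunction of x on the ball of radius r is a
   function of the first coordinate, which only sees the ancestor at level r. *)
Lemma horofun_pat r x : r%:Z <= hgt end0 (dl_fst x) ->
  agree r (horofun (x : gspace R G)) (pat (@dl_fst T T') r (anc r (dl_fst x))).
Proof.
move=> rx y yr; rewrite horofunE /pat.
have cT := tree_connected hT; have cT' := tree_connected hT'.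
suff : (gdist y x)%:Z - (gdist org x)%:Z = (gdist (dl_fst y) (anc r (dl_fst x)))%:Z - r%:Z.
  by move=> /(congr1 (fun i : int => i%:~R : R)); rewrite !intrB -!pmulrn.
have y1 := leq_trans (DL_fst_le hp hq hT hT' y) yr.
have y2 := leq_trans (dl_swap_le y) yr.
have rv : (r <= gdist org (dl_fst x))%N.
  by have := hgt_lipschitz hT end0 (dl_fst x) org; rewrite (hgt_org hT) (gdistC cT); lia.
rewrite -(anc_dist hT rv y1).
have hx := DL_height x; have hy := DL_height y.
have l1 := hgt_lipschitz hT end0 (dl_fst y) org; rewrite (hgt_org hT) (gdistC cT) in l1.
suff : (gdist (dl_snd y) (dl_snd x))%:Z - (gdist org (dl_snd x))%:Z = hgt end0 (dl_snd y).
  rewrite (DL_gdist_org hp hq hT hT') (DL_gdist hp0 hq0 hT hT') /dl_dist.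
  have := hgt_lipschitz hT end0 (dl_fst y) (dl_fst x).
  have := hgt_lipschitz hT end0 (dl_fst x) org; rewrite (hgt_org hT) (gdistC cT _ org).
  move: (gdist (dl_snd y) (dl_snd x)) (gdist org (dl_snd x)) (gdist (dl_fst y) (dl_fst x))
    (gdist org (dl_fst x)) => *; lia.
have [i0 [j0 [e0 d0 h0]]] := hgt_merge hT' end0 (dl_snd x) org.
rewrite (hgt_org hT') subr0 in h0.
have gu : geod org (dl_snd x) (iter r (par end0) org).
  have rj : (r <= j0)%N by lia.
  have gc : geod org (dl_snd x) (iter j0 (par end0) org).
    rewrite /geod /= (gdist_iter_par hT') -e0 (gdistC cT' _ (dl_snd x)).
    by rewrite (gdist_iter_par hT') (gdistC cT') d0 addnC.
  apply: (geod_trans hT' _ gc); have rj' := subnK rj.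
  rewrite -{1}rj' iterD /geod /= !(gdist_iter_par hT').
  by rewrite -iterD (gdist_iter_par hT') addnC.
have := gdist_iter_par_hgt hT' end0 y2.
have := gdist_beyond hT' gu (b := dl_snd y).
rewrite (gdistC cT' (dl_snd y) org) (gdistC cT' _ org) (gdist_iter_par hT') => /(_ y2).
by move: gu; rewrite /geod /= (gdist_iter_par hT'); lia.
Qed.

End DLLimit.

Lemma tree_frac_setT (R : realType) k (U : htree) r : regular_tree U k.+1 -> (0 < k)%N -> (0 < r)%N ->
  tree_frac R k (setT : set U) r = 1.
Proof.
move=> hU k0 r0; rewrite /tree_frac.
rewrite (_ : [set u : U | _] = [set u : U | gdist org u = r]); last first.
  by apply/seteqP; split=> u // [].
have := ncard_sphere hU r.-1; rewrite prednK // => ->.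
by rewrite divff // pnatr_eq0 muln_eq0 /= expn_eq0; lia.
Qed.

Section DLLimit2.
Variables (R : realType) (p q : nat) (T T' : htree).
Hypotheses (hp : (1 < p)%N) (hq : (1 < q)%N).
Hypotheses (hT : regular_tree T p.+1) (hT' : regular_tree T' q.+1).
Notation G := (DL T T').
Let m := maxn p q.
Let hp0 : (0 < p)%N := ltnW hp.
Let hq0 : (0 < q)%N := ltnW hq.
Let cG : connected_graph G := DL_connected hp0 hq0 hT hT'.
Let fG n : finite_set (@gball G n) := DL_ball_finite hp hq hT hT' n.
Implicit Types x y : G.

Lemma horofun_pat_snd r x : r%:Z <= hgt end0 (dl_snd x) ->
  agree r (horofun (x : gspace R G)) (pat (@dl_snd T T') r (anc r (dl_snd x))).
Proof.
move=> rx y yr; have sO : dl_swap (org : G) = org by exact: val_inj.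
have := @horofun_pat R q p T' T hq hp hT' hT r (dl_swap x) rx (dl_swap y).
rewrite !horofunE -sO !(gdist_swap hp0 hq0 hT hT'); exact.
Qed.

Lemma gdist_org_swap x : gdist org (dl_swap x) = gdist org x.
Proof.
have sO : dl_swap (org : G) = org by exact: val_inj.
by rewrite -sO (gdist_swap hp0 hq0 hT hT').
Qed.

Lemma ncard_swap n (A : set (DL T' T)) :
  ncard (@gball G n `&` [set x | A (dl_swap x)]) = ncard (@gball (DL T' T) n `&` A).
Proof.
rewrite (@ncard_bij _ _ (@dl_swap T T') (@gball G n `&` [set x | A (dl_swap x)])
  (@gball (DL T' T) n `&` A)) //.
- exact: finite_setIl.
- by move=> x y _ _ /(can_inj (@dl_swapK T T')).
have sn x : gball n (dl_swap x) <-> gball n x by rewrite /gball /mkset gdist_org_swap.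
apply/seteqP; split=> [_ [x [xn Ax] <-]|x [xn Ax]].
  by split=> //; apply/sn.
exists (dl_swap x); last by rewrite dl_swapK.
by split; [apply/sn|]; rewrite /= dl_swapK.
Qed.

(** The heights of the two coordinates are opposite and r is positive, so at most one of them
    reaches r. This splits the ball into a part high in T, a part high in T' and a remainder of
    bounded heights, which is negligible. *)
Lemma DL_count_cvg (Q : set G) (P : set T) (P' : set T') r : (0 < r)%N ->
  (forall x, r%:Z <= hgt end0 (dl_fst x) -> (Q x <-> P (anc r (dl_fst x)))) ->
  (forall x, r%:Z <= hgt end0 (dl_snd x) -> (Q x <-> P' (anc r (dl_snd x)))) ->
  (ncard (@gball G n `&` Q))%:R / m%:R ^+ n @[n --> \oo] -->
  (weight R p q * tree_frac R p P r + weight R q p * tree_frac R q P' r).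
Proof.
move=> r0 QP QP'; have m0 : 0 < m%:R :> R by rewrite ltr0n /m; lia.
pose U : set G := [set x | r%:Z <= hgt end0 (dl_fst x)].
pose L : set G := [set x | r%:Z <= hgt end0 (dl_snd x)].
have UE n : ncard (@gball G n `&` Q `&` U) =
    ncard (@dl_above T T' r [set v | P (anc r v)] n).
  congr ncard; apply/seteqP; split=> x; first by move=> [[? Qx] Ux]; split=> //; apply/QP.
  by move=> [? Ux Px]; split=> //; split=> //; apply/QP.
have LE n : ncard (@gball G n `&` Q `&` ~` U `&` L) =
    ncard (@dl_above T' T r [set v | P' (anc r v)] n).
  pose A : set (DL T' T) := [set x | r%:Z <= hgt end0 (dl_fst x) /\ P' (anc r (dl_fst x))].
  transitivity (ncard (@gball G n `&` [set x | A (dl_swap x)])).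
    congr ncard; apply/seteqP; split=> x.
      by move=> [[[xn Qx] Ux] Lx]; split=> //; split=> //; apply/QP'.
    move=> [xn [Lx Px]]; split=> //; split; first by split=> //; apply/QP'.
    by have Lx' : r%:Z <= hgt end0 (dl_snd x) := Lx; have := DL_height x; rewrite /U /=; lia.
  rewrite ncard_swap; congr ncard.
  by apply/seteqP; split=> x; [move=> [? []]|move=> []].
have midE n : (ncard (@gball G n `&` Q `&` ~` U `&` ~` L) <=
    ncard [set x : DL T T' | [/\ (gdist org x <= n)%N, (0 <= hgt end0 (dl_fst x))%R &
      (hgt end0 (dl_fst x) < r%:Z)%R]] +
    ncard [set x : DL T' T | [/\ (gdist org x <= n)%N, (0 <= hgt end0 (dl_fst x))%R &
      (hgt end0 (dl_fst x) < r%:Z)%R]])%N.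
  pose A : set (DL T' T) := [set x | 0 <= hgt end0 (dl_fst x) /\ hgt end0 (dl_fst x) < r%:Z].
  have -> : [set x : DL T' T | [/\ (gdist org x <= n)%N, (0 <= hgt end0 (dl_fst x))%R &
      (hgt end0 (dl_fst x) < r%:Z)%R]] = @gball (DL T' T) n `&` A.
    by apply/seteqP; split=> x; [move=> []|move=> [? []]].
  rewrite -ncard_swap; apply: leq_trans (ncardU_le _ _); last 2 first.
  - by apply: sub_finite_set (fG n) => x [].
  - exact: finite_setIl.
  apply: ncard_le.
    rewrite finite_setU; split; last exact: finite_setIl.
    by apply: sub_finite_set (fG n) => x [].
  move=> x [[[xn _] /negP Ux] /negP Lx]; rewrite -!ltNge in Ux Lx.
  have hx := DL_height x; have [h0|h0] := lerP 0 (hgt end0 (dl_fst x)).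
    by left; split.
  by right; split=> //; split=> //=; rewrite /dl_fst /dl_snd /= in hx h0 Lx *; lia.
pose mid n := ncard (@gball G n `&` Q `&` ~` U `&` ~` L).
have midc : (mid n)%:R / m%:R ^+ n @[n --> \oo] --> (0 : R).
  have c1 := @dl_low_cvg R p q T T' hp hq hT hT' r.
  have c2 := @dl_low_cvg R q p T' T hq hp hT' hT r; rewrite (maxnC q) -/m in c1 c2.
  set s1 := (fun n : nat => _) in c1; set s2 := (fun n : nat => _) in c2.
  apply: (squeeze_cvgr (f := fun=> 0) (h := fun n => s1 n + s2 n)); last 2 first.
  - exact: cvg_cst.
  - by rewrite -[X in _ --> X]addr0; exact: cvgD c1 c2.
  near=> n; rewrite /s1 /s2 divr_ge0 ?exprn_ge0 ?ler0n //=.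
  by rewrite -mulrDl ler_pM2r ?invr_gt0 ?exprn_gt0 // -natrD ler_nat midE.
have E n : (ncard (@gball G n `&` Q))%:R / m%:R ^+ n =
    (ncard (@dl_above T T' r [set v | P (anc r v)] n))%:R / m%:R ^+ n +
    (ncard (@dl_above T' T r [set v | P' (anc r v)] n))%:R / m%:R ^+ n +
    (mid n)%:R / m%:R ^+ n :> R.
  rewrite -!mulrDl -!natrD; congr (_%:R / _).
  have f1 : finite_set (@gball G n `&` Q) by exact: finite_setIl.
  have f2 : finite_set (@gball G n `&` Q `&` ~` U) by exact: finite_setIl.
  by rewrite (ncardID U f1) (ncardID L f2) UE LE addnA.
have cU := @dl_above_frac_cvg R p q T T' hp hq hT hT' P r r.
have cL := @dl_above_frac_cvg R q p T' T hq hp hT' hT P' r r.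
rewrite r0 leqnn (maxnC q) -/m in cU cL.
have c := cvgD (cvgD (cU isT) (cL isT)) midc; rewrite addr0 in c.
by under eq_fun => n do rewrite E; apply: c.
Unshelve. all: by end_near. Qed.

Definition total_weight : R := weight R p q + weight R q p.

Lemma weight_ge0 a b : (1 < a)%N -> 0 <= weight R a b.
Proof. by move=> a1; rewrite /weight divr_ge0 ?mulr_ge0 ?mass_ge0. Qed.

Lemma weight_gt0 a b : (1 < a)%N -> (b <= a)%N -> 0 < weight R a b.
Proof.
by move=> a1 ba; rewrite /weight divr_gt0 ?mulr_gt0 ?mass_gt0 ?ltr0n //; lia.
Qed.

Lemma weight_eq0 a b : (a < b)%N -> weight R a b = 0.
Proof. by move=> ab; rewrite /weight /mass leqNgt ab mulr0 mul0r. Qed.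

Lemma total_weight_gt0 : 0 < total_weight.
Proof.
rewrite /total_weight; have [pq|qp] := leqP p q.
  by rewrite ltr_wpDl ?weight_gt0 ?weight_ge0.
by rewrite ltr_wpDr ?weight_gt0 ?weight_ge0 // ltnW.
Qed.

Lemma DL_ball_cvg :
  gball_size R G n / m%:R ^+ n @[n --> \oo] --> total_weight.
Proof.
have := @DL_count_cvg setT setT setT 1 isT _ _.
rewrite !tree_frac_setT // !mulr1; under eq_fun do rewrite setIT.
by apply.
Qed.

Lemma ratio_growth (a : nat -> R) (k : nat) (l : R) : (0 < k)%N -> 0 < l ->
  a n / k%:R ^+ n @[n --> \oo] --> l -> log_regularly_varying a (ln (k%:R : R)).
Proof.
move=> k0 l0 al; rewrite /log_regularly_varying lnK ?posrE ?ltr0n //.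
have kn0 : k%:R != 0 :> R by rewrite pnatr_eq0 -lt0n.
have e n : a n.+1 / a n = k%:R * ((a n.+1 / k%:R ^+ n.+1) / (a n / k%:R ^+ n)).
  rewrite exprS; have [->|an0] := eqVneq (a n) 0; first by rewrite mul0r !invr0 !mulr0.
  by field; rewrite an0 kn0 expf_neq0.
suff H : (fun n => a n.+1 / a n) @ \oo --> k%:R * (l / l).
  by move: H; rewrite divff ?mulr1 ?lt0r_neq0.
under eq_fun do rewrite e.
apply: cvgMr; apply: cvgM.
  by rewrite (cvg_shiftS (fun n => a n / k%:R ^+ n)).
by apply: cvgV => //; rewrite lt0r_neq0.
Qed.

Lemma DL_growth : log_regularly_varying (gball_size R G) (ln (m%:R : R)).
Proof.
by apply: ratio_growth DL_ball_cvg; [rewrite /m; lia|exact: total_weight_gt0].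
Qed.

Variables (muT : probability (borel (ends T)) R) (muT' : probability (borel (ends T')) R).
Hypotheses (hmuT : harmonic_measure muT) (hmuT' : harmonic_measure muT').

Lemma end_fst_agree (f : fspace (gspace R G)) r : (0 < r)%N ->
  muT [set w | agree r f (end_fst R T T' w)] =
  (tree_frac R p [set u | agree r f (pat (@dl_fst T T') r u)] r)%:E.
Proof.
move=> r0; rewrite -(harmonic_frac hp hT hmuT _ r0); congr (muT _).
exact: (end_map_class hT (DL_fst_le hp hq hT hT') r f).
Qed.

Lemma end_snd_agree (f : fspace (gspace R G)) r : (0 < r)%N ->
  muT' [set w | agree r f (end_snd R T T' w)] =
  (tree_frac R q [set u | agree r f (pat (@dl_snd T T') r u)] r)%:E.
Proof.
move=> r0; rewrite -(harmonic_frac hq hT' hmuT' _ r0); congr (muT' _).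
exact: (end_map_class hT' (dl_swap_le hp hq hT hT') r f).
Qed.

Lemma end_fst_measurable : measurable_fun setT (end_fst R T T').
Proof. exact: (end_map_measurable hT cG (DL_fst_le hp hq hT hT')). Qed.

Lemma end_snd_measurable : measurable_fun setT (end_snd R T T').
Proof. exact: (end_map_measurable hT' cG (dl_swap_le hp hq hT hT')). Qed.

Lemma DL_snd_onto (v : T') : exists y : G, dl_snd y = v.
Proof.
have [y yv] := @DL_fst_onto p T' T hp hT v.
by exists (dl_swap y).
Qed.

Lemma end_fst_boundary (w : ends T) : hboundary (gspace R G) (end_fst R T T' w).
Proof.
apply: (end_map_boundary (pi := @dl_fst T T') hT cG (DL_fst_le hp hq hT hT') fG).
  exact: (DL_fst_onto hq hT').
(* The vertex of level r has height at least -r, so raising the height by 2 r reaches the threshold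
   of [horofun_pat]. *)
move=> r; have [v [gv hv]] := @descend _ _ hT end0 (end_anc r w) r.*2 hp.
have [x xv] := @DL_fst_onto q T T' hq hT' v; exists x.
rewrite -(anc_unique hT (gdist_end_anc hT r w) gv) -xv; apply: agree_sym.
apply: (horofun_pat R hp hq hT hT'); rewrite xv hv.
have := hgt_lipschitz hT end0 (end_anc r w) org; rewrite (hgt_org hT).
by rewrite (gdistC (tree_connected hT)) (gdist_end_anc hT); lia.
Qed.

Lemma end_snd_boundary (w : ends T') : hboundary (gspace R G) (end_snd R T T' w).
Proof.
apply: (end_map_boundary (pi := @dl_snd T T') hT' cG (dl_swap_le hp hq hT hT') fG).
  exact: DL_snd_onto.
move=> r; have [v [gv hv]] := @descend _ _ hT' end0 (end_anc r w) r.*2 hq.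
have [x xv] := DL_snd_onto v; exists x.
rewrite -(anc_unique hT' (gdist_end_anc hT' r w) gv) -xv; apply: agree_sym.
apply: horofun_pat_snd; rewrite xv hv.
have := hgt_lipschitz hT' end0 (end_anc r w) org; rewrite (hgt_org hT').
by rewrite (gdistC (tree_connected hT')) (gdist_end_anc hT'); lia.
Qed.

(** Equal to 1 if p > q and to 0 if p < q by [weight_eq0], and to 1/2 if p = q by symmetry. *)
Definition fst_share : R := weight R p q / total_weight.

Variable nu0 : probability (borel (fspace (gspace R G))) R.
Hypothesis nu0E : forall A, nu0 A = (fst_share%:E * pushforward muT (end_fst R T T') A +
  (1 - fst_share)%:E * pushforward muT' (end_snd R T T') A)%E.

Lemma nu0_boundary : nu0 (hboundary (gspace R G)) = 1%E.
Proof.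
rewrite nu0E /pushforward.
rewrite (_ : end_fst R T T' @^-1` _ = setT); last first.
  by apply/seteqP; split=> // w _; exact: end_fst_boundary.
rewrite (_ : end_snd R T T' @^-1` _ = setT); last first.
  by apply/seteqP; split=> // w _; exact: end_snd_boundary.
by rewrite !probability_setT !mule1 -EFinD subrKC.
Qed.

Lemma nu0_agree (f : fspace (gspace R G)) r : (0 < r)%N ->
  fine (nu0 (hbar (gspace R G) `&` [set g | agree r f g])) =
  (weight R p q * tree_frac R p [set u | agree r f (pat (@dl_fst T T') r u)] r +
   weight R q p * tree_frac R q [set u | agree r f (pat (@dl_snd T T') r u)] r) /
  total_weight.
Proof.
move=> r0; have Z0 : total_weight != 0 by rewrite lt0r_neq0 ?total_weight_gt0.
rewrite nu0E /pushforward.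
rewrite (_ : end_fst R T T' @^-1` _ = [set w | agree r f (end_fst R T T' w)]); last first.
  by apply/seteqP; split=> w; [move=> []|split=> //; case: (end_fst_boundary w)].
rewrite (_ : end_snd R T T' @^-1` _ = [set w | agree r f (end_snd R T T' w)]); last first.
  by apply/seteqP; split=> w; [move=> []|split=> //; case: (end_snd_boundary w)].
rewrite end_fst_agree // end_snd_agree // -!EFinM -EFinD /= /fst_share.
rewrite (_ : 1 - weight R p q / total_weight = weight R q p / total_weight).
  by rewrite mulrDl; congr (_ + _); rewrite mulrAC.
by apply: (mulIf Z0); rewrite mulrBl mul1r !divfK // /total_weight addrAC subrr add0r.
Qed.

Lemma DL_agree_cvg (f : fspace (gspace R G)) r : (0 < r)%N ->
  (ncard (@gball G n `&` [set x | agree r f (horofun (x : gspace R G))]))%:R / m%:R ^+ n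
    @[n --> \oo] -->
  total_weight * fine (nu0 (hbar (gspace R G) `&` [set g | agree r f g])).
Proof.
move=> r0; rewrite nu0_agree // mulrC divfK; last by rewrite lt0r_neq0 ?total_weight_gt0.
apply: DL_count_cvg => // x hx /=.
  have H := horofun_pat R hp hq hT hT' hx.
  by split=> fx; [exact: (agree_trans fx H)|exact: (agree_trans fx (agree_sym H))].
have H := horofun_pat_snd hx.
by split=> fx; [exact: (agree_trans fx H)|exact: (agree_trans fx (agree_sym H))].
Qed.

Lemma DL_ipvt_ready : ipvt_ready (ln (m%:R : R)) nu0.
Proof.
split; [by apply: ln_gt0; rewrite ltr1n /m; lia|exact: DL_growth| |exact: nu0_boundary].
have res := @hbar_resolution R G cG fG.
apply: (weak_cvg_of_classes (hbar_compact cG fG) (hbar_closed cG fG) res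
  (mu := @uniform_ball R G) (nu := nu0)).
- by move=> n; apply: uniform_law_le1.
- by apply: probability_le1; apply: borel_closed; exact: hbar_closed.
move=> r f hf; have Z0 : total_weight != 0 by rewrite lt0r_neq0 ?total_weight_gt0.
have m0 : m%:R != 0 :> R by rewrite pnatr_eq0 /m; lia.
have := cvgM (@DL_agree_cvg f r.+1 isT) (cvgV Z0 DL_ball_cvg).
rewrite mulrAC divff // mul1r => H.
apply: cvg_trans (H _ _); apply: near_eq_cvg; near=> n.
rewrite /uniform_ball uniform_lawE //= invfM invrK.
rewrite (_ : @gball G n `&` [set x | rclass _ _ r f (horofun (x : gspace R G))] =
  @gball G n `&` [set x | agree r.+1 f (horofun (x : gspace R G))]); last first.
  apply/seteqP; split=> x [xn]; first by move=> []; split.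
  by move=> fx; split=> //; split=> //; exact: horofun_hbar.
by rewrite mulrACA mulVf ?mulr1 // expf_neq0.
Unshelve. all: by end_near. Qed.

End DLLimit2.

(** * Measurability of the boundary and uniqueness of the limit measure *)

Section Uniqueness.
Variables (R : realType) (G : rooted_graph).
Hypothesis cG : connected_graph G.
Hypothesis fG : forall n, finite_set (@gball G n).
Notation M := (gspace R G).
Notation F := (fspace M).

Let cK := @hbar_compact R G cG fG.
Let clK := @hbar_closed R G cG fG.
Let res := @hbar_resolution R G cG fG.

Lemma hbar_measurable : measurable (hbar M : set (borel F)).
Proof. exact: borel_closed clK. Qed.

(** A countable union of points, each of which is the intersection of its classes. *)
Lemma range_horofun_measurable : measurable (range (@horofun R M) : set (borel F)).
Proof.
have -> : range (@horofun R M) =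
    \bigcup_n \bigcup_(x in @gball G n) \bigcap_r rclass (hbar M) (@same_upto R G) r (horofun (x : M)).
  apply/seteqP; split=> [_ [x _ <-]|f [n _ [x _ fx]]].
    exists (gdist org (x : G)) => //; exists x => [|r _]; first by rewrite /gball /=.
    by split; [exact: horofun_hbar|exact: agree_refl].
  exists x => //; apply/funext => y; have [_ H] := fx (gdist org (y : G)) I.
  exact: H.
apply: (@bigcupT_measurable _ (borel F)) => n.
apply: (@measure_bigcup_finite _ (borel F)) => // x _.
apply: (@bigcapT_measurable _ (borel F)) => r.
exact: rclass_measurable clK res _ _.
Qed.

Lemma hboundary_measurable : measurable (hboundary M : set (borel F)).
Proof.
apply: (@measurableD _ (borel F)); first exact: hbar_measurable.
exact: range_horofun_measurable.
Qed.

Lemma hboundary_hbar1 (nu : probability (borel F) R) :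
  nu (hboundary M) = 1%E -> nu (hbar M) = 1%E.
Proof.
move=> nu1; apply/eqP; rewrite eq_le; apply/andP; split.
  by apply: probability_le1; exact: hbar_measurable.
rewrite -[X in (X <= _)%E]nu1.
by apply: le_measure; rewrite ?inE; [exact: hboundary_measurable|exact: hbar_measurable|move=> f []].
Qed.

(** Needed because [is_IPVT] quantifies existentially over the index and the boundary measure. *)
Lemma ipvt_ready_unique (b b' : R) (nu nu' : probability (borel F) R) :
  ipvt_ready b nu -> ipvt_ready b' nu' -> b = b' /\ same_measure nu nu'.
Proof.
move=> [_ g w /hboundary_hbar1 n1] [_ g' w' /hboundary_hbar1 n1']; split.
  by apply: expR_inj; apply: cvg_unique g g'.
exact: (weak_cvg_unique cK clK res w w' n1 n1').
Qed.

End Uniqueness.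

(** * The boundary measure of the regular tree *)

Section TreeLimit.
Variables (R : realType) (p : nat) (T : htree).
Hypotheses (hp : (1 < p)%N) (hT : regular_tree T p.+1).
Implicit Types u v : T.
Let cT := tree_connected hT.
Let fT n : finite_set (@gball T n) := tree_ball_finite hT n.

Let p0 : p%:R != 0 :> R. Proof. by rewrite pnatr_eq0; lia. Qed.

Lemma tree_horofun_pat r v : (r <= gdist org v)%N ->
  agree r (horofun (v : gspace R T)) (pat (G := T) id r (anc r v)).
Proof.
move=> rv b br; rewrite horofunE /pat.
have /(congr1 (fun i : int => i%:~R : R)) := anc_dist hT rv br.
by rewrite !intrB -!pmulrn.
Qed.

Definition tree_weight : R := p.+1%:R / (p%:R - 1).

Lemma tree_weight_gt0 : 0 < tree_weight.
Proof. by rewrite divr_gt0 ?ltr0n // subr_gt0 ltr1n. Qed.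

Lemma tree_count_cvg (Q P : set T) r : (0 < r)%N ->
  (forall v, (r <= gdist org v)%N -> (Q v <-> P (anc r v))) ->
  (ncard (@gball T n `&` Q))%:R / p%:R ^+ n @[n --> \oo] -->
  (tree_weight * tree_frac R p P r).
Proof.
move=> r0 QP.
pose S n := [set v : T | gdist org v = n /\ Q v].
have fS n : finite_set (S n) by apply: sub_finite_set (fT n) => v [dv _]; rewrite /gball /= dv.
pose N := ncard [set u : T | gdist org u = r /\ P u].
have fN : finite_set [set u : T | gdist org u = r /\ P u].
  by apply: sub_finite_set (fT r) => v [dv _]; rewrite /gball /= dv.
have SE n : ncard (S (r + n)%N) = (N * p ^ n)%N.
  rewrite (@ncard_fibers _ _ (anc r) _ (fset_set [set u : T | gdist org u = r /\ P u]) (fS _) (fset_uniq _)).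
    rewrite (eq_big_seq (fun=> (p ^ n)%N)).
      by rewrite big_const_seq count_predT iter_addn_0 -/(ncard _) mulnC.
    move=> u /(ncard_mem _ fN)[du Pu]; rewrite -(ncard_cap hT n (u := u)) ?du //.
    congr ncard; apply/seteqP; split=> v.
      move=> [[dv Qv] /= av]; rewrite /cap /= du dv; split=> //.
      by rewrite -av; apply: (proj2 (ancP hT _)); rewrite dv leq_addr.
    move=> [gv dv]; rewrite du in dv; have av := anc_unique hT du gv.
    by split=> //; split=> //; apply/QP; rewrite ?av // dv leq_addr.
  move=> v [dv Qv]; apply/(ncard_mem _ fN); have rv : (r <= gdist org v)%N by rewrite dv leq_addr.
  by split; [exact: (proj1 (ancP hT rv))|apply/QP].
have rec n : (ncard (@gball T n.+1 `&` Q))%:R / p%:R ^+ n.+1 =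
    p%:R^-1 * ((ncard (@gball T n `&` Q))%:R / p%:R ^+ n) +
    (ncard (S n.+1))%:R / p%:R ^+ n.+1 :> R.
  have -> : ncard (@gball T n.+1 `&` Q) = (ncard (@gball T n `&` Q) + ncard (S n.+1))%N.
    rewrite -ncardU //; last first.
    - by apply/seteqP; split=> // v [[vn _] [dv _]]; move: vn; rewrite /gball /= dv ltnn.
    - exact: finite_setIl.
    congr ncard; apply/seteqP; split=> v.
      move=> [vn Qv]; move: vn; rewrite /gball /= leq_eqVlt ltnS.
      by move=> /orP[/eqP dv|vn]; [right|left].
    move=> [[vn Qv]|[dv Qv]]; split=> //; rewrite /gball /=; last by rewrite dv.
    exact: leqW.
  by rewrite natrD exprS; field; rewrite p0 expf_neq0.
have Sc : (ncard (S n.+1))%:R / p%:R ^+ n.+1 @[n --> \oo] --> (N%:R / p%:R ^+ r : R).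
  rewrite (cvg_shiftS (fun n => (ncard (S n))%:R / p%:R ^+ n : R)).
  apply: cvg_near_cst; exists r => // n /= rn.
  rewrite -(subnKC rn) SE natrM natrX exprD.
  by field; rewrite !expf_neq0.
have := cvg_contraction (c := p%:R^-1) (natr_invlt1 R hp) rec Sc.
rewrite /tree_weight /tree_frac -/N.
suff -> : N%:R / p%:R ^+ r / (1 - p%:R^-1) =
  p.+1%:R / (p%:R - 1) * (N%:R / (p.+1 * p ^ r.-1)%:R) :> R by [].
case: r r0 {QP S fS fN SE rec Sc N} (N) => // r _ N; rewrite natrM natrX exprS /=.
by field; rewrite p0 expf_neq0 // nat1r pnatr_eq0 /= subr_eq0 pnatr_eq1; lia.
Qed.

Lemma tree_ball_cvg : gball_size R T n / p%:R ^+ n @[n --> \oo] --> tree_weight.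
Proof.
have := @tree_count_cvg setT setT 1 isT _.
rewrite (tree_frac_setT R hT) ?mulr1 //; last by rewrite ltnW.
by under eq_fun do rewrite setIT; apply.
Qed.

Variable muT : probability (borel (ends T)) R.
Hypothesis hmuT : harmonic_measure muT.

Definition end_fun (w : borel (ends T)) : borel (fspace (gspace R T)) :=
  fun v : T => busemann R w v.

Lemma end_fun_measurable : measurable_fun setT end_fun.
Proof. exact: (end_map_measurable (pi := @id T) hT cT (fun=> leqnn _)). Qed.

Lemma end_fun_boundary (w : ends T) : hboundary (gspace R T) (end_fun w).
Proof.
apply: (end_map_boundary (pi := @id T) hT cT (fun=> leqnn _) fT) => [v|r].
  by exists v.
have dr := gdist_end_anc hT r w; exists (end_anc r w).
rewrite -{1}(anc_unique hT dr (geod_refl hT org (end_anc r w))); apply: agree_sym.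
by apply: tree_horofun_pat; rewrite dr.
Qed.

Lemma tree_ipvt_ready (nu : probability (borel (fspace (gspace R T))) R) :
  (forall A, nu A = pushforward muT end_fun A) -> ipvt_ready (ln (p%:R : R)) nu.
Proof.
move=> nuE; split.
- by apply: ln_gt0; rewrite ltr1n.
- by apply: ratio_growth tree_ball_cvg; [exact: ltnW|exact: tree_weight_gt0].
- have res := @hbar_resolution R T cT fT.
  apply: (weak_cvg_of_classes (hbar_compact cT fT) (hbar_closed cT fT) res
    (mu := @uniform_ball R T) (nu := nu)).
  + by move=> n; apply: uniform_law_le1.
  + by apply: probability_le1; apply: hbar_measurable.
  move=> r f hf; have Z0 : tree_weight != 0 by rewrite lt0r_neq0 ?tree_weight_gt0.
  pose P := [set u : T | agree r.+1 f (pat (G := T) id r.+1 u)].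
  have E : nu (rclass (hbar (gspace R T)) (@same_upto R T) r f) = (tree_frac R p P r.+1)%:E.
    rewrite nuE -(harmonic_frac hp hT hmuT P (ltn0Sn r)) /pushforward; congr (muT _).
    rewrite -(end_map_class (pi := @id T) hT (fun=> leqnn _) r.+1 f).
    by apply/seteqP; split=> w; [move=> []|split=> //; case: (end_fun_boundary w)].
  have -> : fine (nu (rclass (hbar (gspace R T)) (@same_upto R T) r f)) = tree_frac R p P r.+1.
    by rewrite E.
  pose Q := [set v : T | agree r.+1 f (horofun (v : gspace R T))].
  have QP v : (r < gdist org v)%N -> (Q v <-> P (anc r.+1 v)).
    move=> rv; have H := tree_horofun_pat rv.
    by split=> fx; [exact: (agree_trans fx H)|exact: (agree_trans fx (agree_sym H))].
  have := cvgM (tree_count_cvg (ltn0Sn r) QP) (cvgV Z0 tree_ball_cvg).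
  rewrite mulrAC divff // mul1r => H; apply: cvg_trans (H _ _); apply: near_eq_cvg; near=> n.
  rewrite /uniform_ball uniform_lawE //= invfM invrK.
  rewrite (_ : @gball T n `&` [set x | rclass _ _ r f (horofun (x : gspace R T))] =
    @gball T n `&` Q); last first.
    apply/seteqP; split=> x [xn]; first by move=> []; split.
    by move=> fx; split=> //; split=> //; exact: horofun_hbar.
  by rewrite mulrACA mulVf ?mulr1 // expf_neq0.
- rewrite nuE /pushforward (_ : end_fun @^-1` _ = setT) ?probability_setT //.
  by apply/seteqP; split=> // w _; exact: end_fun_boundary.
Unshelve. all: by end_near. Qed.

End TreeLimit.

(** * Poisson processes and their Voronoi cells *)

Section CountingEvents.
Context d (Om : measurableType d) (R : realType).

(** Turns a random number of indices into a series of indicators, which is measurable even where it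
    is infinite. *)
Lemma counting_series (Q : set nat) :
  (counting Q : \bar R) = (\sum_(i <oo) (\1_Q i)%:E)%E.
Proof.
have -> : Q = \bigcup_i (if i \in Q then [set i] else set0).
  apply/seteqP; split=> [i Qi|i [j _]]; first by exists i => //; rewrite mem_set.
  by case: ifPn => // /set_mem Qj ->.
rewrite (@measure_bigcup _ _ _ (@counting _ R) setT) //=; last first.
  move=> i j _ _ [x []]; case: ifPn => // _; case: ifPn => // _ -> //.
rewrite (@eq_eseriesl _ _ xpredT) => [|i]; last by rewrite in_setT.
apply: eq_eseriesr => i _; rewrite indicE.
have -> : (i \in \bigcup_j (if j \in Q then [set j] else set0)) = (i \in Q).
  apply/idP/idP => [/set_mem[j _]|iQ]; first by case: ifPn => // jQ ->.
  by apply/mem_set; exists i => //; rewrite iQ.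
case: ifPn => _; rewrite /counting asboolT //.
- by rewrite fset_set1 cardfs1.
- by rewrite fset_set0 cardfs0.
Qed.

Lemma counting_measurable (Q : nat -> set Om) : (forall i, measurable (Q i)) ->
  measurable_fun setT (fun w => counting [set i | Q i w] : \bar R).
Proof.
move=> mQ; rewrite (_ : (fun w => _) = (fun w => \sum_(i <oo) (\1_(Q i) w)%:E)%E).
  apply: ge0_emeasurable_sum => [k w _ _|k _]; first by rewrite lee_fin.
  by apply/measurable_EFinP; apply: measurable_indic.
apply/funext => w; rewrite counting_series; apply: eq_eseriesr => i _.
by rewrite !indicE; congr (nat_of_bool _)%:R%:E; apply/idP/idP => /set_mem ?; apply/mem_set.
Qed.

Lemma counting_event (Q : nat -> set Om) (c : \bar R) : (forall i, measurable (Q i)) ->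
  measurable [set w | counting [set i | Q i w] = c].
Proof.
move=> mQ; have := counting_measurable mQ measurableT (emeasurable_set1 c).
by rewrite setTI.
Qed.

Lemma counting_nat (Q : set nat) (n : nat) :
  counting Q = (n%:R : R)%:E <-> finite_set Q /\ ncard Q = n.
Proof.
rewrite /counting; case: asboolP => fQ; split=> //.
- by move=> [/eqP]; rewrite eqr_nat => /eqP.
- by move=> [_ <-].
- by move=> [].
Qed.

End CountingEvents.

Section PoissonLaw.
Variable R : realType.
Context d' (S : measurableType d').
Context d1 (Om1 : measurableType d1) (P1 : probability Om1 R) (pts1 : nat -> Om1 -> S).
Context d2 (Om2 : measurableType d2) (P2 : probability Om2 R) (pts2 : nat -> Om2 -> S).
Variable Lam : set S -> \bar R.
Hypothesis Lam_mono : forall A B, measurable A -> measurable B -> A `<=` B ->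
  (Lam A <= Lam B)%E.
Hypothesis Lam0 : (Lam set0 < +oo)%E.
Hypothesis pois1 : poisson_process P1 Lam pts1.
Hypothesis pois2 : poisson_process P2 Lam pts2.

Definition npts d (Om : measurableType d) (pts : nat -> Om -> S) (B : set S) (w : Om) : \bar R :=
  counting [set i | B (pts i w)].

Lemma npts_event d (Om : measurableType d) (pts : nat -> Om -> S) (B : set S) c :
  (forall i, measurable_fun setT (pts i)) -> measurable B ->
  measurable [set w | npts pts B w = c].
Proof.
move=> mp mB; apply: (counting_event (Q := fun i => pts i @^-1` B)) => i.
by have := mp i measurableT B mB; rewrite setTI.
Qed.

Lemma npts_events d (Om : measurableType d) (pts : nat -> Om -> S) k
    (B : 'I_k -> set S) (c : 'I_k -> \bar R) :
  (forall i, measurable_fun setT (pts i)) -> (forall j, measurable (B j)) ->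
  measurable [set w | forall j, npts pts (B j) w = c j].
Proof.
move=> mp mB; rewrite (_ : [set w | _] = \bigcap_(j in setT) [set w | npts pts (B j) w = c j]).
  by apply: fin_bigcap_measurable => // j _; apply: npts_event.
by apply/seteqP; split=> w H j => [_|]; apply: H.
Qed.

Section Joint.
Variables (k : nat) (A : 'I_k -> set S) (n : 'I_k -> nat).
Hypothesis mA : forall j, measurable (A j).
Hypothesis fA : forall j, (Lam (A j) < +oo)%E.

Let r := #|{set 'I_k}|.
Let idx (i : 'I_r) : {set 'I_k} := enum_val i.
(** The atom of the points whose memberships in the A j are prescribed by [idx i]. The complement of
    all A j may have infinite intensity, hence the empty set in its place. *)
Let B (i : 'I_r) : set S := [set s | idx i != (finset.set0 : {set 'I_k}) /\ forall j, A j s <-> j \in idx i].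

Let mB i : measurable (B i).
Proof.
have [e|ne] := eqVneq (idx i) (finset.set0 : {set 'I_k}).
  by rewrite (_ : B i = set0) //; apply/seteqP; split=> // s []; rewrite e eqxx.
rewrite (_ : B i = \bigcap_(j in setT) (if j \in idx i then A j else ~` A j)).
  apply: fin_bigcap_measurable => // j _; case: ifP => _ //; exact: measurableC.
apply/seteqP; split=> s.
  move=> [_ H] j _; case: ifPn => jI; first exact/H.
  by move=> /H; apply/negP.
move=> H; split=> // j; have := H j Logic.I; case: ifPn => jI Hj; split=> // /Hj //.
Qed.

Let tB : trivIset setT B.
Proof.
move=> i i' _ _ [s [[_ H] [_ H']]]; apply: enum_val_inj; apply/finset.setP => j.
apply/idP/idP => [jI|jI]; first by apply/H'; apply/H.
by apply/H; apply/H'.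
Qed.

Let fB i : (Lam (B i) < +oo)%E.
Proof.
have [e|/finset.set0Pn[j jI]] := eqVneq (idx i) (finset.set0 : {set 'I_k}).
  rewrite (_ : B i = set0) //; apply/seteqP; split=> // s []; by rewrite e eqxx.
apply: le_lt_trans (fA j); apply: Lam_mono; [exact: mB|exact: mA|move=> s [_ H]].
exact/H.
Qed.

Let M := (\sum_j n j)%N.
Let table := {ffun 'I_r -> 'I_M.+1}.
(** The possible counts of the atoms. No entry exceeds M, so there are finitely many tables and the
    event becomes a finite disjoint union. *)
Let good : set table := [set t : table | (forall j, (\sum_(i | j \in idx i) (t i : nat))%N = n j) /\
  forall i, idx i = (finset.set0 : {set 'I_k}) -> (t i : nat) = 0%N].

Let decompose d (Om : measurableType d) (pts : nat -> Om -> S) :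
  [set w | forall j, npts pts (A j) w = ((n j)%:R : R)%:E] =
  \bigcup_(t in good) [set w | forall i, npts pts (B i) w = ((t i : nat)%:R : R)%:E].
Proof.
have sumA w j : npts pts (A j) w = (\sum_(i | j \in idx i) npts pts (B i) w)%E.
  rewrite /npts; rewrite -(@measure_bigsetU_ord_cond _ _ _ (@counting _ R) _
    (fun i => j \in idx i) (fun i => [set l | B i (pts l w)])) //; last first.
    by move=> i i' _ _ [l [Bl Bl']]; apply: tB => //; exists (pts l w).
  rewrite -(bigcup_pred (fun i => j \in idx i)); congr counting; apply/seteqP; split=> l.
    move=> Al; pose J := finset.finset (fun j' : 'I_k => `[< A j' (pts l w) >]).
    have idxJ : idx (enum_rank J) = J := enum_rankK J.
    exists (enum_rank J); first by suff: j \in idx (enum_rank J) by []; rewrite idxJ finset.inE; apply/asboolP.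
    have jJ : j \in J by rewrite finset.inE; apply/asboolP.
    rewrite /B /mkset idxJ; split; first by apply/finset.set0Pn; exists j.
    by move=> j'; rewrite finset.inE; split=> [?|/asboolP//]; apply/asboolP.
  by move=> [i jI [_ H]]; apply/H.
apply/seteqP; split=> w.
  move=> Hw.
  have fin i : exists t : 'I_M.+1, npts pts (B i) w = ((t : nat)%:R : R)%:E.
    have [e|/finset.set0Pn[j jI]] := eqVneq (idx i) (finset.set0 : {set 'I_k}).
      exists ord0; rewrite /npts (_ : [set l | _] = set0) ?measure0 //.
      by apply/seteqP; split=> // l [+ _]; rewrite e eqxx.
    have /counting_nat[fj cj] := Hw j.
    have sub : [set l | B i (pts l w)] `<=` [set l | A j (pts l w)] by move=> l [_ H]; apply/H.
    have fi := sub_finite_set sub fj.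
    have ltM : (ncard [set l | B i (pts l w)] < M.+1)%N.
      by rewrite ltnS (leq_trans (ncard_le fj sub)) // cj /M (bigD1 j) //= leq_addr.
    by exists (Ordinal ltM); apply/counting_nat.
  have [t Ht] := choice fin; exists [ffun i => t i] => [|i]; last by rewrite ffunE.
  split=> [j|i Ii].
    have := Hw j; rewrite sumA (eq_bigr (fun i => ((t i : nat)%:R : R)%:E)) //.
    rewrite sumEFin -natr_sum => -[/eqP]; rewrite eqr_nat => /eqP <-.
    by apply: eq_bigr => i _; rewrite ffunE.
  rewrite ffunE; have := Ht i; rewrite /npts (_ : [set l | _] = set0) ?measure0.
    by move=> [/eqP]; rewrite eq_sym pnatr_eq0 => /eqP.
  by apply/seteqP; split=> // l [+ _]; rewrite Ii eqxx.
move=> [t [tn t0] Hw] j; rewrite sumA (eq_bigr (fun i => ((t i : nat)%:R : R)%:E)) //.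
by rewrite sumEFin -natr_sum tn.
Qed.

(* A Poisson process is only described on disjoint sets, so that overlapping
   sets are cut into the atoms [B i]. *)
Lemma npts_joint_law :
  P1 [set w | forall j, npts pts1 (A j) w = ((n j)%:R : R)%:E] =
  P2 [set w | forall j, npts pts2 (A j) w = ((n j)%:R : R)%:E].
Proof.
rewrite !decompose.
have disj d (Om : measurableType d) (pts : nat -> Om -> S) :
    trivIset good (fun t : table => [set w | forall i, npts pts (B i) w = ((t i : nat)%:R : R)%:E]).
  move=> t t' _ _ [w [Hw Hw']]; apply/ffunP => i; apply/val_inj/eqP.
  by rewrite -(eqr_nat R) -eqe -Hw -Hw'.
have [m1 H1] := pois1; have [m2 H2] := pois2.
rewrite !measure_fin_bigcup //=; try by move=> t _; apply: npts_events.
by apply: eq_fsbigr => t _; rewrite (H1 r B mB tB fB) (H2 r B mB tB fB).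
Qed.

End Joint.

(** The definition of the process does not say that counts are finite; this follows because the
    Poisson weights sum to 1. *)
Lemma npts_finite d (Om : measurableType d) (P : probability Om R) (pts : nat -> Om -> S)
    (B : set S) : poisson_process P Lam pts -> measurable B -> (0 <= Lam B < +oo)%E ->
  {ae P, forall w, finite_set [set i | B (pts i w)]}.
Proof.
move=> [mp pp] mB /andP[B0 Boo].
pose E n := [set w | npts pts B w = (n%:R : R)%:E].
have mE n : measurable (E n) by apply: npts_event.
have PE n : P (E n) = (expR (- fine (Lam B)) * fine (Lam B) ^+ n / n`!%:R)%:E.
  have := pp 1%N (fun=> B) (fun=> mB) _ (fun=> Boo) (fun=> n).
  rewrite big_ord1 => <-; first by congr (P _); apply/seteqP; split=> w; [move=> H j|apply; exact: ord0].
  by move=> i j _ _ _; rewrite !ord1.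
have tE : trivIset setT E.
  by move=> i j _ _ [w [ei ej]]; apply/eqP; rewrite -(eqr_nat R) -eqe -ei -ej.
have P1E : P (\bigcup_n E n) = 1%E.
  (* A null intensity is treated apart: the event without points then has probability 1. *)
  have [l0|l0] := leP (fine (Lam B)) 0.
    apply/eqP; rewrite eq_le; apply/andP; split; first exact/probability_le1/bigcupT_measurable.
    have e : fine (Lam B) = 0 by apply/eqP; rewrite eq_le l0 fine_ge0.
    have <- : P (E 0%N) = 1%E by rewrite PE e oppr0 expR0 expr0 fact0 !mul1r invr1.
    by apply: le_measure; rewrite ?inE //; [exact: bigcupT_measurable|exact: bigcup_sup].
  rewrite (_ : P _ = \sum_(i <oo | i \in [set: nat]) P (E i))%E; last exact: measure_bigcup.
  transitivity (@poisson_prob R (fine (Lam B)) 0%N setT); last exact: probability_setT.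
  transitivity (\esum_(i in [set: nat]) (poisson_pmf (fine (Lam B)) i)%:E)%E; last by rewrite /poisson_prob l0.
  rewrite -nneseries_esumT; last by move=> n; rewrite lee_fin poisson_pmf_ge0.
  rewrite (@eq_eseriesl _ _ xpredT) => [|i]; last by rewrite in_setT.
  by apply: eq_eseriesr => i _; rewrite PE /poisson_pmf l0; congr EFin; ring.
exists (~` \bigcup_n E n); split.
- exact/measurableC/bigcupT_measurable.
- by rewrite probability_setC ?P1E ?subee //; exact: bigcupT_measurable.
- by move=> w /= H [n _ /counting_nat[]].
Qed.

End PoissonLaw.

Lemma ae_measure_eq d (Om : measurableType d) (R : realType) (P : {measure set Om -> \bar R})
    (A B : set Om) : measurable A -> measurable B -> {ae P, forall w, A w <-> B w} -> P A = P B.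
Proof.
move=> mA mB [N [mN PN AB]].
suff le (U V : set Om) : measurable U -> measurable V -> U `\` V `<=` N -> (P U <= P V)%E.
  apply/eqP; rewrite eq_le; apply/andP; split; apply: le => // w [Uw Vw]; apply: AB => /= e.
    by apply: Vw; apply/e.
  by apply: Vw; apply/e.
move=> mU mV UV; apply: (@le_trans _ _ (P (V `|` N))).
  apply: le_measure; rewrite ?inE //; first exact: measurableU.
  by move=> w Uw; have [Vw|Vw] := pselect (V w); [left|right; apply: UV].
apply: le_trans (measureU2 _ _ _) _ => //.
by rewrite [X in (_ + X)%E]PN adde0.
Qed.

Lemma countable_bigcap_measurable d (T : measurableType d) (I : countType) (F : I -> set T) :
  (forall i, measurable (F i)) -> measurable (\bigcap_i F i).
Proof.
move=> mF; rewrite -[X in measurable X]setCK setC_bigcap; apply: measurableC.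
by apply: countable_bigcupT_measurable => // i; exact: measurableC.
Qed.

Lemma borel_continuous_measurable (X Y : ptopologicalType) (f : X -> Y) : continuous f ->
  measurable_fun setT (f : borel X -> borel Y).
Proof.
move=> cf; apply: (@measurability _ _ (borel X) (borel Y) _ _ (@open Y)) => //.
move=> _ [U oU <-]; rewrite setTI; apply: borel_open.
by move/continuousP: cf; apply.
Qed.

Lemma continuous_real_measurable (X : ptopologicalType) (R : realType) (f : X -> R) :
  continuous f -> measurable_fun setT (f : borel X -> R).
Proof.
move=> cf; apply: (measurability _ (RGenInftyO.measurableE R)) => //.
move=> _ [_ [x ->] <-]; rewrite setTI; apply: borel_open.
by move/continuousP: cf; apply; apply: interval_open.
Qed.

Lemma ncard_infinite (V : choiceType) (A : set V) : ~ finite_set A -> ncard A = 0%N.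
Proof. by move=> nA; rewrite /ncard /fset_set; case: pselect => //; rewrite cardfs0. Qed.

(** * Cells as functions of point counts *)

Section Configurations.
Variables (R : realType) (G : rooted_graph).
Notation F := (fspace (gspace R G)).
Notation S := (borel F * int)%type.

Definition config := nat -> S.
Implicit Type x : config.

Definition layer (d : int) : set S := [set s | s.2 = d].

Definition proper_config x :=
  (forall d, finite_set [set i | layer d (x i)]) /\
  forall i (y : G), exists c : int, ((x i).1 : F) y = c%:~R.

(** A layer has finite intensity, so on these sets the Poisson law applies and the counts are almost
    surely finite. *)
Definition admissible (B : set S) := measurable B /\ exists d, B `<=` layer d.

Definition counts := set S -> nat.
HB.instance Definition _ := Pointed.on counts.

Definition cylinder (s : seq (set S * nat)) : set counts :=
  [set D | forall b, b \in s -> D b.1 = b.2].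

Definition cylinders : set (set counts) :=
  [set cylinder s | s in [set s : seq (set S * nat) | forall b, b \in s -> admissible b.1]].

Definition data := g_sigma_algebraType cylinders.

(** Since [ncard] is 0 on infinite sets, this is the true count only for admissible sets and proper
    configurations. *)
Definition data_of x : data := fun B => ncard [set i | B (x i)].

(* The law of a measurable function of the numbers of points in the admissible
   sets only depends on the intensity of the Poisson process. *)
Definition determined (f : config -> \bar R) := exists Psi : data -> \bar R,
  [/\ measurable_fun setT Psi, forall D, (0 <= Psi D)%E &
      forall x, proper_config x -> f x = Psi (data_of x)].

Lemma data_event B n : admissible B -> measurable [set D : data | D B = n].
Proof.
move=> aB; apply: sub_sigma_algebra; exists [:: (B, n)] => [b|]; first by rewrite inE => /eqP ->.
by apply/seteqP; split=> D H; [exact: (H (B, n) (mem_head _ _))|move=> b; rewrite inE => /eqP ->].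
Qed.

Lemma data_count_measurable B : admissible B ->
  measurable_fun setT (fun D : data => ((D B)%:R)%:E : \bar R).
Proof.
move=> aB _ Y _; rewrite setTI.
rewrite (_ : _ @^-1` Y = \bigcup_(n in [set n | Y ((n%:R)%:E)]) [set D : data | D B = n]).
  by apply: bigcup_measurable => n _; apply: data_event.
by apply/seteqP; split=> [D YD|D [n Yn /= e]]; [exists (D B)|rewrite /preimage /mkset e].
Qed.

Lemma counting_data x B : proper_config x -> admissible B ->
  counting [set i | B (x i)] = ((data_of x B)%:R : R)%:E.
Proof.
move=> [fx _] [_ [d Bd]]; apply/counting_nat; split=> //.
by apply: sub_finite_set (fx d) => i /Bd.
Qed.

Lemma layer_measurable d : measurable (layer d).
Proof.
have := @measurable_snd _ _ (borel F) int measurableT [set d] Logic.I; rewrite setTI.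
by congr measurable.
Qed.

Lemma eval_measurable (y : G) : measurable_fun setT (fun s : S => (s.1 : F) y).
Proof.
have me : measurable_fun setT (fun f : borel F => (f : F) y).
  by apply: continuous_real_measurable; exact: fspace_eval_continuous.
exact: (measurableT_comp me (@measurable_fst _ _ (borel F) int)).
Qed.

Definition cell x := voronoi_cell (fun i => (x i).1 : F) (fun i => (x i).2).

(** Fixing the delay makes the count finite on proper configurations, so that it can be subtracted
    when passing to complements. *)
Definition layer_count d (A : set (set G)) x : \bar R :=
  counting [set i | (x i).2 = d /\ A (cell x i)].

Section Base.
Variables (Fs : seq G) (d : int).

Let atom (phi : seq int) : set S :=
  [set s | [seq (s.1 : F) y | y <- Fs] = [seq c%:~R | c <- phi] /\ s.2 = d].

Let lower (y : G) (c d' : int) : set S :=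
  [set s | ((s.1 : F) y + d'%:~R < c%:~R) /\ s.2 = d'].

Let minimal (phi : seq int) : set data := \bigcap_(y in [set` Fs]) \bigcap_d'
  [set D : data | D (lower y (nth 0 phi (index y Fs) + d) d') = 0%N].

Let atom_admissible phi : admissible (atom phi).
Proof.
split; last by exists d => s [].
rewrite (_ : atom phi = [set s : S | [seq (s.1 : F) y | y <- Fs] = [seq c%:~R | c <- phi]] `&` layer d) //.
apply: measurableI; last exact: layer_measurable.
elim: Fs phi => [|y ys IH] [|c phi] /=.
- by rewrite (_ : [set _ | _] = setT) //; apply/seteqP; split.
- by rewrite (_ : [set _ | _] = set0) //; apply/seteqP; split.
- by rewrite (_ : [set _ | _] = set0) //; apply/seteqP; split.
rewrite (_ : [set _ | _] = [set s : S | (s.1 : F) y = c%:~R] `&`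
  [set s : S | [seq (s.1 : F) y | y <- ys] = [seq c%:~R | c <- phi]]).
  apply: measurableI => //; have := eval_measurable y measurableT (measurable_set1 (c%:~R : R)).
  by rewrite setTI.
by apply/seteqP; split=> [s [e1 e2]|s [/= e1 e2]]; [split|rewrite /mkset e1 e2].
Qed.

Let lower_admissible y c d' : admissible (lower y c d').
Proof.
split; last by exists d' => s [].
apply: measurableI; last exact: layer_measurable.
have := eval_measurable y measurableT (measurable_itv `]-oo, (c%:~R - d'%:~R : R)[).
rewrite setTI; congr measurable; apply/seteqP; split=> s /=; rewrite in_itv /=; lra.
Qed.

Let minimal_measurable phi : measurable (minimal phi).
Proof.
apply: fin_bigcap_measurable; first exact: finite_seq.
move=> y _; apply: countable_bigcap_measurable => d'.
by apply: data_event; apply: lower_admissible.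
Qed.

(* A point (theta, d) with values phi on Fs has a cell that contains Fs iff, for
   all y in Fs, no point (theta', d') has theta' y + d' < phi y + d. *)
Lemma layer_count_base : determined (layer_count d [set V | forall y, y \in Fs -> V y]).
Proof.
pose phi_ m : option (seq int) := pickle_inv m.
pose part m (D : data) : \bar R := if phi_ m is Some phi
  then ((D (atom phi))%:R%:E * (\1_(minimal phi) D)%:E)%E else 0%E.
have part0 m D : (0 <= part m D)%E.
  by rewrite /part; case: (phi_ m) => // phi; rewrite mule_ge0 // lee_fin.
exists (fun D => \sum_(m <oo | m \in setT) part m D)%E; split=> [|D|x ox].
- apply: ge0_emeasurable_sum => [m D _ _|m _]; first exact: part0.
  rewrite /part; case: (phi_ m) => [phi|]; last exact: measurable_cst.
  apply: emeasurable_funM; first exact: data_count_measurable.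
  by apply/measurable_EFinP; apply: measurable_indic.
- by apply: nneseries_ge0 => m _ _; apply: part0.
have [fx ix] := ox.
pose Q m : set nat := if phi_ m is Some phi
  then [set i | atom phi (x i) /\ minimal phi (data_of x)] else set0.
rewrite /layer_count (_ : [set i | _] = \bigcup_m Q m); last first.
  have below i phi : atom phi (x i) -> minimal phi (data_of x) <-> forall y, y \in Fs -> cell x i y.
    move=> [e xd].
    have val y : y \in Fs -> ((x i).1 : F) y = (nth 0 phi (index y Fs))%:~R.
      move=> yF; have sz : size phi = size Fs by rewrite -(size_map (fun c => c%:~R : R)) -e size_map.
      have := congr1 (nth 0 ^~ (index y Fs)) e; rewrite (nth_map y) ?index_mem // nth_index // => ->.
      by rewrite (nth_map 0) ?sz ?index_mem.
    split=> [mn y yF j|H y yF d' _].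
      rewrite leNgt; apply/negP => lt.
      have := mn y yF (x j).2 Logic.I; rewrite /= /data_of => /eqP; apply/negP.
      rewrite -lt0n; apply: ncard_gt0; first by apply: sub_finite_set (fx (x j).2) => k [].
      by exists j; split=> //=; rewrite intrD -val // -xd.
    rewrite /= /data_of (_ : [set _ | _] = set0); first exact: ncard0.
    apply/seteqP; split=> // j [+ jd] /=; rewrite intrD -val // -xd -jd.
    by rewrite ltNge => /negP; apply; apply: H.
  apply/seteqP; split=> i.
    move=> [id H]; have [c Hc] := choice (fun y => ix i y).
    exists (choice.pickle (map c Fs)) => //; rewrite /Q /phi_ pickleK_inv /=.
    have at_i : atom (map c Fs) (x i).
      by split=> //; rewrite -map_comp; apply: eq_map => y; rewrite Hc.
    by split=> //; apply/(below i _ at_i).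
  move=> [m _]; rewrite /Q; case: (phi_ m) => // phi [at_i mn]; split; first by case: at_i.
  exact/(below i _ at_i).
rewrite (@measure_bigcup _ _ _ (@counting _ R) setT) //=; last first.
  move=> m m' _ _ [i []]; rewrite /Q.
  case E : (phi_ m) => [phi|//]; case E' : (phi_ m') => [phi'|//] [[e _] _] [[e' _] _].
  have phiE : phi = phi' by apply: (inj_map (@intr_inj R)); rewrite -e -e'.
  by rewrite -[m](pickle_invK (T := seq int)) -[m'](pickle_invK (T := seq int)) -!/(phi_ _) E E' phiE.
apply: eq_eseriesr => m _; rewrite /Q /part; case: (phi_ m) => [phi|]; last by rewrite measure0.
rewrite indicE; have [mn|mn] := pselect (minimal phi (data_of x)).
  rewrite mem_set // mule1 -counting_data //; congr counting.
  by apply/seteqP; split=> [i []|i].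
rewrite memNset // mule0 (_ : [set i | _] = set0) ?measure0 //.
by apply/seteqP; split=> i [].
Qed.

End Base.

Lemma determined_ext f g : (forall x, proper_config x -> f x = g x) ->
  determined f -> determined g.
Proof.
by move=> fg [Psi [mPsi Psi0 e]]; exists Psi; split=> // x ox; rewrite -fg // e.
Qed.

Lemma determined_series (f : nat -> config -> \bar R) : (forall m, determined (f m)) ->
  determined (fun x => \sum_(m <oo | m \in setT) f m x)%E.
Proof.
move=> /choice[Psi HPsi]; exists (fun D => \sum_(m <oo | m \in setT) Psi m D)%E; split=> [|D|x ox].
- by apply: ge0_emeasurable_sum => [m D _ _|m _]; have [? ? _] := HPsi m.
- by apply: nneseries_ge0 => m _ _; have [_ ? _] := HPsi m.
- by apply: eq_eseriesr => m _; have [_ _ ->] := HPsi m.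
Qed.

Lemma determined_sub f g : determined f -> determined g ->
  determined (fun x => `|f x - g x|%E).
Proof.
move=> [Phi [mPhi _ eP]] [Psi [mPsi _ eQ]]; exists (fun D => `|Phi D - Psi D|%E); split=> [|D|x ox].
- by apply: measurableT_comp => //; apply: emeasurable_funB.
- exact: abse_ge0.
- by rewrite eP // eQ.
Qed.

(** A Dynkin argument: the families of the V that contain a given finite set are stable under
    intersection and generate; complements correspond to differences of finite counts, disjoint
    unions to series. *)
Lemma layer_count_determined d A : measurable_family A -> determined (layer_count d A).
Proof.
pose pi_sets : set (set (set G)) :=
  [set [set V : set G | forall y, y \in Fs -> V y] | Fs in [set: seq G]].
have base Fs := layer_count_base Fs d.
have baseT : determined (layer_count d setT).
  by apply: determined_ext (base [::]) => x _; congr counting; apply/seteqP; split=> i [].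
have sub : @measurable_family G `<=` <<s pi_sets >>.
  apply: smallest_sub; first exact: smallest_sigma_algebra.
  move=> _ [y _ <-]; apply: sub_sigma_algebra; exists [:: y] => //.
  by apply/seteqP; split=> V; [apply; exact: mem_head|move=> Vy z; rewrite inE => /eqP ->].
move=> /sub.
apply: (@dynkin_induction _ (g_sigma_algebraType pi_sets) pi_sets (fun A => determined (layer_count d A))) => //.
- move=> _ _ [Fs _ <-] [Hs _ <-]; exists (Fs ++ Hs) => //.
  apply/seteqP; split=> V; last by move=> [HF HH] y; rewrite mem_cat => /orP[/HF|/HH].
  by move=> HV; split=> y yF; apply: HV; rewrite mem_cat yF ?orbT.
- by move=> _ [Fs _ <-].
- move=> B mB dB; apply: determined_ext (determined_sub baseT dB) => x [fx _].
  have cfin (C : set (set G)) : exists n : nat, layer_count d C x = (n%:R)%:E.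
    exists (ncard [set i | (x i).2 = d /\ C (cell x i)]); apply/counting_nat; split=> //.
    by apply: sub_finite_set (fx d) => i [].
  have : (layer_count d setT x = layer_count d B x + layer_count d (~` B) x)%E.
    rewrite /layer_count -measureU //; last by apply/seteqP; split=> // i [[_ ?] [_]].
    congr counting; apply/seteqP; split=> i; last by move=> [[? _]|[? _]].
    by move=> [id _]; have [?|?] := pselect (B (cell x i)); [left|right].
  have [[n ->] [m ->]] := (cfin B, cfin (~` B)) => ->.
  by rewrite -EFinD /= addrAC subrr add0r ger0_norm.
- move=> B mB tB dB; apply: determined_ext (determined_series dB) => x _.
  rewrite /layer_count (_ : [set i | _ /\ (\bigcup_k B k) _] = \bigcup_k [set i | (x i).2 = d /\ B k (cell x i)]).
    rewrite (@measure_bigcup _ _ _ (@counting _ R) setT) //=.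
    by move=> k k' _ _ [i [[_ Bk] [_ Bk']]]; apply: tB => //; exists (cell x i).
  by apply/seteqP; split=> [i [id [k _ Bk]]|i [k _ [id Bk]]]; [exists k|split=> //; exists k].
Qed.

Lemma cell_count_determined A : measurable_family A ->
  determined (fun x => counting [set i | A (cell x i)]).
Proof.
move=> mA; pose d_ m : option int := pickle_inv m.
pose f m := if d_ m is Some d then layer_count d A else (fun=> 0%E).
have df m : determined (f m).
  rewrite /f; case: (d_ m) => [d|]; first exact: layer_count_determined.
  by exists (fun=> 0%E); split=> //; exact: measurable_cst.
apply: determined_ext (determined_series df) => x _.
pose Q m : set nat := if d_ m is Some d then [set i | (x i).2 = d /\ A (cell x i)] else set0.
rewrite (_ : [set i | _] = \bigcup_m Q m); last first.
  apply/seteqP; split=> i; last by move=> [m _]; rewrite /Q; case: (d_ m) => // d [].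
  move=> Ai; exists (choice.pickle (x i).2); first by [].
  by rewrite /Q /d_; rewrite pickleK_inv; split.
rewrite (@measure_bigcup _ _ _ (@counting _ R) setT) //=.
  by apply: eq_eseriesr => m _; rewrite /f /Q; case: (d_ m) => // ; rewrite measure0.
move=> m m' _ _ [i []]; rewrite /Q; case E : (d_ m) => [d|//]; case E' : (d_ m') => [d'|//] [e _] [e' _].
by rewrite -[m](pickle_invK (T := int)) -[m'](pickle_invK (T := int)) -/(d_ m) -/(d_ m') E E' -e -e'.
Qed.

Section Law.
Variable Lam : set S -> \bar R.
Hypothesis Lam_mono : forall A B, measurable A -> measurable B -> A `<=` B -> (Lam A <= Lam B)%E.
Hypothesis Lam_layer : forall d, (0 <= Lam (layer d) < +oo)%E.

Let Lam_fin B : admissible B -> (Lam B < +oo)%E.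
Proof.
move=> [mB [d Bd]]; have /andP[_] := Lam_layer d; apply: le_lt_trans.
by apply: Lam_mono => //; exact: layer_measurable.
Qed.

Section One.
Context d (Om : measurableType d) (P : probability Om R) (pts : nat -> Om -> S).
Hypothesis pp : poisson_process P Lam pts.
Hypothesis int_pts : forall w i (y : G), exists c : int, ((pts i w).1 : F) y = c%:~R.

Let mpts i : measurable_fun setT (pts i).
Proof. by case: pp. Qed.

Lemma proper_ae : {ae P, forall w, proper_config (pts^~ w)}.
Proof.
have H n : {ae P, forall w, if pickle_inv n is Some e then finite_set [set i | layer e (pts i w)] else True}.
  case: (pickle_inv n) => [e|]; last exact: aeW.
  exact: npts_finite pp (layer_measurable e) (Lam_layer e).
have := ae_foralln H; apply: filterS => w Hw; split; last by move=> i y; apply: int_pts.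
by move=> e; have := Hw (choice.pickle e); rewrite pickleK_inv.
Qed.

Lemma data_of_measurable : measurable_fun setT (fun w => data_of (pts^~ w)).
Proof.
apply: (@measurability _ _ _ data _ _ cylinders) => //.
move=> _ [_ [s sadm <-] <-]; rewrite setTI.
rewrite (_ : _ @^-1` _ = \bigcap_(b in [set` s]) [set w | ncard [set i | b.1 (pts i w)] = b.2]) //.
apply: fin_bigcap_measurable; first exact: finite_seq.
move=> [B n] /sadm /= [mB _].
have mN c : measurable [set w | npts R pts B w = c] by apply: npts_event.
(* For n = 0 the configurations with infinitely many points in B are included, by the convention of
   [ncard]. *)
rewrite (_ : [set w | _] = [set w | npts R pts B w = (n%:R)%:E] `|`
   (if n == 0%N then [set w | npts R pts B w = +oo%E] else set0)).
  by apply: measurableU => //; case: ifP.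
have inf w : npts R pts B w = +oo%E <-> ~ finite_set [set i | B (pts i w)].
  by rewrite /npts /counting; case: asboolP.
apply/seteqP; split=> w /=.
  move=> e; have [fB|nfB] := pselect (finite_set [set i | B (pts i w)]).
    by left; apply/counting_nat.
  by right; rewrite -e ncard_infinite // eqxx; apply/inf.
by move=> [/counting_nat[]//|]; case: eqP => // -> /inf; exact: ncard_infinite.
Qed.

Lemma cell_measurable i A : measurable_family A -> measurable [set w | A (cell (pts^~ w) i)].
Proof.
suff sub : @measurable_family G `<=` [set A | measurable [set w | A (cell (pts^~ w) i)]] by apply: sub.
apply: smallest_sub.
  split=> [|B mB|B mB] /=.
  - by rewrite (_ : [set w | _] = set0) //; apply/seteqP; split.
  - rewrite (_ : [set w | _] = ~` [set w | B (cell (pts^~ w) i)]); first exact: measurableC.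
    by apply/seteqP; split=> w; [case|move=> ?; split].
  - rewrite (_ : [set w | _] = \bigcup_k [set w | B k (cell (pts^~ w) i)]) //.
    exact: bigcupT_measurable.
move=> _ [y _ <-] /=.
have mval j : measurable_fun setT (fun w => ((pts j w).1 : F) y + ((pts j w).2)%:~R : R).
  apply: measurable_funD; first exact: (measurableT_comp (eval_measurable y) (mpts j)).
  apply: (measurableT_comp (f := fun d : int => d%:~R : R)) => //.
  exact: (measurableT_comp (@measurable_snd _ _ (borel F) int) (mpts j)).
rewrite (_ : [set w | _] = \bigcap_j [set w | ((pts i w).1 : F) y + ((pts i w).2)%:~R <=
    ((pts j w).1 : F) y + ((pts j w).2)%:~R]).
  apply: bigcapT_measurable => j.
  by have := measurable_fun_ler (mval i) (mval j) measurableT (Logic.I : measurable [set true]); rewrite setTI.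
by apply/seteqP; split=> w H j => [_|]; apply: H.
Qed.

End One.

Context d1 (Om1 : measurableType d1) (P1 : probability Om1 R) (pts1 : nat -> Om1 -> S).
Context d2 (Om2 : measurableType d2) (P2 : probability Om2 R) (pts2 : nat -> Om2 -> S).
Hypothesis pp1 : poisson_process P1 Lam pts1.
Hypothesis pp2 : poisson_process P2 Lam pts2.
Hypothesis int1 : forall w i (y : G), exists c : int, ((pts1 i w).1 : F) y = c%:~R.
Hypothesis int2 : forall w i (y : G), exists c : int, ((pts2 i w).1 : F) y = c%:~R.

(** Cylinders are stable under intersection and generate; on a cylinder, up to the null set of
    improper configurations, this is the joint law of finitely many counts. *)
Lemma data_law (E : set data) : measurable E ->
  P1 [set w | E (data_of (pts1^~ w))] = P2 [set w | E (data_of (pts2^~ w))].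
Proof.
have m1 := data_of_measurable pp1; have m2 := data_of_measurable pp2.
have [Q1 Q1E] := pushforward_probability P1 m1; have [Q2 Q2E] := pushforward_probability P2 m2.
suff H : forall A, cylinders A -> Q1 A = Q2 A.
  move=> mE; have := Q2E E; have := Q1E E; rewrite /pushforward => <- <-.
  apply: (@measure_unique _ R data cylinders (fun=> setT) _ _ _ _ Q1 Q2) => //.
  - move=> _ _ [s sa <-] [t ta <-]; exists (s ++ t).
      by move=> b; rewrite mem_cat => /orP[/sa|/ta].
    apply/seteqP; split=> D; last by move=> [HF HH] y; rewrite mem_cat => /orP[/HF|/HH].
    by move=> HV; split=> y yF; apply: HV; rewrite mem_cat yF ?orbT.
  - by move=> _; exists [::] => //; apply/seteqP; split.
  - by apply/seteqP; split=> // D _; exists 0%N.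
  - by move=> _ /=; apply: (@le_lt_trans _ _ 1%E); [exact: (@probability_le1 _ _ _ Q1)|rewrite ltry].
move=> _ [s sa <-].
pose A (j : 'I_(size s)) := (tnth (in_tuple s) j).1; pose n (j : 'I_(size s)) := (tnth (in_tuple s) j).2.
have aA j : admissible (A j) by apply: sa; apply: mem_tnth.
have step d (Om : measurableType d) (P : probability Om R) (pts : nat -> Om -> S)
    (pp : poisson_process P Lam pts) (it : forall w i (y : G), exists c : int, ((pts i w).1 : F) y = c%:~R) :
    P [set w | cylinder s (data_of (pts^~ w))] = P [set w | forall j, npts R pts (A j) w = ((n j)%:R)%:E].
  apply: ae_measure_eq.
  - have mc : measurable (cylinder s : set data) by apply: sub_sigma_algebra; exists s.
    by have := data_of_measurable pp measurableT mc; rewrite setTI.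
  - by apply: npts_events => [|j]; [case: pp|case: (aA j)].
  apply: filterS (proper_ae pp it) => w ow.
  have cd j : npts R pts (A j) w = ((data_of (pts^~ w) (A j))%:R)%:E by apply: counting_data.
  split=> [H j|H b bs]; first by rewrite cd; congr (_%:R)%:E; apply: H; apply: mem_tnth.
  have /tnthP[j ->] : b \in in_tuple s := bs.
  by have /eqP := H j; rewrite cd eqe eqr_nat => /eqP.
rewrite Q1E Q2E /pushforward; transitivity (P1 [set w | cylinder s (data_of (pts1^~ w))]) => //.
rewrite step // (@npts_joint_law R _ S _ _ P1 pts1 _ _ P2 pts2 Lam) ?step //.
- by apply: Lam_fin; split; [exact: measurable0|exists 0 => ? []].
- by move=> j; case: (aA j).
- by move=> j; apply: Lam_fin.
Qed.

Lemma cells_law : eq_collection_law P1 (fun i w => cell (pts1^~ w) i)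
  P2 (fun i w => cell (pts2^~ w) i).
Proof.
move=> k A mA n.
have /choice[Psi HPsi] := fun j => cell_count_determined (mA j).
have mE : measurable [set D : data | forall j, Psi j D = n j].
  rewrite (_ : [set _ | _] = \bigcap_(j in setT) [set D | Psi j D = n j]).
    apply: fin_bigcap_measurable => // j _; have [mP _ _] := HPsi j.
    by have := mP measurableT [set n j] (emeasurable_set1 _); rewrite setTI.
  by apply/seteqP; split=> D H j => [_|]; apply: H.
have step d (Om : measurableType d) (P : probability Om R) (pts : nat -> Om -> S)
    (pp : poisson_process P Lam pts) (it : forall w i (y : G), exists c : int, ((pts i w).1 : F) y = c%:~R) :
    P [set w | forall j, counting [set i | A j (cell (pts^~ w) i)] = n j] =
    P [set w | forall j, Psi j (data_of (pts^~ w)) = n j].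
  apply: ae_measure_eq.
  - rewrite (_ : [set _ | _] = \bigcap_(j in setT) [set w | counting [set i | A j (cell (pts^~ w) i)] = n j]).
      apply: fin_bigcap_measurable => // j _.
      apply: (counting_event (Q := fun i => [set w | A j (cell (pts^~ w) i)])) => i.
      have := @cell_measurable _ _ _ _ pp i _ (mA j); exact.
    by apply/seteqP; split=> D H j => [_|]; apply: H.
  - by have := data_of_measurable pp measurableT mE; rewrite setTI.
  apply: filterS (proper_ae pp it) => w ow.
  by split=> H j; have [_ _ e] := HPsi j; [rewrite -e|rewrite e].
by rewrite !step //; exact: data_law mE.
Qed.

End Law.

End Configurations.

(** * Intensity of the nuclei and its projection *)

Section NucleiIntensity.
Variables (R : realType) (G : rooted_graph).
Notation F := (fspace (gspace R G)).
Variables (nu : probability (borel F) R) (b xi : R).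
Hypothesis b0 : 0 < b.
Notation Lam := (nuclei_intensity nu (delay_intensity b xi)).

Lemma delay_intensity_ge0 i : 0 <= delay_intensity b xi i.
Proof. by rewrite mulr_ge0 ?powR_ge0 // subr_ge0 ltW // -expR0 ltr_expR. Qed.

Lemma nuclei_intensity_le (A B : set (borel F * int)) : measurable A -> measurable B ->
  A `<=` B -> (Lam A <= Lam B)%E.
Proof.
move=> mA mB AB; apply: le_esum => i _; rewrite lee_wpmul2l ?lee_fin ?delay_intensity_ge0 //.
apply: le_measure; rewrite ?inE; try exact: measurable_ysection.
exact: le_ysection.
Qed.

Lemma nuclei_intensity_layer d : (0 <= Lam (@layer R G d) < +oo)%E.
Proof.
rewrite (_ : Lam _ = (delay_intensity b xi d)%:E) ?lee_fin ?delay_intensity_ge0 ?ltry //.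
rewrite -(@esum_set1 _ _ d (fun d => (delay_intensity b xi d)%:E)) ?lee_fin ?delay_intensity_ge0 //.
rewrite [RHS]esum_mkcond; apply: eq_esum => i _.
have [->|id] := eqVneq i d.
  rewrite mem_set // (_ : ysection _ _ = setT) ?probability_setT ?mule1 //.
  by apply/seteqP; split=> // f _; rewrite /ysection /= inE.
rewrite memNset /=; last by move/eqP; apply/negP.
rewrite (_ : ysection _ _ = set0) ?measure0 ?mule0 //.
by apply/seteqP; split=> // f; rewrite /ysection /= inE /layer /= => e; rewrite e eqxx in id.
Qed.

End NucleiIntensity.

Section Projection.
Variables (R : realType) (G H : rooted_graph) (pi : G -> H).
Hypothesis cG : connected_graph G.
Hypothesis fG : forall n, finite_set (@gball G n).
Notation FG := (fspace (gspace R G)).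
Notation FH := (fspace (gspace R H)).

Definition lift (f : borel FH) : borel FG := fun y : G => (f : FH) (pi y).

Lemma lift_continuous : continuous (lift : FH -> FG).
Proof.
move=> f; have Ff : ProperFilter (nbhs f) := nbhs_pfilter f.
have FF : Filter (lift x @[x --> (f : FH)]) by apply: fmap_filter.
apply/(@fam_cvgP _ _ _ _ _ FF) => A cA P /uniform_nbhs[E [entE EP]].
have [r Ar] := graph_compact_bounded cG cA.
have fA : finite_set (pi @` A) by apply: finite_image; apply: sub_finite_set (fG r) => y /Ar.
have : nbhs f [set h : FH | forall z, (pi @` A) z -> E (f z, h z)].
  by apply: fam_nbhs => //; exact: (@finite_compact (gspace R H)).
by apply: filterS => h Hh; apply: EP => y Ay; apply: Hh; exists y.
Qed.

Lemma lift_measurable : measurable_fun setT (lift : borel FH -> borel FG).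
Proof. exact: borel_continuous_measurable lift_continuous. Qed.

Variables (nuG : probability (borel FG) R) (nuH : probability (borel FH) R) (b xi : R).
Hypothesis nuE : forall A, measurable A -> nuG A = nuH (lift @^-1` A).

(** The mapping property of Poisson processes: preimages of disjoint sets are disjoint and, by
    [nuE], have the same intensity. *)
Lemma poisson_lift d (Om : measurableType d) (P : probability Om R)
    (theta : nat -> Om -> borel FH) (delta : nat -> Om -> int) :
  poisson_process P (nuclei_intensity nuH (delay_intensity b xi))
    (fun i w => (theta i w, delta i w)) ->
  poisson_process P (nuclei_intensity nuG (delay_intensity b xi))
    (fun i w => (lift (theta i w), delta i w)).
Proof.
move=> [mp pp].
pose L (s : borel FH * int) := (lift s.1, s.2).
have mL : measurable_fun setT L.
  apply: measurable_fun_pair; last exact: measurable_snd.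
  exact: measurableT_comp lift_measurable measurable_fst.
have LamE A : measurable A -> nuclei_intensity nuG (delay_intensity b xi) A =
    nuclei_intensity nuH (delay_intensity b xi) (L @^-1` A).
  move=> mA; apply: eq_esum => i _; rewrite nuE; last exact: measurable_ysection.
  by congr (_ * nuH _)%E; apply/seteqP; split=> f; rewrite /ysection /= !inE.
split=> [i|k A mA tA fA n].
  exact: measurableT_comp mL (mp i).
have mLA j : measurable (L @^-1` A j) by rewrite -[X in measurable X]setTI; apply: mL.
under eq_bigr do rewrite LamE //.
apply: (pp k (fun j => L @^-1` A j)) => // [|j]; last by rewrite -LamE.
by move=> i j _ _ [s [Ai Aj]]; apply: tA => //; exists (L s).
Qed.

End Projection.

Section ProjectedTessellation.
Variables (R : realType) (p q : nat) (T T' : htree).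
Hypothesis hp : (2 <= p)%N.
Hypothesis hq : (2 <= q)%N.
Hypothesis hT : regular_tree T p.+1.
Hypothesis hT' : regular_tree T' q.+1.
Notation G := (DL T T').
Variable muT : probability (borel (ends T)) R.
Hypothesis hmuT : harmonic_measure muT.
Variables (nuG : probability (borel (fspace (gspace R G))) R).
Hypothesis nuGE : same_measure nuG (pushforward muT (end_fst R T T')).
Hypothesis readyG : ipvt_ready (ln (p%:R : R)) nuG.

Let cG : connected_graph G.
Proof. by apply: DL_connected hT hT'; exact: ltnW. Qed.
Let fG n : finite_set (@gball G n).
Proof. exact: DL_ball_finite hp hq hT hT' n. Qed.
Let cT : connected_graph T := tree_connected hT.
Let fT n : finite_set (@gball T n) := tree_ball_finite hT n.

(** The preimage of a cell of T is the cell in [DL] of the lifted nuclei. After identification of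
    the indices and boundary measures, both collections are cells of Poisson processes with the same
    intensity. *)
Lemma ipvt_projection (xi : R)
    d1 (Om1 : measurableType d1) (P1 : probability Om1 R) (C1 : nat -> Om1 -> set G)
    d2 (Om2 : measurableType d2) (P2 : probability Om2 R) (C2 : nat -> Om2 -> set T) :
  is_IPVT xi P1 C1 -> is_IPVT xi P2 C2 ->
  eq_collection_law P1 C1 P2 (fun i w => dl_fst @^-1` C2 i w).
Proof.
move=> [b1 [nu1 [th1 [de1 [r1 pp1 bd1 C1E]]]]] [b2 [nu2 [th2 [de2 [r2 pp2 bd2 C2E]]]]].
have [b1E nu1E] := ipvt_ready_unique cG fG r1 readyG.
have mf : measurable_fun setT (@end_fun R T) := end_fun_measurable hT.
have [nuT nuTE] := pushforward_probability muT mf.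
have [b2E nu2E] := ipvt_ready_unique cT fT r2 (tree_ipvt_ready hp hT hmuT nuTE).
have nuE A : measurable A -> nu1 A = nu2 (lift dl_fst @^-1` A).
  move=> mA; rewrite nu1E // nuGE // nu2E ?nuTE //.
  by rewrite -[X in measurable X]setTI; apply: lift_measurable.
have b1_gt0 : 0 < b1 by case: r1.
rewrite b2E -b1E in pp2.
have pp2' := poisson_lift cG fG nuE pp2.
have int1 w i (y : G) : exists c : int, (th1 i w : fspace (gspace R G)) y = c%:~R.
  by apply: (hbar_int cG fG); case: (bd1 i w).
have int2 w i (y : G) : exists c : int, (lift dl_fst (th2 i w) : fspace (gspace R G)) y = c%:~R.
  by apply: (hbar_int cT fT); case: (bd2 i w).
have H := cells_law (nuclei_intensity_le nu1 xi b1_gt0) (nuclei_intensity_layer nu1 xi b1_gt0) pp1 pp2' int1 int2.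
have <- : (fun i w => voronoi_cell (th1^~ w) (de1^~ w) i) = C1.
  by apply/funext => i; apply/funext => w; rewrite C1E.
rewrite (_ : (fun i w => dl_fst @^-1` C2 i w) =
  (fun i w => dl_fst @^-1` voronoi_cell (th2^~ w) (de2^~ w) i)); first exact: H.
by apply/funext => i; apply/funext => w; rewrite C2E.
Qed.

End ProjectedTessellation.

(** * The edge-measured graph *)

Section EdgeMetric.
Variables (R : realType) (G : rooted_graph).
Hypothesis cG : connected_graph G.
Hypothesis iG : irreflexive (@adj G).
Hypothesis nG : forall x : G, exists y, adj x y.
Notation E := (epoint R G).
Notation on_edge := (@on_edge R G).
Notation evertex := (@evertex R G).
Implicit Types (x y u v : G) (z w : E) (f : G -> R).

Definition lipschitz_adj f := forall x y, adj x y -> `|f x - f y| <= 1.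

Definition edge_value f x y (s : R) : R := Num.min (f x + s) (f y + 1 - s).

Let adj_neq x y : adj x y -> x != y.
Proof. by apply: contraTneq => ->; rewrite iG. Qed.

Let baryE x y s v : adj x y ->
  @bary R G x y s v = if v == x then 1 - s else if v == y then s else 0.
Proof.
move=> /adj_neq xy; rewrite /bary; have [->|vx] := eqVneq v x.
  by rewrite (negbTE xy) mulr1 mulr0 addr0.
by case: (v == y); rewrite !(mulr0, mulr1, add0r).
Qed.

(* The value only depends on the barycentric coordinates [a] of the point: it is
   the minimum of [f v + (1 - a v)] over the support of [a]. *)
Let edge_value_min f x y s z : lipschitz_adj f -> on_edge z x y s ->
  (forall v, 0 < sval z v -> edge_value f x y s <= f v + 1 - sval z v) /\
  exists2 v, 0 < sval z v & edge_value f x y s = f v + 1 - sval z v.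
Proof.
move=> lf [xy /andP[s0 s1] ->]; have xny := adj_neq xy; have := lf _ _ xy.
have bx : @bary R G x y s x = 1 - s by rewrite baryE // eqxx.
have by_ : @bary R G x y s y = s by rewrite baryE // eqxx eq_sym (negbTE xny).
rewrite ler_distl => /andP[l1 l2]; split=> [v|].
  rewrite baryE //; case: eqP => [->|_]; first by rewrite /edge_value ge_min => _; apply/orP; left; lra.
  by case: eqP => [->|_]; rewrite ?ltxx // /edge_value ge_min => _; apply/orP; right; lra.
rewrite /edge_value; case: leP => le.
  have [s1'|s1'] := ltP s 1; first by exists x; rewrite bx; lra.
  by exists y; rewrite by_; lra.
have [s0'|s0'] := ltP 0 s; first by exists y; rewrite by_; lra.
by exists x; rewrite bx; lra.
Qed.

Lemma edge_value_unique f x y s x' y' s' z : lipschitz_adj f ->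
  on_edge z x y s -> on_edge z x' y' s' -> edge_value f x y s = edge_value f x' y' s'.
Proof.
move=> lf /(edge_value_min lf)[H [v v0 e]] /(edge_value_min lf)[H' [v' v0' e']].
by apply/eqP; rewrite eq_le {1}e' {2}e H // H'.
Qed.

Lemma on_edge_ex z : exists x y s, on_edge z x y s.
Proof.
case: z => a []; last by move=> [x [y [s [xy s01 e]]]]; exists x, y, s.
move=> [x e]; have [y xy] := nG x; exists x, y, 0; split=> //=; first by rewrite lexx ler01.
by rewrite e; apply/funext => v; rewrite /bary !mul0r !addr0.
Qed.

Lemma extendE f x y s z : lipschitz_adj f -> on_edge z x y s ->
  @extend R G f z = edge_value f x y s.
Proof.
move=> lf ze; rewrite /extend; set A := (X in inf X).
have -> : A = [set edge_value f x y s].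
  apply/seteqP; split=> r; last by move=> ->; exists x, y, s.
  by move=> [x' [y' [s' [ze' ->]]]]; apply: edge_value_unique ze' ze.
by rewrite inf1.
Qed.

Lemma on_edge_evertex x y : adj x y -> on_edge (evertex x) x y 0.
Proof.
by move=> xy; split=> //; [rewrite lexx ler01|apply/funext => v; rewrite /= /bary !mul0r !addr0].
Qed.

Lemma on_edge_evertex1 x y : adj x y -> on_edge (evertex y) x y 1.
Proof.
move=> xy; split=> //; first by rewrite lexx ler01.
by apply/funext => v; rewrite /= /bary subrr subr0 !mul0r !mul1r add0r addr0.
Qed.

Lemma extend_evertex f x : lipschitz_adj f -> @extend R G f (evertex x) = f x.
Proof.
move=> lf; have [y xy] := nG x; rewrite (extendE lf (on_edge_evertex xy)) /edge_value.
by have := lf _ _ xy; rewrite ler_distl => /andP[l1 l2]; rewrite addr0 subr0 (elimT min_idPl).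
Qed.

Lemma edge_value_lipschitz f x y s t : `|edge_value f x y s - edge_value f x y t| <= `|s - t|.
Proof.
rewrite ler_distl /edge_value; have : s - t <= `|s - t| by exact: ler_norm.
have : t - s <= `|s - t| by rewrite distrC ler_norm.
rewrite !minEle.
by case: (leP (f x + s)); case: (leP (f x + t)) => ? ? ? ?; apply/andP; split; lra.
Qed.

(** Along an edge the extension varies at most at unit speed. Hence every such f bounds path lengths
    from below. *)
Lemma extend_chain f z w l : lipschitz_adj f -> chain_length z w l ->
  `|@extend R G f z - @extend R G f w| <= l.
Proof.
move=> lf; elim=> [{}z|{}z u {}w x y s t {}l ze ue _ IH]; first by rewrite subrr normr0.
rewrite (le_trans (ler_distD (@extend R G f u) _ _)) // lerD //.
by rewrite (extendE lf ze) (extendE lf ue) edge_value_lipschitz.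
Qed.

Lemma chain_cat z (u : E) w (l l' : R) : chain_length z u l -> chain_length u w l' ->
  chain_length z w (l + l').
Proof.
move=> c; elim: c w l' => [{}z|{}z v {}u x y s t {}l ze ve _ IH] w l' c'; first by rewrite add0r.
by rewrite -addrA; apply: chain_cons ze ve (IH _ _ c').
Qed.

Lemma chain_segment z (u : E) x y (s t : R) : on_edge z x y s -> on_edge u x y t ->
  chain_length z u `|s - t|.
Proof. by move=> ze ue; have := chain_cons ze ue (chain_nil _); rewrite addr0. Qed.

Lemma chain_sym z w l : chain_length z w l -> chain_length w z l.
Proof.
elim=> [{}z|{}z u {}w x y s t {}l ze ue _ IH]; first exact: chain_nil.
by rewrite addrC; apply: chain_cat IH _; rewrite distrC; apply: chain_segment ue ze.
Qed.

Lemma chain_ge0 z w l : chain_length z w l -> 0 <= l.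
Proof. by elim=> // {}z u {}w x y s t {}l _ _ _ l0; rewrite addr_ge0. Qed.

Lemma chain_gdist x y : chain_length (evertex x) (evertex y) (gdist x y)%:R.
Proof.
have [n] := ubnP (gdist x y); elim: n x => // n IH x; rewrite ltnS => xn.
have [xy|xy] := posnP (gdist x y).
  by move/eqP: (xy); rewrite (gdist_eq0 cG) => /eqP <-; rewrite (gdistxx cG); apply: chain_nil.
have [x' xx' d] := gdist_step cG xy.
rewrite -d -nat1r; apply: chain_cat (IH x' _); last by rewrite -d in xn.
rewrite -[X in chain_length _ _ X](_ : `|0 - 1| = 1); last by rewrite sub0r normrN normr1.
exact: chain_segment (on_edge_evertex xx') (on_edge_evertex1 xx').
Qed.

Lemma lipschitz_gdist x : lipschitz_adj (fun y => (gdist x y)%:R).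
Proof.
move=> u v uv; rewrite ler_distl; have := adj_gdist_le cG x uv; have := adj_gdist_le_sym cG x uv.
rewrite (gdistC cG u) (gdistC cG v) => l1 l2.
by rewrite -!(ler_nat R) -!nat1r in l1 l2; apply/andP; split; lra.
Qed.

Lemma chain_evertex x z : chain_length (evertex x) z (@extend R G (fun y => (gdist x y)%:R) z).
Proof.
have [u [v [s ze]]] := on_edge_ex z; rewrite (extendE (lipschitz_gdist x) ze) /edge_value.
have [uv /andP[s0 s1] _] := ze.
case: leP => _.
  have := chain_cat (chain_gdist x u) (chain_segment (on_edge_evertex uv) ze).
  by rewrite sub0r normrN ger0_norm.
have := chain_cat (chain_gdist x v) (chain_segment (on_edge_evertex1 uv) ze).
by rewrite ger0_norm ?subr_ge0 // addrA.
Qed.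

Let chain_lb z w : lbound [set l | chain_length z w l] 0.
Proof. by move=> l; apply: chain_ge0. Qed.

Lemma chain_ex z w : exists l, chain_length z w l.
Proof.
exists (@extend R G (fun y => (gdist org y)%:R) z + @extend R G (fun y => (gdist org y)%:R) w).
exact: chain_cat (chain_sym (chain_evertex _ _)) (chain_evertex _ _).
Qed.

Lemma edist_ge0 z w : 0 <= Defs.edist z w.
Proof. by apply: lb_le_inf (@chain_lb z w); have [l] := chain_ex z w; exists l. Qed.

Lemma extend_lipschitz f z w : lipschitz_adj f ->
  `|@extend R G f z - @extend R G f w| <= Defs.edist z w.
Proof.
move=> lf; apply: lb_le_inf; first by have [l] := chain_ex z w; exists l.
by move=> l /(extend_chain lf).
Qed.

Lemma edistC z w : Defs.edist z w = Defs.edist w z.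
Proof. by congr inf; apply/seteqP; split=> l /=; apply: chain_sym. Qed.

(** An explicit path through one end of the edge gives the upper bound; the lower bound is the
    Lipschitz property of the right side itself. *)
Lemma edist_evertex x z : Defs.edist (evertex x) z = @extend R G (fun y => (gdist x y)%:R) z.
Proof.
apply/eqP; rewrite eq_le; apply/andP; split.
  by apply: ge_inf (chain_evertex x z); exists 0; apply: chain_lb.
have := extend_lipschitz (evertex x) z (lipschitz_gdist x).
rewrite extend_evertex; last exact: lipschitz_gdist.
by rewrite gdistxx // sub0r normrN; apply: le_trans; apply: ler_norm.
Qed.

Lemma edist_on_edge x u v s z : on_edge z u v s ->
  Defs.edist (evertex x) z = Num.min ((gdist x u)%:R + s) ((gdist x v)%:R + 1 - s).
Proof. by move=> ze; rewrite edist_evertex (extendE (lipschitz_gdist x) ze). Qed.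

Lemma espace_compact_bounded (A : set (espace R G)) : compact A ->
  exists n : nat, forall z, A z -> Defs.edist (evertex org) z <= n%:R.
Proof.
move=> /compact_near_coveringP cA.
have := cA nat \oo (fun n z => Defs.edist (evertex org) z <= n%:R) _.
case=> [z Az|n _ Hn]; last by exists n => z /(Hn n (leqnn n)).
pose M := espace R G.
have zb : Defs.mdist (morg M) z < Defs.edist (evertex org) z + 1 by rewrite ltrDl.
exists ([set z' : M | Defs.mdist (morg M) z' < Defs.edist (evertex org) z + 1],
  [set n | Defs.edist (evertex org) z + 1 <= n%:R]); last first.
  by move=> [z' n] [/= /ltW z'b nb]; apply: le_trans nb.
split; first exact: ball_nbhs zb.
exists (Num.trunc (Defs.edist (evertex org) z + 1)).+1 => // n /= zn.
by rewrite (le_trans (ltW (truncnS_gt _))) // ler_nat; apply: zn.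
Qed.

Section Boundary.
Hypothesis fG : forall n, finite_set (@gball G n).
Notation M := (gspace R G).

Lemma hbar_lipschitz (f : fspace M) : hbar M f -> lipschitz_adj f.
Proof.
move=> [_ [_ lf]] x y xy; rewrite (le_trans (lf x y)) //=.
by rewrite lern1 (adj_gdist1 xy).
Qed.

(** The vertices that approximate f in the graph also work in the edge space: once f agrees with a
    horofunction at both ends of an edge it does so inside, because the minimum commutes with
    subtracting a constant. *)
Lemma extend_hbar (f : fspace M) : hbar M f -> hbar (espace R G) (@extend R G f).
Proof.
move=> hf; have lf := hbar_lipschitz hf; split; last first.
  split=> [|z w]; last exact: extend_lipschitz.
  by rewrite /= extend_evertex //; case: hf => _ [].
have /choice[x fx] : forall n, exists x : M, agree n f (horofun x) by move/(hbarP cG fG): hf.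
pose h n : fspace (espace R G) := horofun (evertex (x n) : espace R G).
suff hc : h n @[n --> \oo] --> (@extend R G f : fspace (espace R G)).
  move=> B /hc[k _ /(_ k (leqnn k)) Bk]; exists (h k); split; last exact: Bk.
  by exists (evertex (x k)).
apply: fspace_cvg => A /espace_compact_bounded[r Ar]; exists r.+1 => // n /= rn z /Ar.
have [u [v [s ze]]] := on_edge_ex z; have [uv /andP[s0 s1] _] := ze.
rewrite (edist_on_edge _ ze) (extendE lf ze) => zr.
have [dl dl'] : (gdist org u <= n)%N /\ (gdist org v <= n)%N.
  have l1 := adj_gdist_le cG org uv; have l2 := adj_gdist_le_sym cG org uv.
  rewrite -!(gdistC cG org) in l1 l2.
  suff [du|dv] : (gdist org u <= r)%N \/ (gdist org v <= r)%N by lia.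
  move: zr; rewrite ge_min => /orP[zr|zr]; [left|right]; rewrite -(ler_nat R); lra.
rewrite /h /horofun /= edistC (edist_on_edge _ ze) edist_evertex extend_evertex; last first.
  exact: lipschitz_gdist.
rewrite /edge_value (fx n) // (fx n) // !horofunE !(gdistC cG (x n)).
by rewrite !minEle; case: leP => ?; case: leP => ?; lra.
Qed.

(** The horofunction of z, even inside an edge, is bounded below by minus the distance of z, whereas
    f is unbounded below on vertices. *)
Lemma extend_boundary : @extend R G @` hboundary M `<=` hboundary (espace R G).
Proof.
move=> _ [f bf <-]; have hf := proj1 bf; split; first exact: extend_hbar.
move=> [z _ ze]; pose d := Defs.edist (evertex org) z.
have [y yd] := hboundary_unbounded cG fG bf (Num.trunc d).+1.
have : @extend R G f (evertex y) = f y := extend_evertex y (hbar_lipschitz hf).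
rewrite -ze /horofun /= -/d => e; have := edist_ge0 (evertex y) z.
by have := truncnS_gt d; rewrite /= in yd; lra.
Qed.

End Boundary.
End EdgeMetric.

(** * Balls and shells of the edge space *)

Section EdgeShells.
Variables (R : realType) (G : rooted_graph).
Hypothesis cG : connected_graph G.
Hypothesis iG : irreflexive (@adj G).
Hypothesis nG : forall x : G, exists y, adj x y.
Hypothesis fG : forall n, finite_set (@gball G n).
Hypothesis bipartite : forall x y : G, adj x y ->
  gdist org x = (gdist org y).+1 \/ gdist org y = (gdist org x).+1.
Implicit Types x y : G.
Notation level x := (gdist org x).

(** As the levels of the ends differ by one, the distance from the root increases linearly along the
    edge and is largest at the further end. *)
Lemma edge_set_ball x y (r : R) : adj x y ->
  (@edge_set R G x y `<=` eball r) <-> (maxn (level x) (level y))%:R <= r.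
Proof.
move=> xy; split=> [H|H z [s ze]].
  have dE (v : G) : Defs.edist (@evertex R G org) (@evertex R G v) = (level v)%:R.
    by rewrite (edist_evertex cG iG nG); apply: (extend_evertex iG nG v (@lipschitz_gdist R G cG org)).
  have xr : (level x)%:R <= r by rewrite -dE; apply: H; exists 0; exact: on_edge_evertex.
  have yr : (level y)%:R <= r by rewrite -dE; apply: H; exists 1; exact: on_edge_evertex1.
  by rewrite /maxn; case: ifP.
have [_ /andP[s0 s1] _] := ze; rewrite /eball /= (edist_on_edge cG iG nG org ze) ge_min.
apply/orP; have [e|e] := bipartite xy; [right|left].
  by move: H; rewrite (maxn_idPl _) e // -nat1r; lra.
by move: H; rewrite (maxn_idPr _) e // -nat1r; lra.
Qed.

Lemma eshellE n : @eshell R G n = [set xy | adj xy.1 xy.2 /\ maxn (level xy.1) (level xy.2) = n].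
Proof.
apply/seteqP; split=> -[x y] /= []; rewrite /eshell /=.
  move=> xy /(edge_set_ball _ xy) le nle; split=> //.
  apply/eqP; rewrite eqn_leq -(ler_nat R) le /= leqNgt; apply/negP => lt; apply: nle.
  by apply/(edge_set_ball _ xy); rewrite lerBrDr natr1 ler_nat.
move=> xy <-; split=> //; first exact/edge_set_ball.
by move=> /(edge_set_ball _ xy); rewrite lerBrDl; lra.
Qed.

(** Arcs are oriented edges, which accounts for the factor 1/2 in [evolumeE]. *)
Definition ball_arcs (n : nat) : set (G * G) :=
  [set xy | adj xy.1 xy.2 /\ (maxn (level xy.1) (level xy.2) <= n)%N].

Lemma ball_arcs_finite n : finite_set (ball_arcs n).
Proof.
apply: sub_finite_set (finite_setX (fG n) (fG n)) => -[x y] [_]; rewrite geq_max.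
by move=> /andP[].
Qed.

(** For an integer radius an edge is either inside the ball or meets it in at most one end, a null
    set. *)
Lemma eball_trace_measure x y n : adj x y ->
  (@lebesgue_measure R) [set s : R | exists2 z, @on_edge R G z x y s & eball n%:R z] =
  (if (maxn (level x) (level y) <= n)%N then 1 else 0)%E.
Proof.
move=> xy; set A := [set s | _].
have AE s : A s -> 0 <= s <= 1 /\ (level x)%:R + s <= n%:R \/ 0 <= s <= 1 /\ (level y)%:R + 1 - s <= n%:R.
  move=> [z ze]; have [_ s01 _] := ze.
  by rewrite /eball /= (edist_on_edge cG iG nG org ze) ge_min => /orP[]; [left|right].
case: ifPn => [le|]; last rewrite -ltnNge => lt.
  rewrite (_ : A = `[0, 1]%classic).
    by rewrite lebesgue_measure_itv /= lte_fin ltr01 oppr0 adde0.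
  apply/seteqP; split=> s; first by move=> [z [_ s01 _] _]; rewrite /= in_itv.
  rewrite /= in_itv /= => s01.
  have H : exists x' y' s', [/\ adj x' y', 0 <= s' <= 1 & @bary R G x y s = bary x' y' s'].
    by exists x, y, s.
  pose z : epoint R G := exist _ (bary x y s) (or_intror H).
  have ze : on_edge z x y s by [].
  exists z => //; have /(edge_set_ball _ xy) : (maxn (level x) (level y))%:R <= n%:R :> R by rewrite ler_nat.
  by apply; exists s.
suff [a /subset_set1[] ->] : exists a, A `<=` [set a].
- by rewrite measure0.
- by rewrite lebesgue_measure_set1.
have [e|e] := bipartite xy.
  exists 1 => s /AE /=; rewrite e (maxn_idPl _) // ltnS in lt.
  move: lt; rewrite -(ler_nat R) e -nat1r.
  by move=> ? [[/andP[? ?] ?]|[/andP[? ?] ?]]; lra.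
exists 0 => s /AE /=; rewrite e (maxn_idPr _) // ltnS in lt.
move: lt; rewrite -(ler_nat R) e -nat1r.
by move=> ? [[/andP[? ?] ?]|[/andP[? ?] ?]]; lra.
Qed.

Lemma evolumeE n : evolume G n%:R = 2^-1 * (ncard (ball_arcs n))%:R :> R.
Proof.
rewrite /evolume /edge_lebesgue.
rewrite (@eq_esum _ _ _ _ (fun xy : G * G => if xy \in ball_arcs n then 1%E else 0%E)); last first.
  move=> [x y] /= xy; rewrite eball_trace_measure //.
  have -> : ((x, y) \in ball_arcs n) = (maxn (level x) (level y) <= n)%N; last by case: ifP.
  by apply/idP/idP => [/set_mem[]|?]; last apply/mem_set.
rewrite -esum_mkcondr (setIidr _); last by move=> xy [].
rewrite esum_fset; [|exact: ball_arcs_finite|by move=> *; rewrite lee_fin ler01].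
rewrite fsbig_finite /=; last exact: ball_arcs_finite.
by rewrite sumEFin /= big_const_seq count_predT iter_addr_0.
Qed.

End EdgeShells.

(** * Arcs between consecutive levels *)

Section ArcAsymptotics.
Variables (R : realType) (p q : nat) (T T' : htree).
Hypotheses (hp : (1 < p)%N) (hq : (1 < q)%N).
Hypotheses (hT : regular_tree T p.+1) (hT' : regular_tree T' q.+1).
Notation G := (DL T T').
Let m := maxn p q.
Let hp0 : (0 < p)%N := ltnW hp.
Let hq0 : (0 < q)%N := ltnW hq.
Let cG : connected_graph G := DL_connected hp0 hq0 hT hT'.
Let fG n : finite_set (@gball G n) := DL_ball_finite hp hq hT hT' n.
Implicit Types x y : G.
Notation level x := (gdist org x).

Lemma DL_bipartite x y : adj x y -> level x = (level y).+1 \/ level y = (level x).+1.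
Proof. by move=> /(DL_adj_dist hp0 hq0 hT hT' org); rewrite !(gdistC cG org). Qed.

(** The negligible set outside which neighbours have the same horofunction near the root. *)
Definition low (r : nat) : set G :=
  [set x | hgt end0 (dl_fst x) < r%:Z /\ hgt end0 (dl_snd x) < r%:Z].

Lemma anc_adj k (U : htree) (hU : regular_tree U k.+1) r (u v : U) : adj u v ->
  (r <= gdist org u)%N -> (r <= gdist org v)%N -> anc r u = anc r v.
Proof.
wlog uv : u v / gdist org u = (gdist org v).+1.
  move=> H a ru rv; have := adj_gdistP hU org a; have sU := tree_sym hU.
  rewrite !(gdistC (tree_connected hU) _ org) => -[e|e]; first exact: H.
  by symmetry; apply: H => //; rewrite sU.
move=> a _ rv; have [d g] := ancP hU rv; apply: (anc_unique hU d).
apply: (geod_trans hU g); rewrite /geod /= uv.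
have : (gdist v u <= 1)%N by apply: (adj_gdist1 (G := U)); rewrite (tree_sym hU).
by have := gdist_triangle (tree_connected hU) org v u; lia.
Qed.

(** The threshold r+1 leaves room for the loss of one unit of height on passing to y; both
    coordinates then have the same ancestor at level r. *)
Lemma adj_agree r x y : adj x y -> ~ low r.+1 x ->
  agree r (horofun (x : gspace R G)) (horofun (y : gspace R G)).
Proof.
move=> xy nlow; have [a a'] := proj1 (DL_adjP x y) xy.
have [h|h] : r.+1%:Z <= hgt end0 (dl_fst x) \/ r.+1%:Z <= hgt end0 (dl_snd x).
- by apply: contrapT => H; apply: nlow; split; rewrite ltNge; apply/negP => ?; apply: H; [left|right].
- have hy : r%:Z <= hgt end0 (dl_fst y) by have := adj_hgt hT end0 a; lia.
  have hx : r%:Z <= hgt end0 (dl_fst x) by lia.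
  apply: (agree_trans (horofun_pat R hp hq hT hT' hx)); apply: agree_sym.
  rewrite (anc_adj hT a); first exact: horofun_pat hp hq hT hT' _ _ hy.
    by have := hgt_lipschitz hT end0 (dl_fst x) org; rewrite (hgt_org hT) (gdistC (tree_connected hT)); lia.
  by have := hgt_lipschitz hT end0 (dl_fst y) org; rewrite (hgt_org hT) (gdistC (tree_connected hT)); lia.
- have hy : r%:Z <= hgt end0 (dl_snd y) by have := adj_hgt hT' end0 a'; lia.
  have hx : r%:Z <= hgt end0 (dl_snd x) by lia.
  apply: (agree_trans (@horofun_pat_snd R p q T T' hp hq hT hT' r x hx)); apply: agree_sym.
  rewrite (anc_adj hT' a'); first exact: horofun_pat_snd hp hq hT hT' _ _ hy.
    by have := hgt_lipschitz hT' end0 (dl_snd x) org; rewrite (hgt_org hT') (gdistC (tree_connected hT')); lia.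
  by have := hgt_lipschitz hT' end0 (dl_snd y) org; rewrite (hgt_org hT') (gdistC (tree_connected hT')); lia.
Qed.

Lemma low_cvg r : (0 < r)%N ->
  (ncard (@gball G n `&` low r))%:R / m%:R ^+ n @[n --> \oo] --> (0 : R).
Proof.
move=> r0; have t0 k (U : htree) : tree_frac R k (set0 : set U) r = 0.
  by rewrite /tree_frac (_ : [set u : U | _] = set0) ?ncard0 ?mul0r //; apply/seteqP; split=> u [].
have := @DL_count_cvg R p q T T' hp hq hT hT' (low r) set0 set0 r r0.
rewrite !t0 !mulr0 addr0; apply => x h; split=> //.
- by move=> []; rewrite ltNge h.
- by move=> [_]; rewrite ltNge h.
Qed.

Definition up_arcs (n : nat) (Q Q' : set G) : set (G * G) :=
  [set xy | [/\ adj xy.1 xy.2, level xy.1 = n, level xy.2 = n.+1, Q xy.1 & Q' xy.2]].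

Lemma up_arcs_finite n Q Q' : finite_set (up_arcs n Q Q').
Proof.
apply: sub_finite_set (finite_setX (fG n.+1) (fG n.+1)) => -[x y] [/= _ dx dy _ _].
by split; rewrite /gball /= ?dx ?dy.
Qed.

Lemma up_arcs_le n Q Q' : (ncard (up_arcs n Q Q') <= (p + q) * ncard (@gball G n `&` Q))%N.
Proof.
have fA : finite_set (@gball G n `&` Q) by apply: finite_setIl.
have [fS cS] := ncard_sigma (B := fun x => nbr_set x) fA (fun x _ => proj1 (DL_nbr hp hq hT hT' x)).
apply: leq_trans (ncard_le fS _) _; first by move=> [x y] [/= xy dx _ Qx _]; split=> //; split=> //; rewrite /gball /= dx.
rewrite cS (eq_bigr (fun=> (p + q)%N)); last by move=> x _; apply: (proj2 (DL_nbr hp hq hT hT' x)).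
by rewrite big_const_seq count_predT iter_addn_0.
Qed.

Section Limit.
Variables (r : nat) (Q : set G) (W : R).
Hypothesis Qcvg : (ncard (@gball G n `&` Q))%:R / m%:R ^+ n @[n --> \oo] --> W.
Hypothesis Qadj : forall x y, adj x y -> ~ low r.+1 x -> Q x -> Q y.
Hypothesis Qadj' : forall x y, adj x y -> ~ low r.+1 x -> Q y -> Q x.

Let mR : 0 < m%:R :> R. Proof. by rewrite ltr0n /m; lia. Qed.
Let mN : m%:R != 0 :> R. Proof. by rewrite lt0r_neq0. Qed.

(** Bounds the number of arcs from level n to n+1 that start in [low r.+1]; every other such arc has
    both ends in Q or none. *)
Let bad n := ((p + q) * ncard (@gball G n `&` low r.+1))%N.

Let bad_cvg : (bad n)%:R / m%:R ^+ n @[n --> \oo] --> (0 : R).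
Proof.
rewrite -(mulr0 (p + q)%:R); under eq_fun do rewrite /bad natrM -mulrA.
exact: cvgMr (low_cvg (ltn0Sn r)).
Qed.

Lemma up_arcs_agree n : (ncard (up_arcs n Q setT) - bad n <= ncard (up_arcs n Q Q) <= ncard (up_arcs n Q setT))%N.
Proof.
apply/andP; split; last by apply: ncard_le (up_arcs_finite _ _ _) _ => -[x y] [].
rewrite leq_subLR (leq_trans _ (leq_add (up_arcs_le n (low r.+1) setT) (leqnn _))) //.
apply: leq_trans (ncardU_le (up_arcs_finite _ _ _) (up_arcs_finite _ _ _)).
apply: ncard_le => [|[x y] [/= xy dx dy Qx _]].
  by rewrite finite_setU; split; apply: up_arcs_finite.
by have [l|nl] := pselect (low r.+1 x); [left|right; split=> //; apply: Qadj xy nl Qx].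
Qed.

Let down_arcs n := [set xy : G * G | [/\ adj xy.1 xy.2, level xy.1 = n.+1, level xy.2 = n & Q xy.1]].

Let down_finite n : finite_set (down_arcs n).
Proof.
apply: sub_finite_set (finite_setX (fG n.+1) (fG n.+1)) => -[x y] [/= _ dx dy _].
by split; rewrite /gball /= ?dx ?dy.
Qed.

Let down_up n : ncard (down_arcs n) = ncard (up_arcs n setT Q).
Proof.
apply: (@ncard_bij _ _ (fun xy : G * G => (xy.2, xy.1))); first exact: up_arcs_finite.
  by move=> [x y] [x' y'] _ _ /= [-> ->].
have sG : symmetric (@adj G) by case: cG.
apply/seteqP; split=> [_ [[x y] [/= xy dx dy _ Qy] <-]|[x y] [/= xy dx dy Qx]].
  by split=> //; rewrite sG.
by exists (y, x) => //; split=> //; rewrite sG.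
Qed.

Let down_bound n : (ncard (down_arcs n) <= ncard (up_arcs n Q setT) + bad n)%N /\
  (ncard (up_arcs n Q setT) <= ncard (down_arcs n) + bad n)%N.
Proof.
have H (A B : set G) : (forall x y, adj x y -> ~ low r.+1 x -> A x /\ B y -> Q x /\ Q y) ->
    (ncard (up_arcs n A B) <= ncard (up_arcs n Q Q) + bad n)%N.
  move=> HAB; apply: leq_trans (leq_add (leqnn _) (up_arcs_le n (low r.+1) setT)).
  apply: leq_trans (ncardU_le (up_arcs_finite _ _ _) (up_arcs_finite _ _ _)).
  apply: ncard_le => [|[x y] [/= xy dx dy Ax By]].
    by rewrite finite_setU; split; apply: up_arcs_finite.
  have [l|nl] := pselect (low r.+1 x); first by right.
  by left; have [] := HAB _ _ xy nl (conj Ax By); split.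
rewrite down_up; split.
  rewrite (leq_trans (H setT Q _)) ?leq_add2r //; first by move=> x y xy nl [_ Qy]; split=> //; apply: Qadj' xy nl Qy.
  by apply: ncard_le (up_arcs_finite _ _ _) _ => -[x y] [].
rewrite (leq_trans (H Q setT _)) ?leq_add2r //; first by move=> x y xy nl [Qx _]; split=> //; apply: Qadj xy nl Qx.
by apply: ncard_le (up_arcs_finite _ _ _) _ => -[x y] [].
Qed.

Let sphere n := [set x : G | level x = n /\ Q x].

(** Each of the p + q arcs at a vertex leads one level up or one level down. *)
Let sphere_split n : (ncard (up_arcs n.+1 Q setT) + ncard (down_arcs n) = (p + q) * ncard (sphere n.+1))%N.
Proof.
have fS : finite_set (sphere n.+1) by apply: sub_finite_set (fG n.+1) => x [dx _]; rewrite /gball /= dx.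
have [fA cA] := ncard_sigma (B := fun x => nbr_set x) fS (fun x _ => proj1 (DL_nbr hp hq hT hT' x)).
rewrite mulnC (_ : (_ * (p + q))%N = ncard [set xy | sphere n.+1 xy.1 /\ nbr_set xy.1 xy.2]); last first.
  rewrite cA (eq_bigr (fun=> (p + q)%N)); last by move=> x _; apply: (proj2 (DL_nbr hp hq hT hT' x)).
  by rewrite big_const_seq count_predT iter_addn_0 mulnC.
rewrite -ncardU; [|exact: up_arcs_finite|exact: down_finite|]; last first.
  by apply/seteqP; split=> // -[x y] [[/= _ dx dy _ _] [/= _ _ dy' _]]; rewrite dy in dy'; lia.
congr ncard; apply/seteqP; split=> -[x y] /=.
  by move=> [[/= xy dx _ Qx _]|[/= xy dx _ Qx]].
move=> [[dx Qx] xy]; have := DL_bipartite xy; rewrite dx => -[[dy]|dy]; first by right.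
by left.
Qed.

Let sphere_cvg : (ncard (sphere n.+1))%:R / m%:R ^+ n.+1 @[n --> \oo] --> W * (1 - m%:R^-1).
Proof.
have e n : (ncard (sphere n.+1))%:R / m%:R ^+ n.+1 = (ncard (@gball G n.+1 `&` Q))%:R / m%:R ^+ n.+1 -
    m%:R^-1 * ((ncard (@gball G n `&` Q))%:R / m%:R ^+ n) :> R.
  have -> : ncard (@gball G n.+1 `&` Q) = (ncard (@gball G n `&` Q) + ncard (sphere n.+1))%N.
    rewrite -ncardU; [|exact: finite_setIl| |]; last 2 first.
    - by apply: sub_finite_set (fG n.+1) => x [dx _]; rewrite /gball /= dx.
    - by apply/seteqP; split=> // x [[/= + _] [/= dx _]]; rewrite /gball /= dx ltnn.
    congr ncard; apply/seteqP; split=> x /=; rewrite /gball /=.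
      by rewrite leq_eqVlt ltnS => -[/orP[/eqP dx|dx] Qx]; [right|left].
    by move=> [[dx Qx]|[dx Qx]]; split=> //; rewrite ?dx // leqW.
  by rewrite natrD exprS; field; rewrite mN expf_neq0.
under eq_fun do rewrite e; rewrite mulrBr mulr1 (mulrC W).
apply: cvgB; first by rewrite (cvg_shiftS (fun n => (ncard (@gball G n `&` Q))%:R / m%:R ^+ n : R)).
exact: cvgMr Qcvg.
Qed.

(* With kappa for this number: an arc between the levels n and n+1 is seen from
   both ends, so that kappa + kappa / m = (p + q) (1 - 1 / m), where the right
   side is the degree times the share of the sphere in the ball. *)
Definition arc_density : R := (p + q)%:R * (1 - m%:R^-1) / (1 + m%:R^-1).

(** Arcs going down from level n+1 are, up to [bad n], reversed arcs going up from level n, so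
    [sphere_split] is a recurrence for the normalized number of up-arcs. *)
Lemma up_arcs_cvg : (ncard (up_arcs n Q setT))%:R / m%:R ^+ n @[n --> \oo] --> arc_density * W.
Proof.
pose a n := (ncard (up_arcs n Q setT))%:R / m%:R ^+ n : R.
pose d n := ((ncard (down_arcs n))%:R - (ncard (up_arcs n Q setT))%:R) / m%:R ^+ n : R.
have d0 : d n @[n --> \oo] --> 0.
  apply/cvgr0Pnorm_le => e e0; have /cvgr0Pnorm_le/(_ _ e0) := bad_cvg.
  apply: filterS => n; apply: le_trans; rewrite /d !normrM ler_wpM2r //.
  have [l1 l2] := down_bound n; rewrite -!(ler_nat R) !natrD in l1 l2.
  by rewrite (ger0_norm (ler0n _ _)) ler_distl; apply/andP; split; lra.
pose c := m%:R^-1 : R.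
pose y n := (p + q)%:R * ((ncard (sphere n.+1))%:R / m%:R ^+ n.+1) - c * d n.
have rec n : a n.+1 = - c * a n + y n.
  rewrite /a /y /c /d; have /(congr1 (fun k => k%:R : R)) := sphere_split n.
  rewrite natrD natrM => e.
  have -> : (ncard (up_arcs n.+1 Q setT))%:R = (p + q)%:R * (ncard (sphere n.+1))%:R - (ncard (down_arcs n))%:R :> R by lra.
  by rewrite exprS; field; rewrite mN expf_neq0.
have yc : y n @[n --> \oo] --> (p + q)%:R * (W * (1 - c)) - c * 0.
  by apply: cvgB; apply: cvgMr => //; exact: sphere_cvg.
have c01 : 0 <= c ^+ 2 < 1.
  rewrite exprn_ge0 ?invr_ge0 ?ler0n //= expr_lt1 ?invr_ge0 ?ler0n //.
  by rewrite invf_lt1 // ltr1n /m; lia.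
have c1 : 0 < 1 - c ^+ 2 by lra.
have c0 : 0 < c by rewrite invr_gt0.
(* The coefficient -c of the recurrence is negative; two steps give the coefficient c^2, to which
   the contraction lemma applies. *)
have rec2 n : a n.+2 = c ^+ 2 * a n + (y n.+1 - c * y n) by rewrite !rec; ring.
have y2 : y n.+1 - c * y n @[n --> \oo] --> ((p + q)%:R * (W * (1 - c)) - c * 0) - c * ((p + q)%:R * (W * (1 - c)) - c * 0).
  by apply: cvgB; [rewrite (cvg_shiftS y)|apply: cvgMr].
have := cvg_contraction2 c01 rec2 y2.
congr (_ --> _); rewrite /arc_density -/c; field.
by apply/andP; split; nra.
Qed.

Lemma up_arcs_agree_cvg : (ncard (up_arcs n Q Q))%:R / m%:R ^+ n @[n --> \oo] --> arc_density * W.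
Proof.
apply: (squeeze_cvgr (f := fun n => (ncard (up_arcs n Q setT))%:R / m%:R ^+ n - (bad n)%:R / m%:R ^+ n)
  (h := fun n => (ncard (up_arcs n Q setT))%:R / m%:R ^+ n)); last 2 first.
- by rewrite -[arc_density * W]subr0; apply: cvgB up_arcs_cvg bad_cvg.
- exact: up_arcs_cvg.
near=> n; have /andP[l1 l2] := up_arcs_agree n.
rewrite -mulrBl !ler_pM2r ?invr_gt0 ?exprn_gt0 //; apply/andP; split; last by rewrite ler_nat.
by rewrite lerBlDr -natrD ler_nat addnC -leq_subLR.
Unshelve. all: by end_near. Qed.

End Limit.

End ArcAsymptotics.

(** * Limit law of the endpoints of a random edge *)

Lemma resolution_prod (X Y : topologicalType) (K : set X) (L : set Y)
    (D : nat -> X -> X -> Prop) (E : nat -> Y -> Y -> Prop) :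
  resolution K D -> resolution L E ->
  resolution (K `*` L) (fun r x y => D r x.1 y.1 /\ E r x.2 y.2).
Proof.
move=> rK rL; split.
- by move=> r x; split; [apply: (res_refl rK)|apply: (res_refl rL)].
- by move=> r x y [xy xy']; split; [apply: (res_sym rK)|apply: (res_sym rL)].
- move=> r x y z [xy xy'] [yz yz']; split.
    exact: (res_trans rK) xy yz.
  exact: (res_trans rL) xy' yz'.
- move=> r r' x y rr [xy xy']; split; first exact: (res_le rK) rr xy.
  exact: (res_le rL) rr xy'.
- move=> [x x'] V [/= Kx Lx'] [[U U'] /= [nU nU'] UV].
  have [r Hr] := res_nbhs rK Kx nU; have [r' Hr'] := res_nbhs rL Lx' nU'.
  exists (maxn r r') => -[y y'] [/= Ky Ly'] [/= xy xy']; apply: UV; split=> /=.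
    by apply: Hr => //; apply: (res_le rK) xy; exact: leq_maxl.
  by apply: Hr' => //; apply: (res_le rL) xy'; exact: leq_maxr.
- move=> r [x x'] [/= Kx Lx'].
  exists ([set y | K y -> D r x y], [set y | L y -> E r x' y]).
    by split; [apply: (res_open rK)|apply: (res_open rL)].
  by move=> [y y'] [/= Dy Ey] [/= Ky Ly]; split; [apply: Dy|apply: Ey].
Qed.

Lemma closed_setX (X Y : topologicalType) (A : set X) (B : set Y) :
  closed A -> closed B -> closed (A `*` B).
Proof.
move=> cA cB; rewrite (_ : A `*` B = (fst @^-1` A) `&` (snd @^-1` B)) //.
apply: closedI; apply: closed_comp => // x _; [exact: cvg_fst|exact: cvg_snd].
Qed.

Section EdgeLimit.
Variables (R : realType) (p q : nat) (T T' : htree).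
Hypotheses (hp : (1 < p)%N) (hq : (1 < q)%N).
Hypotheses (hT : regular_tree T p.+1) (hT' : regular_tree T' q.+1).
Notation G := (DL T T').
Let m := maxn p q.
Let hp0 : (0 < p)%N := ltnW hp.
Let hq0 : (0 < q)%N := ltnW hq.
Let cG : connected_graph G := DL_connected hp0 hq0 hT hT'.
Let fG n : finite_set (@gball G n) := DL_ball_finite hp hq hT hT' n.
Implicit Types x y : G.
Notation M := (gspace R G).
Notation F := (fspace M).
Notation level x := (gdist org x).

Lemma DL_irr : irreflexive (@adj G).
Proof. by move=> x; apply/negP => /(DL_bipartite hp hq hT hT')[]; lia. Qed.

Lemma DL_nonisolated x : exists y, adj x y.
Proof.
have [fx cx] := DL_nbr hp hq hT hT' x; apply: contrapT => none.
have : (0 < ncard (nbr_set x))%N by rewrite cx; lia.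
by rewrite (_ : nbr_set x = set0) ?ncard0 //; apply/seteqP; split=> // y xy; apply: none; exists y.
Qed.

Let bip := @DL_bipartite p q T T' hp hq hT hT'.

Let m0 : (0 < m)%N. Proof. by rewrite /m; lia. Qed.
Let mR : 0 < m%:R :> R. Proof. by rewrite ltr0n. Qed.
Let mN : m%:R != 0 :> R. Proof. by rewrite lt0r_neq0. Qed.

Lemma DL_eshell_finite n : finite_set (@eshell R G n).
Proof.
rewrite (eshellE _ cG DL_irr DL_nonisolated bip).
apply: sub_finite_set (ball_arcs_finite fG n) => xy [a <-]; split=> //.
Qed.

Lemma ncard_eshell n (A B : set G) :
  ncard (@eshell R G n.+1 `&` [set xy | A xy.1 /\ B xy.2]) =
  (ncard (up_arcs n A B) + ncard (up_arcs n B A))%N.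
Proof.
have sG : symmetric (@adj G) by case: cG.
have fU := up_arcs_finite hp hq hT hT' n.
have -> : ncard (up_arcs n B A) = ncard [set xy : G * G | up_arcs n B A (xy.2, xy.1)].
  symmetry; apply: (@ncard_bij _ _ (fun xy : G * G => (xy.2, xy.1))); first exact: fU.
    by move=> [x y] [x' y'] _ _ /= [-> ->].
  by apply/seteqP; split=> [_ [[x y] H <-]//|[x y] H]; exists (y, x).
rewrite -ncardU; [|exact: fU| |]; last 2 first.
- have := finite_image (fun xy : G * G => (xy.2, xy.1)) (fU B A).
  by apply: sub_finite_set => -[x y] H; exists (y, x).
- apply/seteqP; split=> // -[x y] [[/= _ dx dy _ _] [/= _ dy' dx' _ _]].
  by rewrite dx in dx'; lia.
congr ncard; rewrite (eshellE _ cG DL_irr DL_nonisolated bip).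
apply/seteqP; split=> -[x y].
  move=> [[/= xy dn] [Ax By]]; have [e|e] := bip xy; rewrite e in dn.
    right; have dy : level y = n by move: dn; rewrite (maxn_idPl _) // => -[].
    have yx : adj y x by rewrite sG.
    by split=> //; rewrite /= e dy.
  left; have dx : level x = n by move: dn; rewrite (maxn_idPr _) // => -[].
  by split=> //; rewrite /= ?e ?dx.
move=> [[/= xy dx dy Ax By]|[/= yx dy dx By Ax]].
  by split=> //; split=> //=; rewrite dx dy (maxn_idPr _).
have xy : adj x y by rewrite sG.
have mx : maxn (level x) (level y) = n.+1 by move: dx dy => /= -> ->; rewrite (maxn_idPl _).
by split.
Qed.

Lemma eshell_cvg : (ncard (@eshell R G n.+1))%:R / m%:R ^+ n @[n --> \oo] -->
  2 * arc_density R p q * total_weight R p q.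
Proof.
have c := @up_arcs_cvg R p q T T' hp hq hT hT' 0 setT (total_weight R p q) _ (fun _ _ _ _ => id) (fun _ _ _ _ => id).
rewrite mulrAC -mulrA; under eq_fun => n.
  rewrite -[@eshell R G _]setIT (_ : setT = [set xy : G * G | setT xy.1 /\ setT xy.2]); last first.
    by apply/seteqP; split.
  rewrite ncard_eshell addnn -mul2n natrM -mulrA; over.
apply: cvgMr; rewrite mulrC; apply: c.
under eq_fun do rewrite setIT.
exact: DL_ball_cvg hp hq hT hT'.
Qed.

Lemma arc_density_gt0 : 0 < arc_density R p q.
Proof.
have m1 : m%:R^-1 < 1 :> R by rewrite invf_lt1 // ltr1n /m; lia.
have m2 : 0 < m%:R^-1 :> R by rewrite invr_gt0.
rewrite /arc_density -/m divr_gt0 ?mulr_gt0 ?ltr0n //; first [lia|lra].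
Qed.

Lemma eshell_limit_gt0 : 0 < 2 * arc_density R p q * total_weight R p q.
Proof.
by rewrite mulr_gt0 ?(total_weight_gt0 R hp hq) // mulr_gt0 // arc_density_gt0.
Qed.

Lemma DL_edge_growth : log_regularly_varying (fun n : nat => evolume G n%:R : R) (ln (m%:R : R)).
Proof.
pose V n := (ncard (@ball_arcs G n))%:R / m%:R ^+ n : R.
pose E n := (ncard (@eshell R G n.+1))%:R / m%:R ^+ n : R.
have rec n : V n.+1 = m%:R^-1 * V n + m%:R^-1 * E n.
  rewrite /V /E (_ : ncard (@ball_arcs G n.+1) = ncard (@ball_arcs G n) + ncard (@eshell R G n.+1))%N.
    by rewrite natrD exprS; field; rewrite mN expf_neq0.
  rewrite (eshellE _ cG DL_irr DL_nonisolated bip) -ncardU; [|exact: ball_arcs_finite| |]; last 2 first.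
  - by apply: sub_finite_set (ball_arcs_finite fG n.+1) => xy [a <-].
  - by apply/seteqP; split=> // xy [[_ le] [_ e]]; rewrite e ltnn in le.
  congr ncard; apply/seteqP; split=> xy.
    by move=> [a]; rewrite leq_eqVlt ltnS => /orP[/eqP e|le]; [right|left].
  by move=> [[a le]|[a e]]; split=> //; [exact: leqW|rewrite e].
have Ec : m%:R^-1 * E n @[n --> \oo] --> m%:R^-1 * (2 * arc_density R p q * total_weight R p q).
  exact: cvgMr eshell_cvg.
have m1 : (1 < m)%N by rewrite /m; lia.
have Vc := cvg_contraction (natr_invlt1 R m1) rec Ec.
have c : 2^-1 * V n @[n --> \oo] --> 2^-1 * (m%:R^-1 * (2 * arc_density R p q * total_weight R p q) / (1 - m%:R^-1)).
  exact: cvgMr Vc.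
apply: (ratio_growth (l := 2^-1 * (m%:R^-1 * (2 * arc_density R p q * total_weight R p q) / (1 - m%:R^-1)))) => //.
  have /andP[_ lt1] := natr_invlt1 R m1.
  by rewrite mulr_gt0 ?invr_gt0 // divr_gt0 ?subr_gt0 // mulr_gt0 ?eshell_limit_gt0 // invr_gt0.
apply: cvg_trans c; apply: near_eq_cvg; near=> n.
by rewrite (evolumeE R cG DL_irr DL_nonisolated fG bip) /V mulrA.
Unshelve. all: by end_near. Qed.

Variables (muT : probability (borel (ends T)) R) (muT' : probability (borel (ends T')) R).
Hypotheses (hmuT : harmonic_measure muT) (hmuT' : harmonic_measure muT').
Variable nu0 : probability (borel F) R.
Hypothesis nu0E : forall A, nu0 A = ((fst_share R p q)%:E * pushforward muT (end_fst R T T') A +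
  (1 - fst_share R p q)%:E * pushforward muT' (end_snd R T T') A)%E.

(** If f and g agree up to r, both ends of the arc have to lie in the same class. Otherwise only
    arcs starting in [low r.+1] can contribute, and the limit is 0: the mass concentrates on the
    diagonal. *)
Lemma up_arcs_class_cvg (f g : F) r : (0 < r)%N ->
  (ncard (up_arcs n [set x : G | agree r f (horofun (x : M))]
                    [set x : G | agree r g (horofun (x : M))]))%:R / m%:R ^+ n @[n --> \oo] -->
  arc_density R p q * total_weight R p q * fine (nu0 (hbar M `&` [set h | agree r f h /\ agree r g h])).
Proof.
move=> r0; have [fg|nfg] := pselect (agree r f g).
  have eqfg h : agree r g h <-> agree r f h.
    by split=> H; [exact: (agree_trans fg H)|exact: (agree_trans (agree_sym fg) H)].
  have -> : [set x : G | agree r g (horofun (x : M))] = [set x : G | agree r f (horofun (x : M))].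
    by apply/seteqP; split=> x /eqfg.
  have -> : [set h | agree r f h /\ agree r g h] = [set h | agree r f h].
    by apply/seteqP; split=> h; [move=> []|move=> H; split=> //; apply/eqfg].
  rewrite -mulrA.
  apply: (@up_arcs_agree_cvg R p q T T' hp hq hT hT' r).
  - exact: (@DL_agree_cvg R p q T T' hp hq hT hT' muT muT' hmuT hmuT' nu0 nu0E f r r0).
  - by move=> x y xy nl fx; exact: (agree_trans fx (adj_agree R hp hq hT hT' xy nl)).
  - by move=> x y xy nl fx; exact: (agree_trans fx (agree_sym (adj_agree R hp hq hT hT' xy nl))).
rewrite (_ : hbar M `&` _ = set0); last first.
  by apply/seteqP; split=> // h [_ [fh gh]]; apply: nfg; apply: agree_trans fh (agree_sym gh).
rewrite measure0 /= mulr0.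
have c : (p + q)%:R * ((ncard (@gball G n `&` low r.+1))%:R / m%:R ^+ n) @[n --> \oo] --> (0 : R).
  by rewrite -[X in _ --> X](mulr0 (p + q)%:R); apply: cvgMr; exact: (low_cvg hp hq hT hT' (ltn0Sn r)).
apply: (squeeze_cvgr (f := fun=> 0) _ (cvg_cst _) c); near=> n.
rewrite divr_ge0 ?exprn_ge0 ?ler0n //= mulrA ler_pM2r ?invr_gt0 ?exprn_gt0 // -natrM ler_nat.
rewrite -/m; apply: leq_trans (up_arcs_le hp hq hT hT' n (low r.+1) setT); apply: ncard_le.
  exact: (up_arcs_finite hp hq hT hT').
move=> [x y] [/= xy dx dy fx gy]; split=> //=; apply: contrapT => nl; apply: nfg.
exact: (agree_trans fx (agree_trans (adj_agree R hp hq hT hT' xy nl) (agree_sym gy))).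
Unshelve. all: by end_near. Qed.

Lemma alpha_cvg (alpha : probability (borel (F * F)%type) R) :
  (forall A, alpha A = nu0 [set h | A (h, h)]) ->
  weak_cvg (hbar M `*` hbar M) (@alpha_ R G) alpha.
Proof.
move=> alphaE.
have res := resolution_prod (@hbar_resolution R G cG fG) (@hbar_resolution R G cG fG).
have clK := closed_setX (@hbar_closed R G cG fG) (@hbar_closed R G cG fG).
have cK := compact_setX (@hbar_compact R G cG fG) (@hbar_compact R G cG fG).
apply: (weak_cvg_of_classes cK clK res (mu := @alpha_ R G) (nu := alpha)).
- by move=> n; apply: uniform_law_le1; exact: DL_eshell_finite.
- by apply: probability_le1; apply: borel_closed.
move=> r [f0 g0]; pose f : F := f0; pose g : F := g0; rewrite -/f -/g => -[/= hf hg].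
pose L := 2 * arc_density R p q * total_weight R p q.
have L0 : L != 0 by rewrite lt0r_neq0 ?eshell_limit_gt0.
(* Shell n+1 consists of the arcs between the levels n and n+1, in both orientations; hence the
   shift and the sum of two limits below. *)
rewrite -(cvg_shiftS (fun n => fine (@alpha_ R G n (rclass _ _ r (f, g))))).
have c := cvgM (cvgD (@up_arcs_class_cvg f g r.+1 isT) (@up_arcs_class_cvg g f r.+1 isT)) (cvgV L0 eshell_cvg).
have -> : fine (alpha (rclass (hbar M `*` hbar M)
    (fun r u v => same_upto r u.1 v.1 /\ same_upto r u.2 v.2) r (f, g))) =
  fine (nu0 (hbar M `&` [set h | agree r.+1 f h /\ agree r.+1 g h])).
  by rewrite alphaE; congr (fine (nu0 _)); apply/seteqP; split=> h; [move=> [[]]|move=> []].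
move: c; rewrite (_ : [set h | agree r.+1 g h /\ agree r.+1 f h] = [set h | agree r.+1 f h /\ agree r.+1 g h]).
  set N := fine _.
  rewrite (_ : (_ + _) * L^-1 = N); last first.
    have /andP[a0 w0] : (arc_density R p q != 0) && (total_weight R p q != 0).
      by rewrite !lt0r_neq0 ?arc_density_gt0 ?total_weight_gt0.
    by rewrite /L; field; rewrite w0 a0.
  set h := (X in X @ \oo --> N) => c.
  suff -> : (fun n => fine (@alpha_ R G n.+1 (rclass (hbar M `*` hbar M)
      (fun r u v => same_upto r u.1 v.1 /\ same_upto r u.2 v.2) r (f, g)))) = h by exact: c.
  apply/funext => n; rewrite /h /alpha_ uniform_lawE /=; last exact: DL_eshell_finite.
  rewrite (_ : @eshell R G n.+1 `&` _ = @eshell R G n.+1 `&`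
    [set xy | [set x : G | agree r.+1 f (horofun (x : M))] xy.1 /\ [set x : G | agree r.+1 g (horofun (x : M))] xy.2]).
    rewrite ncard_eshell natrD invfM invrK -mulrDl mulrACA mulVf ?mulr1 // expf_neq0 //.
  apply/seteqP; split=> -[x y] [exy] /=; first by move=> [].
  by move=> H; split=> //; split=> //; split; apply: horofun_hbar.
by apply/seteqP; split=> h [].
Unshelve. all: by end_near. Qed.

End EdgeLimit.

Theorem theorem1p7 (R : realType) (p q : nat) (hp : (2 <= p)%N)
  (hq : (2 <= q)%N) (T T' : htree) (hT : regular_tree T p.+1)
  (hT' : regular_tree T' q.+1)
  (muT : probability (borel (ends T)) R) (hmuT : harmonic_measure muT)
  (muT' : probability (borel (ends T')) R) (hmuT' : harmonic_measure muT') :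
  let G := DL T T' in
  let dG := hboundary (gspace R G) in
  exists (b : R) (nu0 : probability (borel (fspace (gspace R G))) R),
    [/\ ipvt_ready b nu0,
        (q <= p)%N -> b = ln (p%:R : R),
        (q < p)%N ->
          [/\ range (end_fst R T T') `<=` dG,
              nu0 (range (end_fst R T T')) = 1%E,
              same_measure nu0 (pushforward muT (end_fst R T T')) &
              forall xi : R, exists xi' : R,
                forall d1 (Omega1 : measurableType d1)
                  (P1 : probability Omega1 R) (C1 : nat -> Omega1 -> set G)
                  d2 (Omega2 : measurableType d2)
                  (P2 : probability Omega2 R) (C2 : nat -> Omega2 -> set T),
                  is_IPVT xi P1 C1 -> is_IPVT xi' P2 C2 ->
                  eq_collection_law P1 C1
                    P2 (fun i w => dl_fst @^-1` C2 i w)],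
        p = q ->
          [/\ range (end_fst R T T') `<=` dG, range (end_snd R T T') `<=` dG &
              forall A, measurable A ->
                nu0 A = (2^-1%:E * (pushforward muT (end_fst R T T') A +
                                    pushforward muT' (end_snd R T T') A))%E] &
        (q <= p)%N ->
          [/\ log_regularly_varying (fun n : nat => evolume G n%:R) (ln (p%:R : R)),
              @extend R G @` dG `<=` hboundary (espace R G) &
              exists2 alpha : probability
                  (borel (fspace (gspace R G) * fspace (gspace R G))%type) R,
                alpha (dG `*` dG) = 1%E /\
                weak_cvg (hbar (gspace R G) `*` hbar (gspace R G))
                  (@alpha_ R G) alpha &
                forall t : R, 0 <= t < 1 ->
                  same_measure (nu_ alpha t) (pushforward nu0 (@extend R G))]].
Proof.
move=> G dG.
have cG : connected_graph G by apply: DL_connected hT hT'; exact: ltnW.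
have fG n : finite_set (@gball G n) := DL_ball_finite hp hq hT hT' n.
have mf : measurable_fun setT (end_fst R T T') by exact: end_fst_measurable hp hq hT hT'.
have ms : measurable_fun setT (end_snd R T T') by exact: end_snd_measurable hp hq hT hT'.
have [N1 N1E] := pushforward_probability muT mf.
have [N2 N2E] := pushforward_probability muT' ms.
have share01 : 0 <= fst_share R p q <= 1.
  have W := total_weight_gt0 R hp hq; rewrite /fst_share; apply/andP; split.
    by rewrite divr_ge0 ?(ltW W) // weight_ge0.
  by rewrite ler_pdivrMr // mul1r lerDl weight_ge0.
have [nu0 nu0E'] := mixture_probability N1 N2 share01.
have nu0E A : nu0 A = ((fst_share R p q)%:E * pushforward muT (end_fst R T T') A +
    (1 - fst_share R p q)%:E * pushforward muT' (end_snd R T T') A)%E.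
  by rewrite nu0E' N1E N2E.
have ready := DL_ipvt_ready hp hq hT hT' hmuT hmuT' nu0E.
have bfst : range (end_fst R T T') `<=` dG.
  by move=> _ [w _ <-]; exact: end_fst_boundary hp hq hT hT' w.
have bsnd : range (end_snd R T T') `<=` dG.
  by move=> _ [w _ <-]; exact: end_snd_boundary hp hq hT hT' w.
exists (ln (maxn p q)%:R), nu0; split=> //.
- by move=> qp; rewrite (maxn_idPl qp).
- move=> qp; have share1 : fst_share R p q = 1.
    have w0 : weight R q p = 0 by exact: weight_eq0.
    have := total_weight_gt0 R hp hq.
    by rewrite /fst_share /total_weight w0 addr0 => W; rewrite divff // lt0r_neq0.
  have nuE A : nu0 A = pushforward muT (end_fst R T T') A.
    by rewrite nu0E share1 subrr mul1e mul0e adde0.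
  split=> //.
  + rewrite nuE /pushforward (_ : _ @^-1` _ = setT) ?probability_setT //.
    by apply/seteqP; split=> // w _; exists w.
  (* The same parameter serves, since [DL] and T have the same index ln p and hence the same delay
     intensity. *)
  move=> xi; exists xi => d1 Om1 P1 C1 d2 Om2 P2 C2; rewrite (maxn_idPl (ltnW qp)) in ready.
  by apply: (ipvt_projection hp hq hT hT' hmuT (nuG := nu0)) => // A _; apply: nuE.
- move=> pq; split=> // A _; rewrite nu0E.
  have -> : fst_share R p q = 2^-1.
    have := total_weight_gt0 R hp hq; rewrite /fst_share /total_weight -pq => W.
    by field; lra.
  have e : 1 - 2^-1 = 2^-1 :> R by lra.
  by rewrite e ge0_muleDr //; apply: measure_ge0.
move=> qp.
have cdiag : continuous (fun f : fspace (gspace R G) => (f, f)).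
  move=> f V [[A B] /= [nA nB] AB].
  by apply: filterS2 nA nB => h Ah Bh; apply: AB.
have [alpha alphaE] := pushforward_probability nu0 (borel_continuous_measurable cdiag).
split.
- by have := @DL_edge_growth R p q T T' hp hq hT hT'; rewrite (maxn_idPl qp).
- exact: extend_boundary cG (DL_irr hp hq hT hT') (DL_nonisolated hp hq hT hT') fG.
exists alpha.
- split; first rewrite alphaE /pushforward.
    have := nu0_boundary hp hq hT hT' nu0E; congr (nu0 _ = _).
    by apply/seteqP; split=> f; [split|move=> []].
  by apply: (alpha_cvg hp hq hT hT' hmuT hmuT' nu0E) => A; apply: alphaE.
move=> t /andP[t0 t1] A mA; rewrite /nu_ /pushforward alphaE /pushforward.
(* On the diagonal maximum and minimum coincide, and t < 1 gives t <= 2 - t, so that the added t is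
   subtracted again. *)
congr (nu0 _); apply/seteqP; split=> f /=; rewrite (_ : nucleus_map t (f, f) = extend f) //;
  apply/funext => z; rewrite /nucleus_map /= maxxx minxx (elimT min_idPl) ?addrK //; lra.
Qed.
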